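(* Let $r\ge 1$ be an integer and let $\mathbb{T}$ be a time scale with $a=\min\mathbb{T}$, $b=\max\mathbb{T}$, having at least $2r+1$ points, such that there are $a_1\in\mathbb{R}^+$ and $a_0\in\mathbb{R}$ with $\sigma(t)=a_1t+a_0$ for all $t\in[a,\rho(b)]_{\mathbb{T}}$. Let the Lagrangian $L(t,u_0,u_1,\ldots,u_r)$ have (standard) partial derivatives with respect to $u_0,\ldots,u_r$ and partial $\Delta$-derivative with respect to $t$ of order $r+1$. Consider the problem of minimizing $$\mathcal{L}[y(\cdot)]=\int_{a}^{\rho^{r-1}(b)} L\bigl(t,y^{\sigma^r}(t),y^{\sigma^{r-1}\Delta}(t),\ldots,y^{\sigma\Delta^{r-1}}(t),y^{\Delta^r}(t)\bigr)\Delta t$$ over $y\in \mathrm{C}^{2r}$ subject to the boundary conditions $y^{\Delta^i}(a)=y_a^i$ and $y^{\Delta^i}(\rho^{r-1}(b))=y_b^i$, $i=0,\ldots,r-1$, where $y_a^i,y_b^i$ are given real numbers. If $y_\ast\in\mathrm{C}^{2r}$ is a weak local minimum for this problem, then $y_\ast$ satisfies the Euler--Lagrange equation $$\sum_{i=0}^{r}(-1)^i\left(\frac{1}{a_1}\right)^{\frac{(i-1)i}{2}}L^{\Delta^i}_{u_i}\left(t,y_\ast^{\sigma^r}(t),y_\ast^{\sigma^{r-1}\Delta}(t),\ldots,y_\ast^{\sigma\Delta^{r-1}}(t),y_\ast^{\Delta^r}(t)\right)=0$$ for all $t\in[a,\rho^{2r}(b)]_{\mathbb{T}}$.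
   Context: A time scale $\mathbb{T}$ is a nonempty closed subset of $\mathbb{R}$; $[c,d]_{\mathbb{T}}=[c,d]\cap\mathbb{T}$. $\sigma(t)=\inf\{s\in\mathbb{T}:s>t\}$ (with $\inf\emptyset=\sup\mathbb{T}$), $\rho(t)=\sup\{s\in\mathbb{T}:s<t\}$ (with $\sup\emptyset=\inf\mathbb{T}$); $\sigma^i,\rho^i$ are $i$-fold iterates. $\mathbb{T}^\kappa$ is the set of $t\in\mathbb{T}$ that are non-maximal or left-dense ($\rho(t)=t$), and $\mathbb{T}^{\kappa^n}=(\mathbb{T}^{\kappa^{n-1}})^\kappa$. $f$ is $\Delta$-differentiable at $t\in\mathbb{T}^\kappa$ with derivative $f^\Delta(t)$ if for every $\varepsilon>0$ there is a neighborhood $U$ of $t$ in $\mathbb{T}$ with $|f(\sigma(t))-f(s)-f^\Delta(t)(\sigma(t)-s)|\le\varepsilon|\sigma(t)-s|$ for all $s\in U$; $f^{\Delta^n}=(f^{\Delta^{n-1}})^\Delta$, $f^{\Delta^0}=f$. $\int_c^d f(t)\Delta t=F(d)-F(c)$ where $F^\Delta=f$. $y^{\sigma^i}=y\circ\sigma^i$ and $y^{\sigma^i\Delta^j}=(y\circ\sigma^i)^{\Delta^j}$. $L_{u_i}$ is the partial derivative of $L$ with respect to $u_i$, and $L_{u_i}^{\Delta^i}(\ldots)$ denotes the $i$-th $\Delta$-derivative of the function $t\mapsto L_{u_i}(t,y_\ast^{\sigma^r}(t),\ldots,y_\ast^{\Delta^r}(t))$. $\mathrm{C}^{2r}=\{y:[a,b]_{\mathbb{T}}\to\mathbb{R}: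 y^{\Delta^{2r}}\text{ is continuous on }\mathbb{T}^{\kappa^{2r}}\}$. A function $y_\ast\in\mathrm{C}^{2r}$ satisfying the boundary conditions is a weak local minimum if there is $\delta>0$ with $\mathcal{L}[y_\ast]\le\mathcal{L}[y]$ for all $y\in\mathrm{C}^{2r}$ satisfying the boundary conditions with $\|y-y_\ast\|_{r,\infty}<\delta$, where $\|y\|_{r,\infty}=\sum_{i=0}^r\|y^{(i)}\|_\infty$, $y^{(i)}=y^{\sigma^i\Delta^{r-i}}$, $\|y\|_\infty=\sup_{t\in\mathbb{T}^{\kappa^r}}|y(t)|$.
   Formalization: The Lagrangian is assumed to have continuous mixed partial derivatives (standard in the u_i, Δ in t) of all total orders up to r+1; mere existence of the partial derivatives, as literally stated, makes the claim false. *)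

(* Defs.v *)
From mathcomp Require Import all_boot all_order all_algebra.
From mathcomp Require Import all_classical all_reals all_analysis.

Set Implicit Arguments.
Unset Strict Implicit.
Unset Printing Implicit Defensive.

Import Order.TTheory GRing.Theory Num.Theory.
Import numFieldNormedType.Exports.

Local Open Scope classical_set_scope.
Local Open Scope ring_scope.

Definition time_scale (R : realType) (T : set R) : Prop :=
  closed T /\ T !=set0.

Definition sigma (R : realType) (T : set R) (t : R) : R :=
  let A := [set s | T s /\ t < s] in
  if A == set0 then sup T else inf A.

Definition rho (R : realType) (T : set R) (t : R) : R :=
  let A := [set s | T s /\ s < t] in
  if A == set0 then inf T else sup A.

Definition kappa (R : realType) (T : set R) : set R :=
  [set t | T t /\ ((exists2 s, T s & t < s) \/ rho T t = t)].

Definition kappan (R : realType) (T : set R) (n : nat) : set R :=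
  iter n (@kappa R) T.

(* All functions on a time scale are represented by total functions on R, of
   which only the values on the time scale matter. *)
Definition is_delta_derive (R : realType) (T : set R) (f : R -> R) (t l : R) :
    Prop :=
  forall e : R, 0 < e -> \forall s \near within T (nbhs t),
    `|f (sigma T t) - f s - l * (sigma T t - s)| <= e * `|sigma T t - s|.

Definition delta_derivable (R : realType) (T : set R) (f : R -> R) (t : R) :
    Prop :=
  exists l : R, is_delta_derive T f t l.

(* Meaningful at the points of [kappa T] where [delta_derivable T f] holds. *)
Definition delta (R : realType) (T : set R) (f : R -> R) (t : R) : R :=
  get (is_delta_derive T f t).

(* The n-th derivative is a function on the time scale [kappan T n]; it is
   differentiated relatively to that time scale. *)
Fixpoint deltan (R : realType) (T : set R) (n : nat) (f : R -> R) : R -> R :=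
  if n is m.+1 then delta (kappan T m) (deltan T m f) else f.

Definition deltan_derivable (R : realType) (T : set R) (n : nat) (f : R -> R) :
    Prop :=
  forall m : nat, (m < n)%N -> forall t : R, kappan T m.+1 t ->
    delta_derivable (kappan T m) (deltan T m f) t.

Definition delta_C (R : realType) (T : set R) (n : nat) (y : R -> R) : Prop :=
  deltan_derivable T n y /\ {within kappan T n, continuous (deltan T n y)}.

Definition delta_antiderivative (R : realType) (T : set R) (f F : R -> R) :
    Prop :=
  forall t : R, kappa T t -> is_delta_derive T F t (f t).

(* Meaningful for f (defined on [kappa T]) having an antiderivative on T. *)
Definition delta_int (R : realType) (T : set R) (c d : R) (f : R -> R) : R :=
  get [set F d - F c | F in delta_antiderivative T f].

(* y^{sigma^i Delta^j} *)
Definition sigma_delta (R : realType) (T : set R) (i j : nat) (y : R -> R) :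
    R -> R :=
  deltan T j (y \o iter i (sigma T)).

(* Coordinate i is the argument substituted for the variable u_i. *)
Definition jet (R : realType) (T : set R) (r : nat) (y : R -> R) (t : R) :
    'rV[R]_r.+1 :=
  \row_(i < r.+1) sigma_delta T (r - i) i y t.

Definition partial_u (R : realType) (r : nat) (i : 'I_r.+1)
    (L : R -> 'rV[R]_r.+1 -> R) : R -> 'rV[R]_r.+1 -> R :=
  fun t u => 'D_(delta_mx 0 i) (L t) u.

Definition partial_t (R : realType) (T : set R) (r : nat)
    (L : R -> 'rV[R]_r.+1 -> R) : R -> 'rV[R]_r.+1 -> R :=
  fun t u => delta T (L ^~ u) t.

(* L, as a function on T x R^{r+1}, has continuous partial derivatives of all
   orders up to n, where each differentiation is either a standard one with
   respect to some u_i or a delta one with respect to t (which shrinks the time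
   scale T to [kappa T]). *)
Fixpoint lagrangian_C (R : realType) (r : nat) (n : nat) (T : set R)
    (L : R -> 'rV[R]_r.+1 -> R) : Prop :=
  {within T `*` [set: 'rV[R]_r.+1], continuous (fun p => L p.1 p.2)} /\
  (if n is m.+1 then
     (forall i : 'I_r.+1,
        (forall (t : R) (u : 'rV[R]_r.+1), T t ->
           derivable (L t) u (delta_mx 0 i)) /\
        lagrangian_C m T (partial_u i L)) /\
     (forall (t : R) (u : 'rV[R]_r.+1), kappa T t ->
        delta_derivable T (L ^~ u) t) /\
     lagrangian_C m (kappa T) (partial_t T L)
   else True).

(* The integrand is a function on [kappan T r], that is, on
   [kappa (kappan T r.-1)], and rho^{r-1}(b) is the maximum of
   [kappan T r.-1]: the antiderivative is taken on that time scale. *)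
Definition functional (R : realType) (T : set R) (a b : R) (r : nat)
    (L : R -> 'rV[R]_r.+1 -> R) (y : R -> R) : R :=
  delta_int (kappan T r.-1) a (iter r.-1 (rho T) b)
    (fun t => L t (jet T r y t)).

Definition boundary_conditions (R : realType) (T : set R) (a b : R) (r : nat)
    (ya yb : 'I_r -> R) (y : R -> R) : Prop :=
  forall i : 'I_r, deltan T i y a = ya i /\
                   deltan T i y (iter r.-1 (rho T) b) = yb i.

(* The suprema are finite for y of class C^r when sigma is affine. *)
Definition norm_r (R : realType) (T : set R) (r : nat) (y : R -> R) : R :=
  \sum_(i < r.+1) sup [set `|sigma_delta T i (r - i) y t| | t in kappan T r].

Definition weak_local_min (R : realType) (T : set R) (a b : R) (r : nat)
    (L : R -> 'rV[R]_r.+1 -> R) (ya yb : 'I_r -> R) (ystar : R -> R) : Prop :=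
  [/\ delta_C T (2 * r) ystar,
      boundary_conditions T a b ya yb ystar
    & exists2 d : R, 0 < d &
        forall y : R -> R,
          delta_C T (2 * r) y -> boundary_conditions T a b ya yb y ->
          norm_r T r (y \- ystar) < d ->
          functional T a b L ystar <= functional T a b L y].

(* Main.v *)
Require Import Defs.
From mathcomp Require Import all_boot all_order all_algebra.
From mathcomp Require Import all_classical all_reals all_analysis.
From mathcomp Require Import measurable_realfun.
From mathcomp Require Import ring lra zify.
Import Order.TTheory GRing.Theory Num.Theory.
Import numFieldNormedType.Exports.
Local Open Scope classical_set_scope.
Local Open Scope ring_scope.

Set Implicit Arguments.
Unset Strict Implicit.
Unset Printing Implicit Defensive.

(** Write [A t = a1 t + a0]. Because sigma coincides with the continuous map
    [A], a point that is dense on one side is fixed by [A], and a fixed point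
    is a limit point ([affine_scale_compact]). An affine map other than the
    identity has at most one fixed point, so there are two kinds of time scale.
    If [A] is the identity, every point is a limit point and the calculus is
    the ordinary one. Otherwise all points but at most one, called [p] below,
    are isolated.

    The two kinds share the first variation ([first_variation]). Since [L] is
    strictly differentiable in [u], locally uniformly in [t]
    ([uniform_strict_diff]), and the set of integration is compact, the
    integrand along [y + e h] is [L + e Phi] up to [o(e)], uniformly in [t]; the
    mean value inequality ([delta_mean_value]) carries this over to integrals.
    Hence every antiderivative [B] of [Phi] takes the same value at both ends.
    Antiderivatives of continuous functions exist, as Lebesgue integrals of a
    step extension ([exists_delta_antiderivative]).

    Regularity. In the scattered case every function is Delta-differentiable at
    an isolated point, and the Delta-derivative is the quotient
    [(f (A t) - f t) / (A t - t)]. At [p] we have [A t - p = a1 (t - p)], so this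
    quotient sends polynomials in [t - p] to polynomials and lowers orders by
    one. Thus [f] is [n] times differentiable at [p] iff it has a Peano
    expansion [f t = P (t - p) + o(|t - p|^n)] ([deltan_derivable_peano],
    [peano_delta_C]). Such expansions pass to [t |-> g t (x t)]
    ([peano_lagrangian]): replace [x] by its Taylor polynomial, and expand
    [g t (x s)] in powers of [s - p] with coefficients that are functions of [t].
    When [A] is the identity, the usual chain and product rules suffice
    ([delta_C_lagrangian]).

    The equation. At a point [t] of the scattered case that is not fixed, take
    for [h] the indicator of [A^r t]. Then [Phi] lives on the orbit
    [t, A t, .., A^r t], so its integral is a finite sum, and [r] summations by
    parts turn it into the Euler-Lagrange expression at [t]
    ([orbit_sum_parts]). Moving a Delta-derivative past a shift by [sigma]
    costs a factor [a1]; with [j] derivatives left the factor is [1 / a1 ^ j],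
    and [0 + 1 + .. + (i - 1) = (i - 1) i / 2] is the exponent in the equation.
    The point [p] follows by continuity. In the dense case [h] is a bump
    function around a point where the expression does not vanish, and
    integration by parts yields a contradiction
    ([euler_lagrange_dense_interior]). *)

(** * Points of a time scale and Delta-derivatives *)

Definition cont_at (R : realType) (K : set R) (f : R -> R) (t : R) : Prop :=
  forall e : R, 0 < e -> exists2 d : R, 0 < d &
    forall s, K s -> `|s - t| < d -> `|f s - f t| <= e.

Lemma within_nearP (R : realType) (K : set R) (t : R) (P : R -> Prop) :
  (\forall s \near within K (nbhs t), P s) <->
  exists2 d : R, 0 < d & forall s, K s -> `|s - t| < d -> P s.
Proof.
rewrite /prop_near1 /within /= -nbhs_ballE; split=> [[d /= d0 H]|[d d0 H]].
  exists d => // s Ks sd; apply: H => //=.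
  by rewrite /ball /= distrC.
exists d => //= s sd Ks; apply: H => //.
by move: sd; rewrite /ball /= distrC.
Qed.

Lemma is_delta_deriveP (R : realType) (K : set R) (f : R -> R) (t l : R) :
  is_delta_derive K f t l <->
  forall e : R, 0 < e -> exists2 d : R, 0 < d & forall s, K s -> `|s - t| < d ->
    `|f (sigma K t) - f s - l * (sigma K t - s)| <= e * `|sigma K t - s|.
Proof.
by split=> H e e0; have /within_nearP := H e e0.
Qed.

Lemma within_continuousP (R : realType) (K : set R) (f : R -> R) :
  {within K, continuous f} <-> forall t, K t -> cont_at K f t.
Proof.
rewrite subspace_continuousP; split=> H t Kt.
  move=> e e0; have /cvgrPdist_le/(_ e e0)/within_nearP[d d0 Hd] := H t Kt.
  by exists d => // s Ks sd; rewrite distrC; exact: Hd.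
apply/cvgrPdist_le => e e0; apply/within_nearP.
have [d d0 Hd] := H t Kt e e0.
by exists d => // s Ks sd; rewrite distrC; exact: Hd.
Qed.

Lemma limit_pointP_dist (R : realType) (K : set R) (t : R) :
  limit_point K t <->
  forall d : R, 0 < d -> exists s, [/\ K s, s != t & `|s - t| < d].
Proof.
split=> [H d d0|H U].
  have /H[s [st Ks]] : nbhs t (ball t d) by exact: nbhsx_ballx.
  by rewrite /ball /= distrC => sd; exists s.
rewrite -nbhs_ballE => -[d /= d0 HU].
have [s [Ks st sd]] := H d d0.
by exists s; split => //; apply: HU; rewrite /ball /= distrC.
Qed.

Lemma not_limit_pointP (R : realType) (K : set R) (t : R) :
  ~ limit_point K t ->
  exists2 d : R, 0 < d & forall s, K s -> `|s - t| < d -> s = t.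
Proof.
move=> /limit_pointP_dist/existsNP[d /not_implyP[d0 /forallNP H]].
exists d => // s Ks sd; apply: contrapT => /eqP st; exact: (H s).
Qed.

Lemma closed_dist (R : realType) (K : set R) (m : R) : closed K ->
  (forall e : R, 0 < e -> exists2 s, K s & `|s - m| < e) -> K m.
Proof.
move=> cK H; apply: cK => U; rewrite -nbhs_ballE => -[e /= e0 HU].
have [s Ks se] := H e e0.
by exists s; split=> //; apply: HU; rewrite /ball /= distrC.
Qed.

Lemma sigma_adherent (R : realType) (K : set R) (t s0 : R) : K s0 -> t < s0 ->
  [/\ t <= sigma K t, (forall s, K s -> t < s -> sigma K t <= s) &
  forall e : R, 0 < e -> exists s, [/\ K s, t < s, sigma K t <= s & s < sigma K t + e]].
Proof.
move=> Ks0 ts0; rewrite /sigma; set A := [set s | K s /\ t < s].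
have A0 : A !=set0 by exists s0.
have lA : lbound A t by move=> s [_ /ltW].
have -> : (A == set0) = false by apply/negbTE/set0P.
have hA : has_inf A by split => //; exists t.
have iA s : K s -> t < s -> inf A <= s.
  by move=> Ks ts; apply: ge_inf => //; exists t.
split=> //; first exact: lb_le_inf.
move=> e e0; have [s [Ks ts] se] := inf_adherent e0 hA.
by exists s; split => //; exact: iA.
Qed.

Lemma sigma_ge (R : realType) (K : set R) (t s0 : R) : K s0 -> t < s0 -> t <= sigma K t.
Proof. by move=> Ks0 /(sigma_adherent Ks0)[]. Qed.

Lemma sigma_in (R : realType) (K : set R) (t s0 : R) : closed K -> K s0 -> t < s0 ->
  K (sigma K t).
Proof.
move=> cK Ks0 /(sigma_adherent Ks0)[_ _ H]; apply: closed_dist => // e e0.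
have [s [Ks ts ss se]] := H e e0.
exists s => //; rewrite ger0_norm ?subr_ge0//; lra.
Qed.

Lemma sigma_max (R : realType) (K : set R) (t : R) : K t -> (forall s, K s -> s <= t) ->
  sigma K t = t.
Proof.
move=> Kt ub; rewrite /sigma; case: ifPn => [_|/set0P[s [Ks ts]]].
  apply/eqP; rewrite eq_le; apply/andP; split.
    by apply: ge_sup; [exists t|move=> s /ub].
  by apply: ub_le_sup => //; exists t => s /ub.
by have := ub s Ks; rewrite leNgt ts.
Qed.

Lemma rho_adherent (R : realType) (K : set R) (t s0 : R) : K s0 -> s0 < t ->
  [/\ rho K t <= t, (forall s, K s -> s < t -> s <= rho K t) &
  forall e : R, 0 < e -> exists s, [/\ K s, s < t, s <= rho K t & rho K t - e < s]].
Proof.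
move=> Ks0 ts0; rewrite /rho; set A := [set s | K s /\ s < t].
have A0 : A !=set0 by exists s0.
have lA : ubound A t by move=> s [_ /ltW].
have -> : (A == set0) = false by apply/negbTE/set0P.
have hA : has_sup A by split => //; exists t.
have iA s : K s -> s < t -> s <= sup A.
  by move=> Ks ts; apply: ub_le_sup => //; exists t.
split=> //; first exact: ge_sup.
move=> e e0; have [s [Ks ts] se] := sup_adherent e0 hA.
by exists s; split => //; exact: iA.
Qed.

Lemma rho_min (R : realType) (K : set R) (t : R) : K t -> (forall s, K s -> t <= s) ->
  rho K t = t.
Proof.
move=> Kt lb; rewrite /rho; case: ifPn => [_|/set0P[s [Ks ts]]].
  apply/eqP; rewrite eq_le; apply/andP; split.
    by apply: ge_inf => //; exists t => s /lb.
  by apply: lb_le_inf; [exists t|move=> s /lb].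
by have := lb s Ks; rewrite leNgt ts.
Qed.

Lemma rho_left_dense (R : realType) (K : set R) (t : R) :
  (forall e : R, 0 < e -> exists s, [/\ K s, s < t & t - e < s]) -> rho K t = t.
Proof.
move=> H; have [s0 [Ks0 s0t _]] := H 1 ltr01.
have [r1 r2 _] := rho_adherent Ks0 s0t.
apply/eqP; rewrite eq_le r1/= leNgt; apply/negP => rt.
have [|s [Ks st]] := H (t - rho K t); first by rewrite subr_gt0.
have := r2 _ Ks st; lra.
Qed.

Lemma left_scattered (R : realType) (K : set R) (t : R) : rho K t <> t ->
  exists2 d : R, 0 < d & forall s, K s -> s < t -> s <= t - d.
Proof.
move=> rt.
have [[s0 Ks0 s0t]|H] := pselect (exists2 s0, K s0 & s0 < t); last first.
  by exists 1 => // s Ks st; exfalso; apply: H; exists s.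
have [r1 r2 _] := rho_adherent Ks0 s0t.
exists (t - rho K t); first by rewrite subr_gt0 lt_neqAle r1 andbT; apply/eqP.
by move=> s Ks st; rewrite subKr; exact: r2.
Qed.

Lemma not_kappa (R : realType) (K : set R) (t : R) : K t -> ~ kappa K t ->
  (forall s, K s -> s <= t) /\
  exists2 d : R, 0 < d & forall s, K s -> s < t -> s <= t - d.
Proof.
move=> Kt nk; split; last first.
  by apply: left_scattered => // rt; apply: nk; split => //; right.
move=> s Ks; rewrite leNgt; apply/negP => ts; apply: nk; split => //.
by left; exists s.
Qed.

(** Passing from [K] to [kappa K] removes at most a point that is isolated and
    maximal, so local statements at points of [kappa K] do not see the difference. *)
Lemma kappa_near (R : realType) (K : set R) (t : R) : kappa K t ->
  exists2 d : R, 0 < d & forall s, K s -> `|s - t| < d -> kappa K s.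
Proof.
move=> kt; have [[s0 [Ks0 nk]]|H] := pselect (exists s0, K s0 /\ ~ kappa K s0).
  have [ub [d d0 Hd]] := not_kappa Ks0 nk.
  have ts0 : t < s0.
    have := ub t (proj1 kt); rewrite le_eqVlt => /predU1P[ts|//].
    by case: nk; rewrite -ts.
  exists (s0 - t); first by rewrite subr_gt0.
  move=> s Ks sd; split => //; left; exists s0 => //.
  move: sd; rewrite ltr_norml; lra.
exists 1 => // s Ks _; apply: contrapT => nk; apply: H; by exists s.
Qed.

(** The defining inequality at [s] and at [t] itself bounds [f s - f t]; the bound
    contains the fixed length [sigma t - t], whence the choice of the tolerance. *)
Lemma is_delta_derive_cont (R : realType) (K : set R) f (t l : R) : K t ->
  is_delta_derive K f t l -> cont_at K f t.
Proof.
move=> Kt /is_delta_deriveP H e e0.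
set z := sigma K t in H.
set m := `|z - t|.
have m0 : 0 <= m by exact: normr_ge0.
have k0 : 0 < 4 * (2 * m + 1) by lra.
have [d d0 Hd] := H (e / (4 * (2 * m + 1))) (divr_gt0 e0 k0).
pose d' := Num.min (Num.min d 1) (e / (2 * (`|l| + 1))).
have l0 : 0 < 2 * (`|l| + 1) by have := normr_ge0 l; lra.
have d'0 : 0 < d' by rewrite !lt_min d0 ltr01 divr_gt0.
exists d' => // s Ks; rewrite !lt_min => /andP[/andP[sd s1] se].
have h1 := Hd t Kt; rewrite subrr normr0 in h1; have {}h1 := h1 d0.
have h2 := Hd s Ks sd.
rewrite -/m in h1.
have h3 : `|z - s| <= m + 1.
  have -> : z - s = (z - t) - (s - t) by ring.
  by apply: (le_trans (ler_normB _ _)); rewrite lerD2l ltW.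
set q := e / (4 * (2 * m + 1)) in h1 h2.
have q0 : 0 < q by rewrite divr_gt0.
have qe : q * (2 * m + 1) = e / 4 by rewrite /q; field; lra.
have -> : f s - f t = (f z - f t - l * (z - t)) - (f z - f s - l * (z - s)) + l * (s - t).
  by ring.
apply: (le_trans (ler_normD _ _)).
have h4 : `|l * (s - t)| <= e / 2.
  rewrite normrM; apply: (@le_trans _ _ ((`|l| + 1) * (e / (2 * (`|l| + 1))))).
    by apply: ler_pM => //; [lra|exact: ltW].
  by rewrite le_eqVlt; apply/orP; left; apply/eqP; field; have := normr_ge0 l; lra.
have h5 := ler_normB (f z - f t - l * (z - t)) (f z - f s - l * (z - s)).
have h6 : q * `|z - s| <= q * (m + 1) by rewrite ler_pM2l.
have : q * m + q * (m + 1) = e / 4 by rewrite -qe; ring.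
lra.
Qed.

Lemma is_delta_derive_scattered (R : realType) (K : set R) f (t l : R) : K t ->
  sigma K t <> t -> is_delta_derive K f t l ->
  l = (f (sigma K t) - f t) / (sigma K t - t).
Proof.
move=> Kt /eqP st /is_delta_deriveP H.
set z := sigma K t in st H *.
have m0 : 0 < `|z - t| by rewrite normr_gt0 subr_eq0.
have zt : z - t != 0 by rewrite subr_eq0.
have : f z - f t - l * (z - t) = 0.
  apply/eqP; rewrite -normr_le0; apply/ler_addgt0Pr => e e0.
  have [d d0 Hd] := H (e / `|z - t|) (divr_gt0 e0 m0).
  have := Hd t Kt; rewrite subrr normr0 => /(_ d0).
  by rewrite add0r divfK ?gt_eqF.
by move=> h; apply: (mulIf zt); rewrite divfK//; apply/eqP; rewrite eq_sym -subr_eq0; apply/eqP.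
Qed.

Lemma isolated_is_delta_derive (R : realType) (K : set R) f (t : R) :
  sigma K t <> t -> ~ limit_point K t ->
  is_delta_derive K f t ((f (sigma K t) - f t) / (sigma K t - t)).
Proof.
move=> /eqP st /not_limit_pointP[d d0 Hd]; apply/is_delta_deriveP => e e0.
exists d => // s Ks sd; rewrite (Hd s Ks sd) divfK ?subr_eq0// subrr normr0.
by rewrite mulr_ge0// ltW.
Qed.

(** The points where the Delta-derivative is unique: at an isolated fixed point of
    sigma every number is a derivative. *)
Definition regular (R : realType) (K : set R) (t : R) : Prop :=
  sigma K t <> t \/ limit_point K t.

Lemma is_delta_derive_unique (R : realType) (K : set R) f (t l l' : R) : K t ->
  regular K t -> is_delta_derive K f t l -> is_delta_derive K f t l' -> l = l'.
Proof.
move=> Kt rg; have [st|st] := pselect (sigma K t = t); last first.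
  move=> h1 h2.
  by rewrite (is_delta_derive_scattered Kt st h1) -(is_delta_derive_scattered Kt st h2).
case: rg => // /limit_pointP_dist lp /is_delta_deriveP h1 /is_delta_deriveP h2.
rewrite st in h1 h2.
apply/eqP; rewrite -subr_eq0 -normr_le0; apply/ler_addgt0Pr => e e0.
have e20 : 0 < e / 2 by rewrite divr_gt0.
have [d1 d10 {}h1] := h1 _ e20.
have [d2 d20 {}h2] := h2 _ e20.
have [|s [Ks sne]] := lp (Num.min d1 d2); first by rewrite lt_min d10.
rewrite lt_min => /andP[/(h1 _ Ks) {}h1 /(h2 _ Ks) {}h2].
have ts : 0 < `|t - s| by rewrite normr_gt0 subr_eq0 eq_sym.
rewrite add0r -(ler_pM2r ts) -normrM.
have -> : (l - l') * (t - s) = (f t - f s - l' * (t - s)) - (f t - f s - l * (t - s)) by ring.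
apply: (le_trans (ler_normB _ _)).
apply: (le_trans (lerD h2 h1)); rewrite le_eqVlt; apply/orP; left; apply/eqP; by field.
Qed.

Lemma deltaP (R : realType) (K : set R) f (t : R) :
  delta_derivable K f t -> is_delta_derive K f t (delta K f t).
Proof. by move=> [l h]; apply: (@getPex _ (is_delta_derive K f t)); exists l. Qed.

Lemma deltaE (R : realType) (K : set R) f (t l : R) : K t -> regular K t ->
  is_delta_derive K f t l -> delta K f t = l.
Proof.
move=> Kt rg h; apply: (is_delta_derive_unique Kt rg _ h).
by apply: deltaP; exists l.
Qed.

(** The value at [sigma t] has to be assumed, since [sigma t] need not be near [t]. *)
Lemma is_delta_derive_near (R : realType) (K : set R) f g (t l d : R) : 0 < d ->
  f (sigma K t) = g (sigma K t) ->
  (forall s, K s -> `|s - t| < d -> f s = g s) ->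
  is_delta_derive K f t l -> is_delta_derive K g t l.
Proof.
move=> d0 fgz fg /is_delta_deriveP h; apply/is_delta_deriveP => e e0.
have [d' d'0 {}h] := h e e0.
exists (Num.min d d'); first by rewrite lt_min d0.
move=> s Ks; rewrite lt_min => /andP[sd sd'].
by rewrite -fgz -fg//; exact: h.
Qed.

Lemma is_delta_derive_eq (R : realType) (K : set R) f g (t l : R) :
  K (sigma K t) -> (forall s, K s -> f s = g s) ->
  is_delta_derive K f t l -> is_delta_derive K g t l.
Proof.
by move=> Kz fg; apply: (@is_delta_derive_near _ _ _ _ _ _ 1) => // [|s Ks _]; exact: fg.
Qed.

Lemma is_delta_derive_lin (R : realType) (K : set R) f g (t l l' c : R) :
  is_delta_derive K f t l -> is_delta_derive K g t l' ->
  is_delta_derive K (fun s => f s + c * g s) t (l + c * l').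
Proof.
move=> /is_delta_deriveP h1 /is_delta_deriveP h2; apply/is_delta_deriveP => e e0.
have k0 : 0 < 2 * (`|c| + 1) by have := normr_ge0 c; lra.
have [d1 d10 {}h1] := h1 _ (divr_gt0 e0 (ltr0n _ 2)).
have [d2 d20 {}h2] := h2 _ (divr_gt0 e0 k0).
exists (Num.min d1 d2); first by rewrite lt_min d10.
move=> s Ks; rewrite lt_min => /andP[/(h1 _ Ks) {}h1 /(h2 _ Ks) {}h2].
set z := sigma K t in h1 h2 *.
have -> : f z + c * g z - (f s + c * g s) - (l + c * l') * (z - s) =
  (f z - f s - l * (z - s)) + c * (g z - g s - l' * (z - s)) by ring.
apply: (le_trans (ler_normD _ _)); rewrite normrM.
have : `|c| * `|g z - g s - l' * (z - s)| <= (`|c| + 1) * (e / (2 * (`|c| + 1)) * `|z - s|).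
  by apply: ler_pM => //; lra.
have -> : (`|c| + 1) * (e / (2 * (`|c| + 1)) * `|z - s|) = e / 2 * `|z - s|.
  by field; have := normr_ge0 c; lra.
have -> : e * `|z - s| = e / 2 * `|z - s| + e / 2 * `|z - s| by field.
by move=> h3; exact: lerD.
Qed.

Lemma is_delta_derive_cst (R : realType) (K : set R) (t k : R) :
  is_delta_derive K (fun=> k) t 0.
Proof.
apply/is_delta_deriveP => e e0; exists 1 => // s _ _.
by rewrite subrr mul0r subrr normr0 mulr_ge0// ltW.
Qed.

Lemma is_delta_derive_id (R : realType) (K : set R) (t : R) :
  is_delta_derive K id t 1.
Proof.
apply/is_delta_deriveP => e e0; exists 1 => // s _ _.
by rewrite mul1r subrr normr0 mulr_ge0// ltW.
Qed.

Lemma is_delta_derive_mulr (R : realType) (K : set R) f (t l c : R) :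
  is_delta_derive K f t l -> is_delta_derive K (fun s => c * f s) t (c * l).
Proof.
move=> h; have := is_delta_derive_lin c (is_delta_derive_cst K t 0) h.
by rewrite add0r; under eq_fun do rewrite add0r.
Qed.

Lemma is_delta_derive_add (R : realType) (K : set R) f g (t l l' : R) :
  is_delta_derive K f t l -> is_delta_derive K g t l' ->
  is_delta_derive K (fun s => f s + g s) t (l + l').
Proof.
move=> h1 h2; have := is_delta_derive_lin 1 h1 h2.
by rewrite mul1r; under eq_fun do rewrite mul1r.
Qed.

Lemma is_delta_derive_sum (R : realType) (I : Type) (r : seq I) (K : set R)
    (f : I -> R -> R) (l : I -> R) (t : R) :
  (forall i, is_delta_derive K (f i) t (l i)) ->
  is_delta_derive K (fun s => \sum_(i <- r) f i s) t (\sum_(i <- r) l i).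
Proof.
move=> h; elim: r => [|i r IH].
  under eq_fun do rewrite big_nil.
  by rewrite big_nil; exact: is_delta_derive_cst.
under eq_fun do rewrite big_cons.
by rewrite big_cons; exact: is_delta_derive_add.
Qed.

(** Only at a fixed point of sigma: elsewhere the product rule contains the shifted
    value of one factor. *)
Lemma is_delta_derive_mul (R : realType) (K : set R) f g (t l l' : R) : K t ->
  sigma K t = t ->
  is_delta_derive K f t l -> is_delta_derive K g t l' ->
  is_delta_derive K (fun s => f s * g s) t (l * g t + f t * l').
Proof.
move=> Kt st h1 h2; have cg := is_delta_derive_cont Kt h2.
move: h1 h2 => /is_delta_deriveP h1 /is_delta_deriveP h2; apply/is_delta_deriveP => e e0.
rewrite st in h1 h2 *.
pose a := 3 * (`|g t| + 1); pose b := 3 * (`|f t| + 1); pose c := 3 * (`|l| + 1).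
have a0 : 0 < a by rewrite /a; have := normr_ge0 (g t); lra.
have b0 : 0 < b by rewrite /b; have := normr_ge0 (f t); lra.
have c0 : 0 < c by rewrite /c; have := normr_ge0 l; lra.
have [d1 d10 {}h1] := h1 _ (divr_gt0 e0 a0).
have [d2 d20 {}h2] := h2 _ (divr_gt0 e0 b0).
have m0 : 0 < Num.min 1 (e / c) by rewrite lt_min ltr01 divr_gt0.
have [d3 d30 h3] := cg _ m0.
exists (Num.min (Num.min d1 d2) d3); first by rewrite !lt_min d10 d20.
move=> s Ks; rewrite !lt_min => /andP[/andP[/(h1 _ Ks) {}h1 /(h2 _ Ks) {}h2]] /(h3 _ Ks).
rewrite le_min => /andP[h31 h32].
have -> : f t * g t - f s * g s - (l * g t + f t * l') * (t - s) =
  (f t - f s - l * (t - s)) * g s + f t * (g t - g s - l' * (t - s))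
  + l * (t - s) * (g s - g t) by ring.
have hg : `|g s| <= `|g t| + 1.
  rewrite -[g s](subrK (g t)); apply: (le_trans (ler_normD _ _)); lra.
have k1 : `|(f t - f s - l * (t - s)) * g s| <= e / 3 * `|t - s|.
  rewrite normrM; have -> : e / 3 * `|t - s| = (e / a * `|t - s|) * (`|g t| + 1).
    by rewrite /a; field; have := normr_ge0 (g t); lra.
  exact: ler_pM.
have k2 : `|f t * (g t - g s - l' * (t - s))| <= e / 3 * `|t - s|.
  rewrite normrM; have -> : e / 3 * `|t - s| = (`|f t| + 1) * (e / b * `|t - s|).
    by rewrite /b; field; have := normr_ge0 (f t); lra.
  by apply: ler_pM => //; lra.
have k3 : `|l * (t - s) * (g s - g t)| <= e / 3 * `|t - s|.
  rewrite !normrM; have -> : e / 3 * `|t - s| = (`|l| + 1) * `|t - s| * (e / c).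
    by rewrite /c; field; have := normr_ge0 l; lra.
  by apply: ler_pM => //; apply: ler_wpM2r => //; lra.
have -> : e * `|t - s| = e / 3 * `|t - s| + e / 3 * `|t - s| + e / 3 * `|t - s| by field.
apply: (le_trans (ler_normD _ _)); apply: lerD => //.
by apply: (le_trans (ler_normD _ _)); apply: lerD.
Qed.

(** * Mean value inequality and antiderivatives *)

(** For [e > 0], let [m] be the supremum of the points [u] of [K] in [[c, d]] with
    [H c <= H u + e (u - c)]. Continuity puts [m] into this set, and if [m < d]
    the derivative at [m] yields a larger point of it: [sigma m] if [m] is
    right-scattered, a nearby point otherwise. *)
Lemma delta_nondecreasing (R : realType) (K : set R) (H h : R -> R) (c d : R) :
  closed K -> K c -> K d -> c <= d ->
  (forall u, kappa K u -> c <= u <= d -> is_delta_derive K H u (h u) /\ 0 <= h u) ->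
  H c <= H d.
Proof.
move=> cK Kc Kd cd hH.
suff main (e : R) : 0 < e -> H c <= H d + e * (d - c).
  apply/ler_addgt0Pr => e e0.
  have k0 : 0 < d - c + 1 by lra.
  have := main (e / (d - c + 1)) (divr_gt0 e0 k0).
  have : e / (d - c + 1) * (d - c) <= e.
    by rewrite -[X in _ <= X](divfK (lt0r_neq0 k0)) ler_pM2l ?divr_gt0//; lra.
  lra.
move=> e0.
pose W := [set u | [/\ K u, c <= u, u <= d & H c <= H u + e * (u - c)]].
have Wc : W c by split=> //; rewrite subrr mulr0 addr0.
have hW : has_sup W by split; [exists c|exists d => u []].
set m := sup W.
have cm : c <= m by apply: ub_le_sup => //; exists d => u [].
have md : m <= d by apply: ge_sup; [exists c|move=> u []].
have um u : W u -> u <= m by move=> Wu; apply: ub_le_sup => //; exists d => v [].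
have adh (q : R) : 0 < q -> exists2 u, W u & m - q < u by move=> q0; exact: sup_adherent.
have Km : K m.
  apply: closed_dist => // q q0; have [u Wu mu] := adh _ q0.
  exists u; first by case: Wu.
  by rewrite ltr_distl; have := um _ Wu; lra.
have Wm : W m.
  apply: contrapT => nW.
  have km : kappa K m.
    split=> //; right; apply: rho_left_dense => q q0.
    have [u Wu mu] := adh _ q0; exists u; split => //; first by case: Wu.
    rewrite lt_neqAle um// andbT; apply/eqP => umE; apply: nW; by rewrite -umE.
  have cmd : c <= m <= d by rewrite cm.
  have cH := is_delta_derive_cont Km (hH _ km cmd).1.
  apply: nW; split => //; apply/ler_addgt0Pr => q q0.
  have [d1 d10 Hd1] := cH _ q0.
  have [u Wu mu] := adh _ d10.
  have umu := um _ Wu; case: Wu => Ku cu ud Hu.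
  have := Hd1 _ Ku; rewrite ltr_distl => /(_ _)/wrap[]; first lra.
  rewrite ler_distl => /andP[_ h1].
  have : e * (u - c) <= e * (m - c) by rewrite ler_pM2l//; lra.
  lra.
have [->|mneqd] := eqVneq d m; first by case: Wm.
have mltd : m < d by rewrite lt_neqAle eq_sym mneqd.
have km : kappa K m by split => //; left; exists d.
have cmd : c <= m <= d by rewrite cm.
have [dH h0] := hH _ km cmd.
have [s1 s2 s3] := sigma_adherent Kd mltd.
have [_ _ _ Wm4] := Wm.
have [sm|sm] := eqVneq (sigma K m) m; last first.
  have sm' : m < sigma K m by rewrite lt_neqAle eq_sym sm.
  have Ks := sigma_in cK Kd mltd.
  have hE := is_delta_derive_scattered Km (elimN eqP sm) dH.
  have : W (sigma K m).
    split=> //; [lra|exact: s2|].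
    have : 0 <= h m * (sigma K m - m) by rewrite mulr_ge0//; lra.
    rewrite hE divfK ?subr_eq0// => h1.
    have : e * (m - c) <= e * (sigma K m - c) by rewrite ler_pM2l//; lra.
    lra.
  by move/um; rewrite leNgt sm'.
move: dH => /is_delta_deriveP/(_ _ e0)[d1 d10 Hd1].
rewrite sm in s3 Hd1.
have q0 : 0 < Num.min d1 (d - m) by rewrite lt_min d10 subr_gt0.
have [s [Ks ms _]] := s3 _ q0.
rewrite -ltrBlDl lt_min => /andP[sd1 sdm].
have := Hd1 _ Ks; rewrite gtr0_norm ?subr_gt0// => /(_ sd1).
rewrite [X in _ <= _ * X]distrC [X in _ <= _ * X]gtr0_norm ?subr_gt0// ler_distl => /andP[_ h1].
have hms : 0 <= h m * (s - m) by rewrite mulr_ge0//; lra.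
have : W s.
  split=> //; [lra|lra|].
  have -> : e * (s - c) = e * (m - c) + e * (s - m) by ring.
  have : h m * (m - s) = - (h m * (s - m)) by ring.
  lra.
by move/um; rewrite leNgt ms.
Qed.

Lemma delta_mean_value (R : realType) (K : set R) (H h : R -> R) (c d C : R) :
  closed K -> K c -> K d -> c <= d ->
  (forall u, kappa K u -> c <= u <= d -> is_delta_derive K H u (h u) /\ `|h u| <= C) ->
  `|H d - H c| <= C * (d - c).
Proof.
move=> cK Kc Kd cd hH.
have idd u := is_delta_derive_mulr C (is_delta_derive_id K u).
have h1 : C * c + 1 * H c <= C * d + 1 * H d.
  apply: (@delta_nondecreasing _ K (fun s => C * s + 1 * H s) (fun u => C * 1 + 1 * h u)) => // u ku cud.
  have [dH] := hH u ku cud; rewrite ler_norml => /andP[h1 h2].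
  by split; [exact: is_delta_derive_lin|lra].
have h2 : C * c + (-1) * H c <= C * d + (-1) * H d.
  apply: (@delta_nondecreasing _ K (fun s => C * s + (-1) * H s) (fun u => C * 1 + (-1) * h u)) => // u ku cud.
  have [dH] := hH u ku cud; rewrite ler_norml => /andP[h2 h3].
  by split; [exact: is_delta_derive_lin|lra].
rewrite ler_norml mulrBr; lra.
Qed.

(** Two antiderivatives differ by a function with zero derivative, which the mean
    value inequality shows to be constant. *)
Lemma delta_intE (R : realType) (K : set R) (f F : R -> R) (c d : R) :
  closed K -> K c -> K d -> c <= d -> delta_antiderivative K f F ->
  delta_int K c d f = F d - F c.
Proof.
move=> cK Kc Kd cd aF; rewrite /delta_int.
have : [set G d - G c | G in delta_antiderivative K f] (get [set G d - G c | G in delta_antiderivative K f]).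
  by apply: getPex; exists (F d - F c); exists F.
move=> [G aG <-].
have := @delta_mean_value _ K (fun s => G s + (-1) * F s) (fun u => f u + (-1) * f u) c d 0 cK Kc Kd cd.
rewrite mul0r => /(_ _)/wrap[].
  move=> u ku _; split; first by apply: is_delta_derive_lin; [exact: aG|exact: aF].
  by rewrite mulN1r subrr normr0.
rewrite normr_le0 => /eqP; lra.
Qed.

Lemma rho_in (R : realType) (K : set R) (t s0 : R) : closed K -> K s0 -> s0 < t ->
  K (rho K t).
Proof.
move=> cK Ks0 /(rho_adherent Ks0)[_ _ H]; apply: closed_dist => // e e0.
have [s [Ks ts ss se]] := H e e0.
exists s => //; rewrite ler0_norm ?subr_le0//; lra.
Qed.

(** The maximum [b] is kept exactly when it is left-dense, that is when
    [rho K b = b]. *)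
Lemma kappa_setE (R : realType) (K : set R) (b : R) : closed K -> K b -> ubound K b ->
  [/\ kappa K = [set t | K t /\ t <= rho K b], K (rho K b) & rho K b <= b].
Proof.
move=> cK Kb ub.
have [rK rb rP] : [/\ K (rho K b), rho K b <= b & forall s, K s -> s < b -> s <= rho K b].
  have [[s0 Ks0 s0b]|H] := pselect (exists2 s, K s & s < b).
    by have [r1 r2 _] := rho_adherent Ks0 s0b; split => //; exact: (rho_in cK Ks0 s0b).
  have lb s : K s -> b <= s.
    by move=> Ks; rewrite leNgt; apply/negP => sb; apply: H; exists s.
  by rewrite (rho_min Kb lb); split => // s Ks; rewrite ltNge lb.
split => //; apply/seteqP; split => t /= [Kt].
  case=> [[s Ks ts]|rt]; split => //.
    by apply: rP => //; apply: (lt_le_trans ts); exact: ub.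
  have := ub _ Kt; rewrite le_eqVlt => /predU1P[tb|]; last exact: rP.
  by rewrite -tb rt.
move=> tr; split=> //; have := ub _ Kt; rewrite le_eqVlt => /predU1P[tb|tb].
  by right; move: tr; rewrite tb => tr; apply/eqP; rewrite eq_le rb.
by left; exists b.
Qed.

Lemma Rintegral_near_cst (R : realType) (g : R -> R) (s z c e : R) : s <= z ->
  (@lebesgue_measure R).-integrable `[s, z[ (EFin \o g) ->
  (forall u, s <= u < z -> `|g u - c| <= e) ->
  `|(\int[@lebesgue_measure R]_(u in `[s, z[) g u)%R - c * (z - s)| <= e * (z - s).
Proof.
move=> sz ig H.
have cst k : (@lebesgue_measure R).-integrable `[s, z[ (EFin \o cst k).
  apply: measurable_bounded_integrable => //; first by rewrite /= lebesgue_measure_itv /=; case: ifP; rewrite ltry.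
  by exists `|k|; split => [|x kx u _] /=; [exact: num_real|exact: ltW].
have cstE k : (\int[@lebesgue_measure R]_(u in `[s, z[) k)%R = k * (z - s).
  rewrite Rintegral_cst//= lebesgue_measure_itv /= lte_fin; case: ltP => //= zs.
  by rewrite (_ : s = z) ?subrr//; apply/eqP; rewrite eq_le sz zs.
have h1 : (c - e) * (z - s) <= (\int[@lebesgue_measure R]_(u in `[s, z[) g u)%R.
  rewrite -cstE; apply: le_Rintegral => //=; first exact: cst.
  move=> u; rewrite in_itv /= => /H.
  rewrite ler_distl; lra.
have h2 : (\int[@lebesgue_measure R]_(u in `[s, z[) g u)%R <= (c + e) * (z - s).
  rewrite -cstE; apply: le_Rintegral => //=; first exact: cst.
  move=> u; rewrite in_itv /= => /H.
  rewrite ler_distl; lra.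
by rewrite ler_distl -mulrBl -mulrDl h1 h2.
Qed.

(** Extend [f] to [[a, b[] as a step function, constant on the gaps of [K], by
    composing it with the monotone retraction [lam u = sup {s in K | s <= u}], and
    integrate. Monotonicity makes the extension measurable, and near [t] the
    extension differs little from [f t] on the whole of the interval between [s]
    and [sigma t]. *)
Lemma exists_delta_antiderivative (R : realType) (K : set R) (a b : R) (f : R -> R) :
  closed K -> K a -> lbound K a -> K b -> ubound K b ->
  {within kappa K, continuous f} -> exists F, delta_antiderivative K f F.
Proof.
move=> cK Ka la Kb ub cf.
have [kE rK rb] := kappa_setE cK Kb ub.
have ckK : closed (kappa K).
  rewrite kE; apply: closedI => //; exact: closed_le.
have kcK : compact (kappa K).
  apply: (subclosed_compact ckK (@segment_compact _ a b)) => t /= [Kt _].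
  by rewrite in_itv /= la// ub.
pose lam u := sup [set s | K s /\ s <= Num.max a u].
have hs u : has_sup [set s | K s /\ s <= Num.max a u].
  by split; [exists a; split => //; rewrite le_max lexx|exists b => s [/ub]].
have lam_ge u s : K s -> s <= u -> s <= lam u.
  move=> Ks su; apply: ub_le_sup; first by case: (hs u).
  by split => //; rewrite le_max su orbT.
have lam_le u : a <= u -> lam u <= u.
  move=> au; apply: ge_sup => [|s [_]]; first by case: (hs u).
  by rewrite max_r.
have lamK u : K (lam u).
  apply: closed_dist => // e e0; have [s [Ks su] se] := sup_adherent e0 (hs u).
  rewrite -/(lam u) in se.
  exists s => //; rewrite ler0_norm; first lra.
  by rewrite subr_le0; apply: ub_le_sup => //; case: (hs u).
have lam_nd : nondecreasing_fun lam.
  move=> u v uv; apply: ge_sup => [|s [Ks su]]; first by case: (hs u).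
  apply: ub_le_sup; first by case: (hs v).
  by split => //; apply: (le_trans su); rewrite ge_max !le_max lexx uv orbT.
have lamk u : a <= u < b -> kappa K (lam u).
  move=> /andP[au ub']; split => //; left; exists b => //.
  exact: le_lt_trans (lam_le _ au) ub'.
pose g := f \o lam.
have mg : measurable_fun `[a, b[ g.
  apply: (@measurable_comp _ _ _ _ _ _ (kappa K)).
  - exact: closed_measurable.
  - by move=> _ [u /= uab <-]; apply: lamk; move: uab; rewrite in_itv.
  - by apply: subspace_continuous_measurable_fun => //; exact: closed_measurable.
  - exact: nondecreasing_measurable.
have [M [_ HM]] := compact_bounded (continuous_compact cf kcK).
have ig : (@lebesgue_measure R).-integrable `[a, b[ (EFin \o g).
  apply: measurable_bounded_integrable => //.
    by rewrite /= lebesgue_measure_itv /=; case: ifP => _; rewrite ?ltry.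
  exists M; split; first exact: num_real.
  move=> x Mx u /=; rewrite in_itv /= => uab; apply: (HM x Mx) => /=.
  by exists (lam u) => //; exact: lamk.
pose F t := (\int[@lebesgue_measure R]_(u in `[a, t[) g u)%R.
have igS s z : a <= s -> z <= b -> (@lebesgue_measure R).-integrable `[s, z[ (EFin \o g).
  move=> as_ zb; apply: integrableS ig => // u /=; rewrite !in_itv /= => /andP[su uz].
  by rewrite (le_trans as_ su) (lt_le_trans uz zb).
have FB s z : a <= s -> s <= z -> z <= b ->
    F z - F s = (\int[@lebesgue_measure R]_(u in `[s, z[) g u)%R.
  move=> as_ sz zb; rewrite /F.
  rewrite (@itv_bndbnd_setU _ _ (BLeft a) (BLeft s)) ?bnd_simp//.
  rewrite Rintegral_setU//=; first by rewrite addrC addKr.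
    by rewrite -(@itv_bndbnd_setU _ _ (BLeft a) (BLeft s)) ?bnd_simp//; exact: igS.
  apply/disj_setPS => u /= []; rewrite !in_itv /= => /andP[_ us] /andP[su _].
  by have := lt_le_trans us su; rewrite ltxx.
exists F => t kt; have [Kt _] := kt.
apply/is_delta_deriveP => e e0.
have /within_continuousP/(_ t kt e e0)[d d0 Hd] := cf.
set z := sigma K t.
(* for s near t, the retraction of a point between s and sigma t lies between s and t *)
suff [d' d'0 H] : exists2 d' : R, 0 < d' & forall s, K s -> `|s - t| < d' ->
    [/\ a <= z, z <= b & forall u, Num.min s z <= u < Num.max s z -> `|lam u - t| < d].
  exists d' => // s Ks sd'; have [az zb Hu] := H s Ks sd'.
  have as_ := la _ Ks; have sb := ub _ Ks.
  have [sz|zs] := leP s z.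
    rewrite FB// (ger0_norm (_ : 0 <= z - s)) ?subr_ge0//.
    apply: Rintegral_near_cst => //; first exact: igS.
    move=> u suz; apply: Hd; last by apply: Hu; rewrite min_l// max_r.
    by apply: lamk; clear -as_ zb suz; lra.
  rewrite (_ : F z - F s - f t * (z - s) = - (F s - F z - f t * (s - z))); last by ring.
  rewrite normrN (FB _ _ az (ltW zs) sb) (distrC z s) (ger0_norm (_ : 0 <= s - z)) ?subr_ge0 ?(ltW zs)//.
  apply: (Rintegral_near_cst (ltW zs)); first exact: igS.
  move=> u suz; apply: Hd; last by apply: Hu; rewrite min_r ?max_l ?(ltW zs).
  by apply: lamk; clear -az sb suz; lra.
have az : forall s, K s -> t < s -> a <= z by move=> s Ks ts; apply: (le_trans (la _ Kt)); exact: (sigma_ge Ks ts).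
have [[s0 Ks0 ts0]|Hmax] := pselect (exists2 s0, K s0 & t < s0).
  have [s1 s2 s3] := sigma_adherent Ks0 ts0.
  have Kz := sigma_in cK Ks0 ts0.
  rewrite -/z in s1 s2 s3 Kz.
  have [zt|zt] := eqVneq z t.
    exists d => // s Ks sd; split; [exact: la|exact: ub|] => u; rewrite zt.
    have [st|ts] := leP s t => /andP[u1 u2].
      have := lam_ge u s Ks u1; have := lam_le u (le_trans (la _ Ks) u1).
      move: sd; rewrite !ltr_distl; lra.
    have := lam_ge u t Kt u1; have := lam_le u (le_trans (la _ Kt) u1).
    move: sd; rewrite !ltr_distl; lra.
  have tz : t < z by rewrite lt_neqAle eq_sym zt.
  exists (Num.min d (z - t)); first by rewrite lt_min d0 subr_gt0.
  move=> s Ks; rewrite lt_min => /andP[sd sz].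
  have st : s <= t.
    rewrite leNgt; apply/negP => /(s2 _ Ks); move: sz; rewrite ltr_distl; lra.
  split; [exact: la|exact: ub|] => u.
  rewrite min_l ?max_r ?(le_trans st s1)// => /andP[u1 u2].
  have h1 := lam_ge u s Ks u1; have h2 := lam_le u (le_trans (la _ Ks) u1).
  have h3 : lam u <= t.
    by rewrite leNgt; apply/negP => /(s2 _ (lamK u)); lra.
  move: sd; rewrite !ltr_distl; lra.
have tmax s : K s -> s <= t by move=> Ks; rewrite leNgt; apply/negP => ts; apply: Hmax; exists s.
have zt : z = t by exact: sigma_max.
exists d => // s Ks sd; rewrite zt; split; [exact: la|exact: ub|] => u.
rewrite min_l ?max_r ?tmax// => /andP[u1 u2].
have := lam_ge u s Ks u1; have := lam_le u (le_trans (la _ Ks) u1).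
move: sd; rewrite !ltr_distl; lra.
Qed.

(** * Time scales with affine forward jump *)

Definition affine (R : realType) (a1 a0 t : R) : R := a1 * t + a0.

(** What the calculus of derivatives up to order [n] uses of an affine jump.
    Each derivative is taken relatively to a smaller time scale, so sigma must be
    [A] on each of them, with values in the scale itself. *)
Definition affine_scale (R : realType) (K : set R) (A : R -> R) (n : nat) : Prop :=
  forall (m : nat) (t : R), (m < n)%N -> kappan K m.+1 t ->
    [/\ sigma (kappan K m) t = A t, kappan K m (A t), t <= A t &
        A t = t <-> limit_point (kappan K m) t].

Lemma kappanD (R : realType) (K : set R) (k m : nat) :
  kappan (kappan K k) m = kappan K (k + m).
Proof. by rewrite /kappan -iterD addnC. Qed.

Lemma kappan_sub (R : realType) (K : set R) (k m : nat) : (k <= m)%N ->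
  kappan K m `<=` kappan K k.
Proof.
move=> km; rewrite -(subnKC km) -kappanD; elim: (m - k)%N => // j IH t [/IH].
by [].
Qed.

Lemma affine_scale_kappan (R : realType) (K : set R) (A : R -> R) (k n : nat) :
  affine_scale K A (k + n) -> affine_scale (kappan K k) A n.
Proof.
move=> H m t mn; rewrite !kappanD addnS => kt.
by apply: H => //; rewrite ltn_add2l.
Qed.

Lemma affine_scale_le (R : realType) (K : set R) (A : R -> R) (n n' : nat) : (n <= n')%N ->
  affine_scale K A n' -> affine_scale K A n.
Proof. by move=> nn' H m t mn; apply: H; exact: leq_trans nn'. Qed.

Lemma inf_min (R : realType) (K : set R) (a : R) : K a -> lbound K a -> inf K = a.
Proof.
move=> Ka la; apply/eqP; rewrite eq_le; apply/andP; split.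
  by apply: ge_inf => //; exists a.
by apply: lb_le_inf => //; exists a.
Qed.

(** The iterated truncation removes from [T] everything beyond the iterated
    backward jump of its maximum. *)
Lemma kappan_rho (R : realType) (T : set R) (a b : R) (m : nat) : closed T ->
  T a -> lbound T a -> T b -> ubound T b ->
  let B := iter m (rho T) b in
  [/\ closed (kappan T m), kappan T m B & kappan T m = [set t | T t /\ t <= B]].
Proof.
move=> cT Ta la Tb ub /=; elim: m => [|m [cK KB KE]] /=.
  by split => //; apply/seteqP; split => t /= => [Tt|[]//]; split => //; exact: ub.
set B := iter m (rho T) b in KB KE *.
have TB : T B by move: KB; rewrite KE => -[].
have rE : rho (kappan T m) B = rho T B.
  rewrite /rho.
  have -> : [set s | kappan T m s /\ s < B] = [set s | T s /\ s < B].
    apply/seteqP; split => s /=; rewrite KE /= => -[]; first by case.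
    by move=> Ts sB; split => //; split=> //; exact: ltW.
  suff -> : inf (kappan T m) = inf T by [].
  rewrite (inf_min Ta la); apply: inf_min => [|t].
    by rewrite KE; split => //; exact: la.
  by rewrite KE => -[/la].
have ubB : ubound (kappan T m) B by move=> t; rewrite KE => -[].
have [kE kr rB] := kappa_setE cK KB ubB.
rewrite rE in kE kr rB.
have kE' : kappa (kappan T m) = [set t | T t /\ t <= rho T B].
  rewrite kE KE; apply/seteqP; split => t /= => [[[]]//|[Tt tr]].
  by do !split => //; exact: le_trans rB.
rewrite kE'; split => //; last first.
  by split => //; move: kr; rewrite KE => -[].
rewrite -/(setI T [set t | t <= rho T B]).
by apply: closedI => //; exact: closed_le.
Qed.

(** If the [m]-fold backward jump of [b] were [a], then [T] would consist of its
    at most [m + 1] iterates. *)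
Lemma kappan_max_gt_min (R : realType) (T : set R) (a b : R) (m n : nat) :
  T a -> lbound T a -> ubound T b -> (`I_n #<= T)%card -> (m.+1 < n)%N ->
  a < iter m (rho T) b.
Proof.
move=> Ta la ub cT' mn; rewrite ltNge; apply/negP => Ba.
have sub : T `<=` [set iter i (rho T) b | i in `I_m.+1].
  move=> t Tt; apply: contrapT => nt.
  have H i : (i <= m)%N -> t < iter i (rho T) b.
    elim: i => [|i IH] im.
      rewrite lt_neqAle (ub _ Tt) andbT; apply/eqP => tb; apply: nt.
      by exists 0%N.
    have ti := IH (ltnW im); have [r1 r2 _] := rho_adherent Tt ti.
    rewrite lt_neqAle [X in _ && X]r2// andbT; apply/eqP => tb; apply: nt.
    by exists i.+1 => //=; rewrite ltnS.
  have := H m (leqnn _); have := la _ Tt; lra.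
have h1 := card_le_trans cT' (subset_card_le sub).
have h2 := card_le_trans h1 (card_image_le _ _).
by move: h2; rewrite card_le_II leqNgt mn.
Qed.

(** For [t] below the maximum of [kappan T m] the jump is that of [T]. At the
    maximum [t], membership in [kappan T m.+1] makes [t] left-dense: the number
    of points of [T] excludes that [t] is the minimum. And a left-dense point is
    fixed by [A], by continuity of [A]. *)
Lemma affine_scale_compact (R : realType) (T : set R) (a b a1 a0 : R) (n : nat) :
  closed T -> T a -> lbound T a -> T b -> ubound T b -> (`I_n.+1 #<= T)%card ->
  0 < a1 -> (forall t, T t -> a <= t <= rho T b -> sigma T t = a1 * t + a0) ->
  affine_scale T (affine a1 a0) n.
Proof.
move=> cT Ta la Tb ub card a10 hsig m t mn kt.
have [cK KB KE] := kappan_rho m cT Ta la Tb ub.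
set B := iter m (rho T) b in KB KE.
have kE : kappan T m.+1 = [set t | T t /\ t <= rho T B].
  by have [_ _ ->] := kappan_rho m.+1 cT Ta la Tb ub.
have aB : a < B by apply: (kappan_max_gt_min Ta la ub card).
have ubB : ubound (kappan T m) B by move=> s; rewrite KE => -[].
have [Tt trB] : T t /\ t <= rho T B by move: kt; rewrite kE.
have TB : T B by move: KB; rewrite KE => -[].
have Bb : B <= b by exact: ub.
have [r1 r2 _] := rho_adherent Ta aB.
have Kt : kappan T m t by rewrite KE; split => //; lra.
have sA s : T s -> s < b -> sigma T s = affine a1 a0 s.
  move=> Ts sb; apply: hsig => //; rewrite la//=.
  by have [_ rP _] := rho_adherent Ts sb; exact: rP.
(* sigma s lies in ]s, u] for s < u, so letting s increase to u gives A u = u *)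
have ld u : T u -> (forall e : R, 0 < e -> exists s, [/\ T s, s < u & u - e < s]) ->
    affine a1 a0 u = u.
  move=> Tu H; apply/eqP; rewrite -subr_eq0 -normr_le0; apply/ler_addgt0Pr => e e0.
  have k0 : 0 < a1 + 1 by lra.
  have [s [Ts su us]] := H _ (divr_gt0 e0 k0).
  have sb : s < b by apply: (lt_le_trans su); exact: ub.
  have [s1 s2 _] := sigma_adherent Tu su.
  have := s2 _ Tu su; rewrite (sA s Ts sb) in s1 * => s3.
  have -> : affine a1 a0 u - u = (affine a1 a0 s - u) + a1 * (u - s).
    by rewrite /affine; ring.
  have h1 : (u - s) < e / (a1 + 1) by lra.
  have h2 : a1 * (u - s) <= a1 * (e / (a1 + 1)) by rewrite ler_pM2l//; lra.
  have h3 : a1 * (e / (a1 + 1)) + e / (a1 + 1) = e by field; lra.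
  have h4 : 0 < a1 * (u - s) by rewrite mulr_gt0//; lra.
  by rewrite ler_norml; lra.
have [tB|tB] := ltP t B; last first.
  have tE : t = B by apply/eqP; rewrite eq_le tB (ubB _ Kt).
  have rB : rho T B = B by apply/eqP; rewrite eq_le r1 -{1}tE.
  have ldB (e : R) : 0 < e -> exists s, [/\ T s, s < t & t - e < s].
    move=> e0; have [_ _ /(_ e e0)[s [Ts sB _]]] := rho_adherent Ta aB.
    by rewrite rB => se; exists s; rewrite tE.
  have AE := ld t Tt ldB.
  have Kmax s : kappan T m s -> s <= t by move=> /ubB; rewrite tE.
  rewrite AE (sigma_max Kt Kmax); split => //; split => // _.
  apply/limit_pointP_dist => d d0; have [s [Ts st se]] := ldB d d0.
  exists s; split; rewrite ?lt_eqF//; last by rewrite ltr_distl; lra.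
  by rewrite KE; split => //; rewrite -tE; exact: ltW.
have tb : t < b by apply: (lt_le_trans tB).
have AE := sA t Tt tb.
have [s1 s2 s3] := sigma_adherent TB tB.
have Ts := sigma_in cT TB tB.
have Ks : kappan T m (sigma T t) by rewrite KE; split => //; exact: s2.
have sE : sigma (kappan T m) t = sigma T t.
  have [u1 u2 u3] := sigma_adherent KB tB.
  apply/eqP; rewrite eq_le; apply/andP; split.
    apply/ler_addgt0Pr => e e0; have [s [Ts' ts ss se]] := s3 e e0.
    have [sB|Bs] := leP s B; first by apply: (le_trans (u2 s _ ts)); rewrite ?KE//; lra.
    by have := u2 _ KB tB; lra.
  apply/ler_addgt0Pr => e e0; have [s [Ks' ts ss se]] := u3 e e0.
  have Ts' : T s by move: Ks'; rewrite KE => -[].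
  by have := s2 _ Ts' ts; lra.
rewrite -AE; split => //; split.
  move=> st; apply/limit_pointP_dist => d d0.
  have [|s [Ts' ts _ se]] := s3 (Num.min d (B - t)); first by rewrite lt_min d0 subr_gt0.
  rewrite st -ltrBlDl lt_min in se; move: se => /andP[se1 se2].
  exists s; split; rewrite ?gt_eqF//; last by rewrite ltr_distl; lra.
  by rewrite KE; split => //; lra.
move=> /limit_pointP_dist lp; apply: contrapT => st.
have ts : t < sigma T t by rewrite lt_neqAle s1 andbT eq_sym; apply/eqP.
apply: st; rewrite AE; apply: ld => // e e0.
have [|s [Ks' sne]] := lp (Num.min e (sigma T t - t)); first by rewrite lt_min e0 subr_gt0.
rewrite lt_min !ltr_distl => /andP[/andP[h1 h2] /andP[h3 h4]].
have Ts' : T s by move: Ks'; rewrite KE => -[].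
exists s; split => //; rewrite lt_neqAle sne leNgt /=; apply/negP => ts'.
by have := s2 _ Ts' ts'; lra.
Qed.

(** * Higher Delta-derivatives *)

Lemma affine_scale_regular (R : realType) (K : set R) A n m (t : R) :
  affine_scale K A n -> (m < n)%N -> kappan K m.+1 t -> regular (kappan K m) t.
Proof.
move=> hA mn kt; have [sE _ _ lp] := hA m t mn kt.
have [AE|AE] := pselect (A t = t); first by right; exact/lp.
by left; rewrite sE.
Qed.

Lemma affine_scale_deltaE (R : realType) (K : set R) A n m f (t l : R) :
  affine_scale K A n -> (m < n)%N -> kappan K m.+1 t ->
  is_delta_derive (kappan K m) f t l -> delta (kappan K m) f t = l.
Proof.
move=> hA mn kt; apply: deltaE; first by case: kt.
exact: (affine_scale_regular hA).
Qed.

Lemma deltan_is_delta_derive (R : realType) (K : set R) n m f (t : R) :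
  deltan_derivable K n f -> (m < n)%N -> kappan K m.+1 t ->
  is_delta_derive (kappan K m) (deltan K m f) t (deltan K m.+1 f t).
Proof. by move=> df mn kt; apply: deltaP; exact: df. Qed.

(** Functions that agree on the time scale have the same set of candidate
    derivatives, whether empty or not. *)
Lemma deltan_eq (R : realType) (K : set R) A n f g :
  affine_scale K A n -> (forall t, K t -> f t = g t) ->
  forall m, (m <= n)%N -> forall t, kappan K m t -> deltan K m f t = deltan K m g t.
Proof.
move=> hA fg; elim=> [|m IH] mn t kt /=; first exact: fg.
have [sE KA _ _] := hA m t mn kt.
rewrite /delta; congr get; apply/seteqP; split => l;
  apply: is_delta_derive_eq; rewrite ?sE// => s Ks; first exact: IH (ltnW mn) _ Ks.
by symmetry; exact: IH (ltnW mn) _ Ks.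
Qed.

Lemma deltan_derivable_eq (R : realType) (K : set R) A n f g :
  affine_scale K A n -> (forall t, K t -> f t = g t) ->
  deltan_derivable K n f -> deltan_derivable K n g.
Proof.
move=> hA fg df m mn t kt; have [l dl] := df m mn t kt.
have [sE KA _ _] := hA m t mn kt.
exists l; apply: is_delta_derive_eq dl; rewrite ?sE// => s.
by apply: (deltan_eq hA fg); exact: ltnW.
Qed.

Lemma delta_C_eq (R : realType) (K : set R) A n f g :
  affine_scale K A n -> (forall t, K t -> f t = g t) ->
  delta_C K n f -> delta_C K n g.
Proof.
move=> hA fg [df cf]; split; first exact: (deltan_derivable_eq hA fg).
move: cf => /within_continuousP cf; apply/within_continuousP => t kt e e0.
have [d d0 H] := cf t kt e e0; exists d => // s ks sd.
by rewrite -!(deltan_eq hA fg (leqnn _))//; exact: H.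
Qed.

Lemma deltan_lin (R : realType) (K : set R) A n f g (c : R) :
  affine_scale K A n -> deltan_derivable K n f -> deltan_derivable K n g ->
  forall m, (m <= n)%N -> forall t, kappan K m t ->
    deltan K m (fun s => f s + c * g s) t = deltan K m f t + c * deltan K m g t.
Proof.
move=> hA df dg; elim=> [//|m IH] mn t kt /=.
have [sE KA _ _] := hA m t mn kt.
apply: (affine_scale_deltaE hA mn kt).
apply: (@is_delta_derive_eq _ _ (fun s => deltan K m f s + c * deltan K m g s)).
- by rewrite sE.
- by move=> s Ks; rewrite (IH (ltnW mn)).
- by apply: is_delta_derive_lin; apply: (@deltan_is_delta_derive _ _ n).
Qed.

Lemma deltan_derivable_lin (R : realType) (K : set R) A n f g (c : R) :
  affine_scale K A n -> deltan_derivable K n f -> deltan_derivable K n g ->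
  deltan_derivable K n (fun s => f s + c * g s).
Proof.
move=> hA df dg m mn t kt.
have [sE KA _ _] := hA m t mn kt.
exists (deltan K m.+1 f t + c * deltan K m.+1 g t).
apply: (@is_delta_derive_eq _ _ (fun s => deltan K m f s + c * deltan K m g s)).
- by rewrite sE.
- by move=> s Ks; rewrite (deltan_lin _ hA df dg (ltnW mn)).
- by apply: is_delta_derive_lin; apply: (@deltan_is_delta_derive _ _ n).
Qed.

Lemma cont_at_lin (R : realType) (K : set R) f g (c t : R) :
  cont_at K f t -> cont_at K g t -> cont_at K (fun s => f s + c * g s) t.
Proof.
move=> cf cg e e0.
have k0 : 0 < 2 * (`|c| + 1) by have := normr_ge0 c; lra.
have [d1 d10 h1] := cf _ (divr_gt0 e0 (ltr0n _ 2)).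
have [d2 d20 h2] := cg _ (divr_gt0 e0 k0).
exists (Num.min d1 d2); first by rewrite lt_min d10.
move=> s Ks; rewrite lt_min => /andP[/(h1 _ Ks) {}h1 /(h2 _ Ks) {}h2].
rewrite (_ : _ - _ = (f s - f t) + c * (g s - g t)); last by ring.
apply: (le_trans (ler_normD _ _)); rewrite normrM.
have : `|c| * `|g s - g t| <= (`|c| + 1) * (e / (2 * (`|c| + 1))).
  by apply: ler_pM => //; lra.
have -> : (`|c| + 1) * (e / (2 * (`|c| + 1))) = e / 2.
  by field; have := normr_ge0 c; lra.
lra.
Qed.

Lemma delta_C_lin (R : realType) (K : set R) A n f g (c : R) :
  affine_scale K A n -> delta_C K n f -> delta_C K n g ->
  delta_C K n (fun s => f s + c * g s).
Proof.
move=> hA [df /within_continuousP cf] [dg /within_continuousP cg].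
split; first exact: (deltan_derivable_lin _ hA).
apply/within_continuousP => t kt e e0.
have [d d0 H] := cont_at_lin c (cf t kt) (cg t kt) e0.
exists d => // s ks sd; rewrite !(deltan_lin _ hA df dg (leqnn _))//.
exact: H.
Qed.

(** A point outside [kappa K] is isolated, so continuity is automatic there. *)
Lemma delta_derivable_cont_at (R : realType) (K : set R) f (t : R) : K t ->
  (kappa K t -> delta_derivable K f t) -> cont_at K f t.
Proof.
move=> Kt df; have [kt|nk] := pselect (kappa K t).
  by have [l] := df kt; exact: is_delta_derive_cont.
move=> e e0; have [ub [d d0 H]] := not_kappa Kt nk.
exists d => // s Ks sd; suff -> : s = t by rewrite subrr normr0 ltW.
apply/eqP; rewrite eq_le ub//= leNgt; apply/negP => /(H _ Ks).
move: sd; rewrite ltr_distl; lra.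
Qed.

Lemma deltan_derivable_cont (R : realType) (K : set R) n m f :
  deltan_derivable K n f -> (m < n)%N ->
  {within kappan K m, continuous (deltan K m f)}.
Proof.
move=> df mn; apply/within_continuousP => t kt.
by apply: delta_derivable_cont_at => // kt'; exact: df.
Qed.

Lemma delta_C_le (R : realType) (K : set R) m n f : (m <= n)%N ->
  delta_C K n f -> delta_C K m f.
Proof.
rewrite leq_eqVlt => /predU1P[->//|mn] [df cf]; split.
  by move=> i im; apply: df; exact: ltn_trans mn.
exact: deltan_derivable_cont mn.
Qed.

(** The definition adds the outermost derivative; this splits off the innermost
    ones, which is the form needed for inductions over the function. *)
Lemma deltanD (R : realType) (K : set R) k m f :
  deltan (kappan K k) m (deltan K k f) = deltan K (k + m) f.
Proof.
elim: m => [|m IH] /=; first by rewrite addn0.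
by rewrite addnS /= IH kappanD.
Qed.

Lemma kappan_kappa (R : realType) (K : set R) m : kappan (kappa K) m = kappan K m.+1.
Proof. by rewrite -[kappa K]/(kappan K 1) kappanD. Qed.

Lemma deltanSr (R : realType) (K : set R) m f :
  deltan (kappa K) m (delta K f) = deltan K m.+1 f.
Proof. by rewrite -add1n -deltanD. Qed.

Lemma deltan_derivableS (R : realType) (K : set R) n f :
  deltan_derivable K n.+1 f <->
  (forall t, kappa K t -> delta_derivable K f t) /\
  deltan_derivable (kappa K) n (delta K f).
Proof.
split=> [H|[H1 H2] [|m] mn t].
  split=> [t kt|m mn t]; first exact: (H 0%N).
  by rewrite !kappan_kappa deltanSr => kt; exact: (H m.+1).
  exact: H1.
have := H2 m mn t.
by rewrite !kappan_kappa deltanSr.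
Qed.

Lemma delta_CS (R : realType) (K : set R) n f :
  delta_C K n.+1 f <->
  (forall t, kappa K t -> delta_derivable K f t) /\
  delta_C (kappa K) n (delta K f).
Proof.
split=> [[/deltan_derivableS[h1 h2] h3]|[h1 [h2 h3]]].
  by split => //; split => //; rewrite kappan_kappa deltanSr.
split; first exact/deltan_derivableS.
by move: h3; rewrite kappan_kappa deltanSr.
Qed.

(** * Scattered time scales: quotients and Peano expansions *)

Definition dquot (R : realType) (A : R -> R) (f : R -> R) (s : R) : R :=
  (f (A s) - f s) / (A s - s).

Lemma delta_dquot (R : realType) (K : set R) A n m f (t : R) :
  affine_scale K A n -> (m < n)%N -> kappan K m.+1 t -> A t != t ->
  delta_derivable (kappan K m) f t /\ delta (kappan K m) f t = dquot A f t.
Proof.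
move=> hA mn kt /eqP At; have [sE _ _ lp] := hA m t mn kt.
have h : is_delta_derive (kappan K m) f t (dquot A f t).
  by rewrite /dquot -sE; apply: isolated_is_delta_derive; rewrite ?sE// => /lp.
by split; [exists (dquot A f t)|exact: (affine_scale_deltaE hA mn kt)].
Qed.

Lemma deltan_dquot (R : realType) (K : set R) A n f :
  affine_scale K A n -> injective A ->
  forall m (t : R), (m <= n)%N -> kappan K m t -> A t != t ->
  deltan K m f t = iter m (dquot A) f t.
Proof.
move=> hA iA; elim=> [//|m IH] t mn kt At /=.
have [sE KA _ _] := hA m t mn kt.
rewrite (delta_dquot _ hA mn kt At).2 /dquot !IH ?(ltnW mn)//; first by case: kt.
by rewrite (inj_eq iA).
Qed.

(** The degree of [P] is left free, as terms of degree above [n] belong to the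
    remainder. The inequality includes [s = p]. *)
Definition peano (R : realType) (K : set R) (p : R) (n : nat) (f : R -> R) : Prop :=
  exists P : {poly R}, forall e : R, 0 < e -> exists2 d : R, 0 < d &
    forall s, K s -> `|s - p| < d -> `|f s - P.[s - p]| <= e * `|s - p| ^+ n.

Lemma poly_split (R : realType) (P : {poly R}) :
  exists q : {poly R}, forall x, P.[x] = P.[0] + x * q.[x].
Proof.
elim/poly_ind: P => [|q c _]; first by exists 0 => x; rewrite !horner0 mulr0 addr0.
by exists q => x; rewrite !hornerE /=; ring.
Qed.

(** The difference quotient along [A] preserves polynomials in [t - p], and its
    value at [p] is the first order coefficient. *)
Lemma dquot_poly (R : realType) (a1 : R) (P q : {poly R}) :
  (forall x, P.[x] = P.[0] + x * q.[x]) ->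
  exists Q : {poly R}, Q.[0] = q.[0] /\
    forall x, P.[a1 * x] - P.[x] = (a1 - 1) * x * Q.[x].
Proof.
move=> Pq.
have H (p : {poly R}) : exists Q : {poly R},
    forall x, p.[a1 * x] - p.[x] = (a1 - 1) * x * Q.[x].
  elim/poly_ind: p => [|p c [Q HQ]]; first by exists 0 => x; rewrite !horner0; ring.
  exists (a1%:P * 'X * Q + p) => x; rewrite !hornerE /=.
  have -> : p.[a1 * x] = p.[x] + (a1 - 1) * x * Q.[x] by rewrite -HQ; ring.
  ring.
have [Q HQ] := H q; exists (a1%:P * 'X * Q + q); split.
  by rewrite !hornerE /=; ring.
move=> x; rewrite !hornerE /= Pq [P.[x]]Pq.
have -> : q.[a1 * x] = q.[x] + (a1 - 1) * x * Q.[x] by rewrite -HQ; ring.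
ring.
Qed.

(** Inverse of the difference quotient on polynomials: the coefficient of degree [i]
    becomes that of degree [i + 1] times [(a1 - 1) / (a1 ^ (i + 1) - 1)], whose
    denominator is nonzero as [a1] is positive and not 1. *)
Lemma primitive_poly (R : realType) (a1 c : R) (Q : {poly R}) : 0 < a1 -> a1 != 1 ->
  exists P q : {poly R}, [/\ q.[0] = Q.[0],
    forall x, P.[x] = c + x * q.[x] &
    forall x, P.[a1 * x] - P.[x] = (a1 - 1) * x * Q.[x]].
Proof.
move=> a10 a11.
pose C i := Q`_i * (a1 - 1) / (a1 ^+ i.+1 - 1).
have a1n : a1 - 1 != 0 by rewrite subr_eq0.
pose q : {poly R} := \sum_(i < size Q) (C i *: 'X^i)%R.
exists (c%:P + \sum_(i < size Q) C i *: 'X^(i.+1)), q.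
split.
- rewrite horner_sum horner_coef; apply: eq_bigr => -[[|i] ?] _; rewrite !hornerE /= ?expr0n /= ?mulr0//.
  by rewrite /C -[a1 ^+ 1]/a1 mulfK.
- move=> x; rewrite /q !hornerE !horner_sum mulr_sumr; congr (_ + _).
  by apply: eq_bigr => i _; rewrite !hornerZ !hornerXn exprS mulrCA.
move=> x; rewrite /C !hornerD !hornerC !horner_sum opprD addrACA subrr add0r -sumrB.
rewrite horner_coef mulr_sumr; apply: eq_bigr => i _.
rewrite !hornerZ !hornerXn exprMn (exprS x).
have : a1 ^+ i.+1 - 1 != 0 by rewrite subr_eq0 pexpr_eq1 ?ltW.
by move: (a1 ^+ i.+1) => k k1; field.
Qed.

Lemma poly_near0 (R : realType) (q : {poly R}) (e : R) : 0 < e ->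
  exists2 d : R, 0 < d & forall x, `|x| < d -> `|q.[x] - q.[0]| <= e.
Proof.
move=> e0; have := @continuous_horner R q 0.
move=> /cvgrPdist_le/(_ e e0); rewrite -nbhs_ballE => -[d /= d0 H].
exists d => // x xd; rewrite distrC; apply: H.
by rewrite /ball /= sub0r normrN.
Qed.

Lemma fixed_affine (R : realType) (a1 a0 p t : R) : affine a1 a0 p = p ->
  affine a1 a0 t - p = a1 * (t - p) /\ affine a1 a0 t - t = (a1 - 1) * (t - p).
Proof.
rewrite /affine => h.
have -> : a0 = p - a1 * p by rewrite -{1}h; ring.
by split; ring.
Qed.

Lemma is_delta_derive_poly (R : realType) (K : set R) (P q : {poly R}) (p c : R) :
  sigma K p = p -> (forall x, P.[x] = c + x * q.[x]) ->
  is_delta_derive K (fun s => P.[s - p]) p q.[0].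
Proof.
move=> sp Pq; apply/is_delta_deriveP => e e0; rewrite sp.
have [d d0 H] := poly_near0 q e0.
exists d => // s Ks /H h.
have -> : P.[p - p] - P.[s - p] - q.[0] * (p - s) = - ((s - p) * (q.[s - p] - q.[0])).
  by rewrite !Pq; ring.
by rewrite normrN normrM mulrC [`|p - s|]distrC ler_wpM2r.
Qed.

Lemma peano1 (R : realType) (K : set R) (p : R) f : K p -> sigma K p = p ->
  delta_derivable K f p -> peano K p 1 f.
Proof.
move=> Kp sp [l /is_delta_deriveP h]; exists ((f p)%:P + l *: 'X) => e e0.
have [d d0 H] := h e e0; exists d => // s Ks sd; rewrite expr1.
have -> : f s - ((f p)%:P + l *: 'X).[s - p] = - (f p - f s - l * (p - s)).
  by rewrite !hornerE /=; ring.
by have := H s Ks sd; rewrite sp normrN [`|p - s|]distrC.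
Qed.

(** In the quotient the remainder, of order [k + 1], is divided by
    [A s - s = (a1 - 1) (s - p)] and so keeps order [k]. *)
Lemma peano_delta (R : realType) (K : set R) (a1 a0 : R) n m k f (p : R) :
  0 < a1 -> a1 != 1 ->
  affine_scale K (affine a1 a0) n -> (m < n)%N -> kappan K m.+1 p ->
  affine a1 a0 p = p -> peano (kappan K m) p k.+1 f ->
  delta_derivable (kappan K m) f p /\
  peano (kappan K m.+1) p k (delta (kappan K m) f).
Proof.
move=> a10 a11 hA mn kp Ap [P HP].
have [sE _ _ _] := hA m p mn kp; rewrite Ap in sE.
have Kp : kappan K m p by case: kp.
have [q Pq] := poly_split P.
have fp : f p = P.[0].
  apply/eqP; rewrite -subr_eq0 -normr_le0; apply/ler_addgt0Pr => e e0.
  have [d d0 H] := HP e e0.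
  by have := H p Kp; rewrite subrr normr0 expr0n /= mulr0 add0r => h; have := h d0; lra.
have dp : is_delta_derive (kappan K m) f p q.[0].
  have dP := is_delta_derive_poly sE Pq.
  suff dR : is_delta_derive (kappan K m) (fun s => f s + (-1) * P.[s - p]) p 0.
    have := is_delta_derive_lin 1 dR dP; rewrite add0r mul1r.
    by congr is_delta_derive; apply/funext => s; ring.
  apply/is_delta_deriveP => e e0; rewrite sE.
  have [d d0 H] := HP _ e0.
  exists (Num.min d 1); first by rewrite !lt_min d0 ltr01.
  move=> s Ks; rewrite !lt_min => /andP[/(H _ Ks) h s1].
  have -> : f p + -1 * P.[p - p] - (f s + -1 * P.[s - p]) - 0 * (p - s) = - (f s - P.[s - p]).
    by rewrite subrr fp; ring.
  rewrite normrN [`|p - s|]distrC; apply: (le_trans h).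
  by rewrite ler_wpM2l ?(ltW e0)// exprS ler_piMr// exprn_ile1// ltW.
split; first by exists q.[0].
have dpE := affine_scale_deltaE hA mn kp dp.
have [Q [Q0 HQ]] := dquot_poly a1 Pq.
exists Q => e e0.
have a1n : a1 - 1 != 0 by rewrite subr_eq0.
have a1p : 0 < `|a1 - 1| by rewrite normr_gt0.
have c0 : 0 < a1 ^+ k.+1 + 1 by rewrite addr_gt0// exprn_gt0.
have [d d0 H] := HP (e * `|a1 - 1| / (a1 ^+ k.+1 + 1)) (divr_gt0 (mulr_gt0 e0 a1p) c0).
exists (d / (a1 + 1)); first by rewrite divr_gt0//; lra.
move=> s ks sd.
have sd1 : `|s - p| * (a1 + 1) < d by rewrite -ltr_pdivlMr//; lra.
have [sp|sp] := eqVneq s p.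
  by rewrite sp subrr dpE Q0 subrr normr0 mulr_ge0 ?(ltW e0)// exprn_ge0.
have [e1 e2] := fixed_affine s Ap.
have sp0 : s - p != 0 by rewrite subr_eq0.
have np0 : 0 < `|s - p| by rewrite normr_gt0.
have As : affine a1 a0 s != s by rewrite -subr_eq0 e2 mulf_neq0.
have Ks : kappan K m s by case: ks.
have [_ KA _ _] := hA m s mn ks.
rewrite (delta_dquot f hA mn ks As).2 /dquot.
have h1 := H _ KA; rewrite e1 normrM (ger0_norm (ltW a10)) in h1.
have {}h1 := h1 (le_lt_trans (_ : a1 * `|s - p| <= `|s - p| * (a1 + 1)) sd1).
have {}h1 : `|f (affine a1 a0 s) - P.[a1 * (s - p)]| <=
    e * `|a1 - 1| / (a1 ^+ k.+1 + 1) * (a1 * `|s - p|) ^+ k.+1.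
  by apply: h1; rewrite mulrC ler_wpM2l//; lra.
have h2 : `|f s - P.[s - p]| <= e * `|a1 - 1| / (a1 ^+ k.+1 + 1) * `|s - p| ^+ k.+1.
  by apply: H => //; apply: le_lt_trans sd1; rewrite ler_peMr//; lra.
rewrite e2 (_ : _ - Q.[s - p] = ((f (affine a1 a0 s) - P.[a1 * (s - p)]) - (f s - P.[s - p])) / ((a1 - 1) * (s - p))); last first.
  apply: (mulIf (mulf_neq0 a1n sp0)); rewrite mulrBl !divfK ?mulf_neq0//.
  by rewrite [Q.[_] * _]mulrC -HQ; ring.
rewrite normrM normfV ler_pdivrMr ?normr_gt0 ?mulf_neq0//.
apply: (le_trans (ler_normB _ _)); apply: (le_trans (lerD h1 h2)).
rewrite normrM exprMn -mulrDr -[X in _ * (_ + X)]mul1r -mulrDl mulrA divfK ?gt_eqF//.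
by rewrite exprS le_eqVlt; apply/orP; left; apply/eqP; ring.
Qed.

(** Let [P] be a polynomial whose difference quotient is the expansion of the
    derivative. The derivative of [f - P] is [o(|s - p|^(k + 1))], and the mean value
    inequality between [p] and [s] gains one order. *)
Lemma peano_primitive (R : realType) (K : set R) (a1 a0 : R) n m k f (p : R) :
  0 < a1 -> a1 != 1 ->
  affine_scale K (affine a1 a0) n -> (m < n)%N -> closed (kappan K m) ->
  kappan K m.+1 p -> affine a1 a0 p = p ->
  (forall t, kappan K m.+1 t -> delta_derivable (kappan K m) f t) ->
  peano (kappan K m.+1) p k.+1 (delta (kappan K m) f) ->
  peano (kappan K m) p k.+2 f.
Proof.
move=> a10 a11 hA mn cK kp Ap df [Q HQ].
have [P [q [q0 Pq HP]]] := primitive_poly (f p) Q a10 a11.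
have [sE _ _ _] := hA m p mn kp; rewrite Ap in sE.
have a1n : a1 - 1 != 0 by rewrite subr_eq0.
exists P => e e0.
have [d1 d10 H1] := HQ e e0.
have [d2 d20 H2] := kappa_near kp.
have Kp : kappan K m p by case: kp.
(* away from p this is the choice of P; at p both quotients are first order coefficients *)
have dH u : kappan K m.+1 u ->
    is_delta_derive (kappan K m) (fun s => f s + (-1) * P.[s - p]) u
      (delta (kappan K m) f u + (-1) * Q.[u - p]).
  move=> ku; apply: is_delta_derive_lin; first exact/deltaP/df.
  have [up|up] := eqVneq u p.
    by rewrite up subrr -q0; exact: is_delta_derive_poly sE Pq.
  have [e1 e2] := fixed_affine u Ap.
  have up0 : u - p != 0 by rewrite subr_eq0.
  have Au : affine a1 a0 u != u by rewrite -subr_eq0 e2 mulf_neq0.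
  have [/deltaP dP dE] := delta_dquot (fun s => P.[s - p]) hA mn ku Au.
  move: dP; rewrite dE /dquot e1 e2 HP mulrAC divff ?mul1r ?mulf_neq0//.
exists (Num.min d1 d2); first by rewrite lt_min d10.
move=> s Ks; rewrite lt_min => /andP[sd1 sd2].
have key u : kappan K m.+1 u -> `|u - p| <= `|s - p| ->
    `|delta (kappan K m) f u + (-1) * Q.[u - p]| <= e * `|s - p| ^+ k.+1.
  move=> ku us; rewrite mulN1r; apply: (le_trans (H1 u ku (le_lt_trans us sd1))).
  by rewrite ler_pM2l// lerXn2r// nnegrE.
pose H u := f u + (-1) * P.[u - p].
have -> : f s - P.[s - p] = H s - H p by rewrite /H subrr !Pq; ring.
rewrite exprSr mulrA.
have [ps|sp] := leP p s.
  rewrite [X in _ <= _ * X]ger0_norm ?subr_ge0//.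
  apply: (@delta_mean_value _ _ H _ _ _ _ cK Kp Ks ps) => u ku /andP[pu us].
  by split; [exact: dH|apply: key => //; rewrite !ger0_norm; lra].
rewrite [X in _ <= _ * X]distrC [X in _ <= _ * X]gtr0_norm ?subr_gt0// distrC.
apply: (@delta_mean_value _ _ H _ _ _ _ cK Ks Kp (ltW sp)) => u ku /andP[su up].
by split; [exact: dH|apply: key => //; rewrite !ler0_norm; lra].
Qed.

Lemma limit_point_kappa (R : realType) (K : set R) (p : R) : K p ->
  limit_point K p -> kappa K p /\ limit_point (kappa K) p.
Proof.
move=> Kp /limit_pointP_dist lp.
have kp : kappa K p.
  apply: contrapT => nk; have [ub [d d0 Hd]] := not_kappa Kp nk.
  have [s [Ks sp sd]] := lp d d0.
  have : s < p by rewrite lt_neqAle sp ub.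
  move/(Hd _ Ks); move: sd; rewrite ltr_distl; lra.
split => //; apply/limit_pointP_dist => d d0.
have [d1 d10 Hd1] := kappa_near kp.
have [|s [Ks sp]] := lp (Num.min d d1); first by rewrite lt_min d0.
rewrite lt_min => /andP[sd sd1]; exists s; split => //; exact: Hd1.
Qed.

(** A fixed point is a limit point, and truncation never removes limit points. *)
Lemma fixed_kappan (R : realType) (K : set R) A n (p : R) :
  affine_scale K A n -> (0 < n)%N -> kappa K p -> A p = p ->
  forall m, kappan K m p.
Proof.
move=> hA n0 kp Ap m; have [_ _ _ [/(_ Ap) lp _]] := hA 0%N p n0 kp.
suff [] : kappan K m p /\ limit_point (kappan K m) p by [].
elim: m => [|m [IH1 IH2]]; first by case: kp.
exact: limit_point_kappa.
Qed.

Lemma peano_deltan (R : realType) (K : set R) (a1 a0 : R) n N f (p : R) :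
  0 < a1 -> a1 != 1 -> affine_scale K (affine a1 a0) n ->
  affine a1 a0 p = p -> peano K p N f ->
  forall m, (m <= n)%N -> (m <= N)%N -> kappan K m p ->
    peano (kappan K m) p (N - m) (deltan K m f).
Proof.
move=> a10 a11 hA Ap pf; elim=> [|m IH] mn mN kp; first by rewrite subn0.
have := IH (ltnW mn) (ltnW mN) (proj1 kp).
rewrite subnS; case E : (N - m)%N => [|k] pm /=; first lia.
exact: (peano_delta a10 a11 hA mn kp Ap pm).2.
Qed.

Lemma peano0_cont_at (R : realType) (K : set R) f (p : R) : K p ->
  peano K p 0 f -> cont_at K f p.
Proof.
move=> Kp [P HP] e e0.
have e30 : 0 < e / 3 by lra.
have [d1 d10 H1] := HP _ e30; have [d2 d20 H2] := poly_near0 P e30.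
exists (Num.min d1 d2); first by rewrite lt_min d10.
move=> s Ks; rewrite lt_min => /andP[/(H1 _ Ks) h1 /H2 h2].
have := H1 p Kp; rewrite subrr normr0 => /(_ d10); rewrite !expr0 !mulr1 in h1 * => h3.
have -> : f s - f p = (f s - P.[s - p]) + (P.[s - p] - P.[0]) - (f p - P.[0]) by ring.
apply: (le_trans (ler_normB _ _)).
have := ler_normD (f s - P.[s - p]) (P.[s - p] - P.[0]); lra.
Qed.

(** Points that are not fixed are isolated, so only the fixed points matter.
    Continuity of the top derivative there is its expansion of order 0. The second
    hypothesis expresses that the affine map is not the identity. *)
Lemma peano_delta_C (R : realType) (K : set R) (a1 a0 : R) n f :
  0 < a1 -> (forall p, affine a1 a0 p = p -> a1 != 1) ->
  affine_scale K (affine a1 a0) n -> (0 < n)%N ->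
  (forall p, kappa K p -> affine a1 a0 p = p -> peano K p n f) -> delta_C K n f.
Proof.
move=> a10 fx hA n0 pf; split.
  move=> m mn t kt; have [At|/eqP At] := pselect (affine a1 a0 t = t); last first.
    by have [] := delta_dquot (deltan K m f) hA mn kt At.
  have kt1 : kappa K t by apply: (@kappan_sub _ _ 1 m.+1).
  have a11 := fx t At.
  have := peano_deltan a10 a11 hA At (pf t kt1 At) (ltnW mn) (ltnW mn) (proj1 kt).
  case E : (n - m)%N => [|k] pm; first lia.
  exact: (peano_delta a10 a11 hA mn kt At pm).1.
apply/within_continuousP => t kt.
have [At|/eqP At] := pselect (affine a1 a0 t = t).
  apply: peano0_cont_at => //; rewrite -(subnn n).
  by apply: (peano_deltan a10 (fx t At) hA) => //; apply: pf => //; exact: (@kappan_sub _ _ 1 n).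
case: n n0 hA pf kt => // n _ hA _ kt.
have [_ _ _ lp] := hA n t (ltnSn n) kt.
have [|d d0 H] := @not_limit_pointP _ (kappan K n) t; first by move=> /lp; exact/eqP.
move=> e e0; exists d => // s [Ks _] /(H _ Ks) ->; by rewrite subrr normr0 ltW.
Qed.

(** Downward induction on the number of derivatives: the last but one is merely
    differentiable at [p], and each integration gains one order. *)
Lemma deltan_derivable_peano (R : realType) (K : set R) (a1 a0 : R) n f (p : R) :
  0 < a1 -> a1 != 1 -> affine_scale K (affine a1 a0) n ->
  (forall m, closed (kappan K m)) -> kappan K n p -> affine a1 a0 p = p ->
  deltan_derivable K n f ->
  forall m, (m < n)%N -> peano (kappan K m) p (n - m) (deltan K m f).
Proof.
move=> a10 a11 hA cK kp Ap df.
suff H j m : (m + j.+1 = n)%N -> peano (kappan K m) p j.+1 (deltan K m f).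
  by move=> m mn; have := H (n - m).-1 m; rewrite prednK ?subn_gt0// subnKC ?(ltnW mn)//; apply.
elim: j m => [|j IH] m mj.
  have mn : (m < n)%N by lia.
  have kp' : kappan K m.+1 p by apply: (kappan_sub mn).
  have [sE _ _ _] := hA m p mn kp'.
  by apply: peano1; [case: kp'|rewrite sE|exact: df].
have mn : (m < n)%N by lia.
have kp' : kappan K m.+1 p by apply: (kappan_sub mn).
apply: (peano_primitive a10 a11 hA mn) => //; first exact: df.
by apply: (IH m.+1); lia.
Qed.

Lemma peano_eq_near (R : realType) (K : set R) (p : R) n f g (d : R) : 0 < d ->
  (forall s, K s -> `|s - p| < d -> f s = g s) -> peano K p n f -> peano K p n g.
Proof.
move=> d0 fg [P HP]; exists P => e e0; have [d1 d10 H1] := HP e e0.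
exists (Num.min d d1); first by rewrite lt_min d0.
move=> s Ks; rewrite lt_min => /andP[sd sd1]; rewrite -fg//; exact: H1.
Qed.

Lemma peano_sub (R : realType) (K K' : set R) (p : R) n f (d : R) : 0 < d ->
  (forall s, K' s -> `|s - p| < d -> K s) -> peano K p n f -> peano K' p n f.
Proof.
move=> d0 sub [P HP]; exists P => e e0; have [d1 d10 H1] := HP e e0.
exists (Num.min d d1); first by rewrite lt_min d0.
by move=> s Ks; rewrite lt_min => /andP[sd sd1]; apply: H1 => //; exact: sub.
Qed.

Lemma peano_le (R : realType) (K : set R) (p : R) m n f : (m <= n)%N ->
  peano K p n f -> peano K p m f.
Proof.
move=> mn [P HP]; exists P => e e0; have [d d0 H] := HP e e0.
exists (Num.min d 1); first by rewrite lt_min d0 ltr01.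
move=> s Ks; rewrite lt_min => /andP[sd s1]; apply: (le_trans (H s Ks sd)).
by rewrite ler_wpM2l ?(ltW e0)// ler_wiXn2l// ltW.
Qed.

Lemma peano_lin (R : realType) (K : set R) (p : R) n f g (c : R) :
  peano K p n f -> peano K p n g -> peano K p n (fun s => f s + c * g s).
Proof.
move=> [P HP] [Q HQ]; exists (P + c *: Q) => e e0.
have k0 : 0 < 2 * (`|c| + 1) by have := normr_ge0 c; lra.
have [d1 d10 H1] := HP _ (divr_gt0 e0 (ltr0n _ 2)).
have [d2 d20 H2] := HQ _ (divr_gt0 e0 k0).
exists (Num.min d1 d2); first by rewrite lt_min d10.
move=> s Ks; rewrite lt_min => /andP[/(H1 _ Ks) h1 /(H2 _ Ks) h2].
have -> : f s + c * g s - (P + c *: Q).[s - p] = (f s - P.[s - p]) + c * (g s - Q.[s - p]).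
  by rewrite !hornerE; ring.
apply: (le_trans (ler_normD _ _)); rewrite normrM.
set x := `|s - p| ^+ n in h1 h2 *.
have : `|c| * `|g s - Q.[s - p]| <= (`|c| + 1) * (e / (2 * (`|c| + 1)) * x).
  by apply: ler_pM => //; lra.
have -> : (`|c| + 1) * (e / (2 * (`|c| + 1)) * x) = e / 2 * x.
  by field; have := normr_ge0 c; lra.
have -> : e * x = e / 2 * x + e / 2 * x by field.
by move=> h; exact: lerD.
Qed.

Lemma peano_poly (R : realType) (K : set R) (p : R) n (P : {poly R}) :
  peano K p n (fun s => P.[s - p]).
Proof.
exists P => e e0; exists 1 => // s _ _.
by rewrite subrr normr0 mulr_ge0 ?exprn_ge0// ltW.
Qed.

Lemma peano_cst (R : realType) (K : set R) (p : R) n (c : R) : peano K p n (fun=> c).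
Proof.
apply: (@peano_eq_near _ _ _ _ _ _ 1 ltr01 _ (peano_poly K p n c%:P)) => s _ _.
by rewrite hornerC.
Qed.

Lemma peano_sum (R : realType) (I : Type) (r : seq I) (K : set R) (p : R) n (f : I -> R -> R) :
  (forall i, peano K p n (f i)) -> peano K p n (fun s => \sum_(i <- r) f i s).
Proof.
move=> h; elim: r => [|i r IH].
  under eq_fun do rewrite big_nil; exact: peano_cst.
under eq_fun do rewrite big_cons.
have := peano_lin 1 (h i) IH; by under eq_fun do rewrite mul1r.
Qed.

Lemma peano_mul_exp (R : realType) (K : set R) (p : R) n k f :
  peano K p n f -> peano K p (n + k) (fun s => f s * (s - p) ^+ k).
Proof.
move=> [P HP]; exists (P * 'X^k) => e e0; have [d d0 H] := HP e e0.
exists d => // s Ks /(H _ Ks) h.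
rewrite hornerM hornerXn -mulrBl normrM normrX exprD mulrA.
by rewrite ler_wpM2r// exprn_ge0.
Qed.

(** [A s - p = a1 (s - p)]: the expansion is rescaled. *)
Lemma peano_comp_affine (R : realType) (K : set R) (a1 a0 p d : R) n f : 0 < a1 -> 0 < d ->
  affine a1 a0 p = p -> (forall s, K s -> `|s - p| < d -> K (affine a1 a0 s)) ->
  peano K p n f -> peano K p n (f \o affine a1 a0).
Proof.
move=> a10 d0 Ap KA [P HP]; exists (P \Po (a1%:P * 'X)) => e e0.
have c0 : 0 < a1 ^+ n by rewrite exprn_gt0.
have [d1 d10 H1] := HP _ (divr_gt0 e0 c0).
exists (Num.min d (d1 / a1)); first by rewrite lt_min d0 divr_gt0.
move=> s Ks; rewrite lt_min => /andP[sd]; rewrite ltr_pdivlMr// => sd1.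
have [e1 _] := fixed_affine s Ap.
have h := H1 _ (KA _ Ks sd); rewrite e1 normrM (gtr0_norm a10) mulrC exprMn in h.
rewrite horner_comp !hornerE /=.
have := h sd1; congr (_ <= _).
by field; rewrite gt_eqF.
Qed.

(** * Strict differentiability *)

Lemma common_dist (R : realType) (I : finType) (P : I -> R -> Prop) :
  (forall i, exists2 d : R, 0 < d & P i d) ->
  (forall i d d', d' <= d -> P i d -> P i d') ->
  exists2 d : R, 0 < d & forall i, P i d.
Proof.
move=> H mono.
have /choice[D HD] : forall i, exists d : R, 0 < d /\ P i d.
  by move=> i; have [d d0 Pd] := H i; exists d.
exists (\big[Num.min/1]_i D i).
  apply: lt_bigmin => // i _; exact: (HD i).1.
move=> i; apply: mono (HD i).2; exact: bigmin_le_cond.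
Qed.

Definition cont_prod_at (R : realType) (r : nat) (K : set R)
    (g : R -> 'rV[R]_r.+1 -> R) (t : R) (u : 'rV[R]_r.+1) : Prop :=
  forall e : R, 0 < e -> exists2 d : R, 0 < d & forall (s : R) (v : 'rV[R]_r.+1), K s -> `|s - t| < d ->
    (forall i, `|v 0 i - u 0 i| < d) -> `|g s v - g t u| <= e.

Lemma within_cont_prod (R : realType) (r : nat) (K : set R)
    (g : R -> 'rV[R]_r.+1 -> R) :
  {within K `*` [set: 'rV[R]_r.+1], continuous (fun p => g p.1 p.2)} ->
  forall t u, K t -> cont_prod_at K g t u.
Proof.
move=> /subspace_continuousP cg t u Kt e e0.
have /cvgrPdist_le/(_ e e0) := cg (t, u) (conj Kt I).
rewrite /prop_near1 /within /= -nbhs_ballE => -[d /= d0 H].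
exists d => // s v Ks st vu; rewrite distrC.
apply: (H (s, v)) => //; split => /=; first by rewrite /ball /= distrC.
by split => // i j; rewrite !ord1 /ball /= distrC.
Qed.

(** Delta-differentiation on the full line is ordinary differentiation, so the mean
    value inequality and the chain rule apply to real variables as well. *)
Lemma sigma_setT (R : realType) (t : R) : sigma [set: R] t = t.
Proof.
have t1 : t < t + 1 by lra.
have [s1 s2 _] := @sigma_adherent R setT t (t + 1) I t1.
apply/eqP; rewrite eq_le s1 andbT; apply/ler_addgt0Pr => e e0; apply: s2 => //; lra.
Qed.

Lemma mean_value_dist (R : realType) (g dg : R -> R) (x y c e : R) :
  (forall z, is_delta_derive setT g z (dg z)) ->
  (forall z, Num.min x y <= z <= Num.max x y -> `|dg z - c| <= e) ->
  `|g y - g x - c * (y - x)| <= e * `|y - x|.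
Proof.
move=> dgP.
pose h z := g z + (- c) * z.
have dh z : is_delta_derive setT h z (dg z - c).
  by have := is_delta_derive_lin (- c) (dgP z) (is_delta_derive_id setT z); rewrite mulr1.
have -> : g y - g x - c * (y - x) = h y - h x by rewrite /h; ring.
have [xy|yx] := leP x y => H.
  rewrite [X in _ <= _ * X]ger0_norm ?subr_ge0//.
  by apply: (delta_mean_value (@closedT R) _ _ xy) => // u _ uxy; split; [exact: dh|exact: H].
rewrite [X in _ <= _ * X]distrC [X in _ <= _ * X]gtr0_norm ?subr_gt0// distrC.
by apply: (delta_mean_value (@closedT R) _ _ (ltW yx)) => // u _ uxy; split; [exact: dh|exact: H].
Qed.

Lemma derivable_line (R : realType) (n : nat) (f : 'rV[R]_n -> R) (u v : 'rV[R]_n) (h : R) :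
  derivable f (u + h *: v) v ->
  is_delta_derive setT (fun x => f (u + x *: v)) h ('D_v f (u + h *: v)).
Proof.
move=> df; apply/is_delta_deriveP => e e0; rewrite sigma_setT.
have /cvgrPdist_le/(_ e e0) := df.
rewrite /prop_near1 /dnbhs /within /= -nbhs_ballE => -[d /= d0 H].
exists d => // s _ sd.
have [->|sh] := eqVneq s h; first by rewrite !subrr mulr0 subrr normr0 mulr0.
have sh0 : s - h != 0 by rewrite subr_eq0.
have := H (s - h); rewrite /ball /= sub0r normrN => /(_ sd sh0).
rewrite (_ : (s - h) *: v + (u + h *: v) = u + s *: v); last first.
  by rewrite scalerBl addrCA subrK.
rewrite -/('D_v f (u + h *: v)) /GRing.scale /=.
set D := 'D_v f _; set F := f (u + s *: v); set G := f (u + h *: v) => HD.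
have -> : G - F - D * (h - s) = (D - (s - h)^-1 * (F - G)) * (s - h).
  by field.
by rewrite normrM [`|h - s|]distrC ler_wpM2r.
Qed.

(** Change [v] into [u] one coordinate at a time and apply the mean value
    inequality on each of the segments, where the partial derivative is close to its
    value at [(t0, u0)]. The point [t] is a mere parameter, which makes the estimate
    uniform in [t]. *)
Lemma uniform_strict_diff (R : realType) (r : nat) (K : set R)
    (f : R -> 'rV[R]_r.+1 -> R) (t0 : R) (u0 : 'rV[R]_r.+1) :
  (forall (i : 'I_r.+1) t (u : 'rV[R]_r.+1), K t -> derivable (f t) u (delta_mx 0 i)) ->
  (forall i, cont_prod_at K (partial_u i f) t0 u0) ->
  forall e : R, 0 < e -> exists2 d : R, 0 < d & forall (t : R) (u v : 'rV[R]_r.+1), K t -> `|t - t0| < d ->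
    (forall i, `|u 0 i - u0 0 i| < d) -> (forall i, `|v 0 i - u0 0 i| < d) ->
    `|f t u - f t v - \sum_i partial_u i f t0 u0 * (u 0 i - v 0 i)|
      <= e * \sum_i `|u 0 i - v 0 i|.
Proof.
move=> df cf e e0.
have [|d d0 H] := @common_dist R 'I_r.+1 (fun i d => forall (s : R) (v : 'rV[R]_r.+1), K s -> `|s - t0| < d ->
    (forall i, `|v 0 i - u0 0 i| < d) ->
    `|partial_u i f s v - partial_u i f t0 u0| <= e) (fun i => cf i e e0).
  move=> i d d' d'd Hd s v Ks sd' vd'; apply: Hd => //; first exact: lt_le_trans d'd.
  by move=> j; exact: lt_le_trans d'd.
exists d => // t u v Kt td ud vd.
pose w k : 'rV[R]_r.+1 := \row_j (if (j < k)%N then u 0 j else v 0 j).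
have w0 : w 0%N = v by apply/rowP => j; rewrite mxE.
have wN : w r.+1 = u by apply/rowP => j; rewrite mxE ltn_ord.
have -> : f t u - f t v = \sum_(k < r.+1) (f t (w k.+1) - f t (w k)).
  by rewrite -w0 -wN -(telescope_sumr (fun k => f t (w k)) (leq0n r.+1)) big_mkord.
rewrite -sumrB mulr_sumr; apply: (le_trans (ler_norm_sum _ _ _)).
apply: ler_sum => k _.
pose e_ : 'rV[R]_r.+1 := delta_mx 0 k.
have wS : w k.+1 = w k + (u 0 k - v 0 k) *: e_.
  apply/rowP => j; rewrite !mxE eqxx /= ltnS.
  have [->|jk] := eqVneq j k; first by rewrite leqnn ltnn mulr1 addrC subrK.
  by rewrite mulr0 addr0 leq_eqVlt (negbTE (jk : val j != val k)).
have := @mean_value_dist R (fun x => f t (w k + x *: e_))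
  (fun x => partial_u k f t (w k + x *: e_)) 0 (u 0 k - v 0 k) (partial_u k f t0 u0) e.
rewrite scale0r addr0 subr0 -wS; apply.
  by move=> z; apply: derivable_line; exact: df.
move=> z zr; apply: H => // j; rewrite !mxE eqxx /=.
have [->|jk] := eqVneq j k; last by rewrite mulr0 addr0; case: ifP.
rewrite ltnn mulr1.
have := ud k; have := vd k; rewrite !ltr_distl; move: zr.
by case: (leP 0 (u 0 k - v 0 k)) => ? /andP[? ?] ? ?; lra.
Qed.

(** * Functions along a curve *)

(** Write [f t (x t) - f s (x s)] as [f t (x t) - f s (x t)] plus
    [f s (x t) - f s (x s)]. The first term is a derivative at the fixed vector [x t]; the
    second is covered by strict differentiability, uniformly in [s]. *)
Lemma chain_fixed (R : realType) (r : nat) (K : set R) (f : R -> 'rV[R]_r.+1 -> R)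
    (x : 'I_r.+1 -> R -> R) (t lt : R) (c l : 'I_r.+1 -> R) :
  K t -> sigma K t = t ->
  (forall e : R, 0 < e -> exists2 d : R, 0 < d &
    forall (s : R) (u v : 'rV[R]_r.+1), K s -> `|s - t| < d ->
    (forall i, `|u 0 i - x i t| < d) -> (forall i, `|v 0 i - x i t| < d) ->
    `|f s u - f s v - \sum_i c i * (u 0 i - v 0 i)| <= e * \sum_i `|u 0 i - v 0 i|) ->
  is_delta_derive K (f ^~ (\row_i x i t)) t lt ->
  (forall i, is_delta_derive K (x i) t (l i)) ->
  is_delta_derive K (fun s => f s (\row_i x i s)) t (lt + \sum_i c i * l i).
Proof.
move=> Kt st sd /is_delta_deriveP dlt dx.
have cx i : cont_at K (x i) t := is_delta_derive_cont Kt (dx i).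
apply/is_delta_deriveP => e e0; rewrite st in dlt *.
pose M := \sum_i (`|l i| + 1) + 1.
have M0 : 0 < M.
  by apply: ltr_wpDl => //; apply: sumr_ge0 => i _; rewrite addr_ge0.
pose C := \sum_i `|c i| + 1.
have C0 : 0 < C by apply: ltr_wpDl => //; apply: sumr_ge0.
have k1 : 0 < e / 3 by lra.
have k2 : 0 < e / 3 / M by rewrite divr_gt0.
have k3 : 0 < Num.min 1 (e / 3 / C / r.+1%:R) by rewrite lt_min ltr01 !divr_gt0.
have [d1 d10 H1] := dlt _ k1.
have [d2 d20 H2] := sd _ k2.
have [||d3 d30 H3] := @common_dist R 'I_r.+1 (fun i d => forall s, K s -> `|s - t| < d ->
    `|x i t - x i s - l i * (t - s)| <= Num.min 1 (e / 3 / C / r.+1%:R) * `|t - s|) .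
- by move=> i; have /is_delta_deriveP/(_ _ k3) := dx i; rewrite st.
- by move=> i d d' d'd Hd s Ks sd'; apply: Hd => //; exact: lt_le_trans d'd.
have [||d4 d40 H4] := @common_dist R 'I_r.+1 (fun i d => forall s, K s -> `|s - t| < d ->
    `|x i s - x i t| < d2) .
- move=> i; have d22 : 0 < d2 / 2 by lra.
  have [d d0 Hd] := cx i _ d22; exists d => // s Ks /(Hd s Ks); lra.
- by move=> i d d' d'd Hd s Ks sd'; apply: Hd => //; exact: lt_le_trans d'd.
exists (Num.min (Num.min d1 d2) (Num.min d3 d4)); first by rewrite !lt_min d10 d20 d30.
move=> s Ks; rewrite !lt_min => /andP[/andP[sd1 sd2] /andP[sd3 sd4]].
set u : 'rV[R]_r.+1 := \row_i x i t; set v : 'rV[R]_r.+1 := \row_i x i s.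
have h1 := H1 _ Ks sd1.
have h2 : `|f s u - f s v - \sum_i c i * (u 0 i - v 0 i)| <= e / 3 / M * \sum_i `|u 0 i - v 0 i|.
  apply: H2 => // i; rewrite mxE; first by rewrite subrr normr0.
  exact: H4.
have h3 i : `|x i t - x i s - l i * (t - s)| <= Num.min 1 (e / 3 / C / r.+1%:R) * `|t - s|.
  exact: H3.
have h4 i : `|u 0 i - v 0 i| <= (`|l i| + 1) * `|t - s|.
  rewrite !mxE -[x i t - x i s](subrK (l i * (t - s))) mulrDl mul1r addrC.
  apply: (le_trans (ler_normD _ _)); rewrite normrM lerD2l; apply: (le_trans (h3 i)).
  by rewrite ler_piMl// ge_min lexx.
have h5 : \sum_i `|u 0 i - v 0 i| <= M * `|t - s|.
  apply: (@le_trans _ _ ((\sum_i (`|l i| + 1)) * `|t - s|)).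
    by rewrite mulr_suml; apply: ler_sum => i _; exact: h4.
  by rewrite ler_wpM2r// lerDl.
have h6 : `|\sum_i c i * (u 0 i - v 0 i - l i * (t - s))| <= e / 3 * `|t - s|.
  apply: (le_trans (ler_norm_sum _ _ _)).
  apply: (@le_trans _ _ (\sum_(i < r.+1) e / 3 / r.+1%:R * `|t - s|)).
    apply: ler_sum => i _; rewrite !mxE normrM.
    have -> : e / 3 / r.+1%:R * `|t - s| = C * (e / 3 / C / r.+1%:R * `|t - s|).
      have gen (C' N z : R) : C' != 0 -> N != 0 -> e / 3 / N * z = C' * (e / 3 / C' / N * z).
        by move=> C'0 N0; field; rewrite C'0 N0.
      by apply: gen; rewrite ?pnatr_eq0// gt_eqF.
    apply: ler_pM => //.
      rewrite /C (bigD1 i)//= -addrA lerDl addr_ge0// sumr_ge0//.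
    by apply: (le_trans (h3 i)); rewrite ler_wpM2r// ge_min lexx orbT.
  by rewrite sumr_const card_ord -[X in X <= _]mulr_natr mulrAC divfK ?pnatr_eq0.
have -> : f t u - f s v - (lt + \sum_i c i * l i) * (t - s) =
   (f t u - f s u - lt * (t - s)) + (f s u - f s v - \sum_i c i * (u 0 i - v 0 i))
   + \sum_i c i * (u 0 i - v 0 i - l i * (t - s)).
  have -> : \sum_i c i * (u 0 i - v 0 i - l i * (t - s)) =
     \sum_i c i * (u 0 i - v 0 i) - (\sum_i c i * l i) * (t - s).
    by rewrite mulr_suml -sumrB; apply: eq_bigr => i _; ring.
  ring.
have h7 : e / 3 / M * \sum_i `|u 0 i - v 0 i| <= e / 3 * `|t - s|.
  apply: (@le_trans _ _ (e / 3 / M * (M * `|t - s|))); first by rewrite ler_pM2l.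
  by rewrite mulrA divfK ?gt_eqF.
apply: (le_trans (ler_normD _ _)).
have := ler_normD (f t u - f s u - lt * (t - s)) (f s u - f s v - \sum_i c i * (u 0 i - v 0 i)).
have -> : e * `|t - s| = e / 3 * `|t - s| + e / 3 * `|t - s| + e / 3 * `|t - s| by field.
move=> h8; apply: lerD => //; apply: (le_trans h8); apply: lerD => //.
exact: le_trans h7.
Qed.

Lemma is_delta_derive_horner (R : realType) (P : {poly R}) (p s : R) :
  is_delta_derive setT (fun u => P.[u - p]) s (P^`().[s - p]).
Proof.
elim/poly_ind: P => [|q c IH].
  rewrite deriv0 horner0; under eq_fun do rewrite horner0.
  exact: is_delta_derive_cst.
have dX : is_delta_derive setT (fun u => u - p) s 1.
  have := is_delta_derive_lin 1 (is_delta_derive_id setT s) (is_delta_derive_cst setT s (- p)).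
  by rewrite mulr0 addr0; under eq_fun do rewrite mul1r.
have dM := is_delta_derive_mul I (sigma_setT s) IH dX.
have := is_delta_derive_lin 1 dM (is_delta_derive_cst setT s c).
rewrite mulr0 addr0 mulr1 derivMXaddC hornerD hornerM hornerX [X in is_delta_derive _ _ _ X -> _]addrC.
by congr is_delta_derive; apply/funext => u; rewrite !hornerE ?mul1r.
Qed.

Lemma lagrangian_cont (R : realType) (r : nat) n K (f : R -> 'rV[R]_r.+1 -> R) :
  lagrangian_C n K f -> forall t u, K t -> cont_prod_at K f t u.
Proof. by case: n => [|n] [cf _]; exact: within_cont_prod. Qed.

Lemma lagrangian_deltan_derivable (R : realType) (r : nat) n K (f : R -> 'rV[R]_r.+1 -> R) u :
  lagrangian_C n K f -> deltan_derivable K n (f ^~ u).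
Proof.
elim: n K f => [//|n IH] K f [_ [_ [df lf]]].
by apply/deltan_derivableS; split=> [t kt|]; [exact: df|exact: IH lf].
Qed.

Lemma lagrangian_C_pred (R : realType) (r : nat) n K (f : R -> 'rV[R]_r.+1 -> R) :
  lagrangian_C n.+1 K f -> lagrangian_C n K f.
Proof.
elim: n K f => [|n IH] K f [cf [uf [df lf]]]; first by split.
split => //; split; first by move=> i; have [h1 h2] := uf i; split => //; exact: IH.
by split => //; exact: IH.
Qed.

Lemma lagrangian_strict_diff (R : realType) (r : nat) n K (f : R -> 'rV[R]_r.+1 -> R) t0 (u0 : 'rV[R]_r.+1) :
  lagrangian_C n.+1 K f -> K t0 ->
  forall e : R, 0 < e -> exists2 d : R, 0 < d &
    forall (t : R) (u v : 'rV[R]_r.+1), K t -> `|t - t0| < d ->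
    (forall i, `|u 0 i - u0 0 i| < d) -> (forall i, `|v 0 i - u0 0 i| < d) ->
    `|f t u - f t v - \sum_i partial_u i f t0 u0 * (u 0 i - v 0 i)|
      <= e * \sum_i `|u 0 i - v 0 i|.
Proof.
move=> [_ [uf _]] Kt0; apply: uniform_strict_diff => [i t u|i]; first exact: (uf i).1.
exact: lagrangian_cont (uf i).2 _ _ Kt0.
Qed.

(** Families [G t s] with enough smoothness at [(p, p)] for a joint expansion:
    [n] derivatives in [s], the [k]-th of which has at [s = p] a Peano expansion of
    order [n - k] in [t]. Only [|s - p| <= |t - p|] matters for the diagonal. *)
Fixpoint expandable (R : realType) (K : set R) (p : R) (n : nat) (G : R -> R -> R) : Prop :=
  if n is m.+1 then
    peano K p m.+1 (G ^~ p) /\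
    exists G' : R -> R -> R, (forall t s, K t -> is_delta_derive setT (G t) s (G' t s)) /\
      expandable K p m G'
  else forall e : R, 0 < e -> exists2 d : R, 0 < d & forall t, K t -> `|t - p| < d ->
    forall s, `|s - p| <= `|t - p| -> `|G t s - G p p| <= e.

Lemma is_delta_derive_power_sum (R : realType) (c : nat -> R) (p s : R) n :
  is_delta_derive setT (fun v => \sum_(k < n) c k / k.+1%:R * (v - p) ^+ k.+1) s
    (\sum_(k < n) c k * (s - p) ^+ k).
Proof.
apply: is_delta_derive_sum => k.
have := is_delta_derive_horner ((c k / k.+1%:R) *: 'X^(k.+1)) p s.
rewrite derivZ derivXn hornerZ hornerMn hornerXn /=.
rewrite mulrnAr -mulrnAl -[(c k / _) *+ _]mulr_natr divfK ?pnatr_eq0//.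
by under eq_fun do rewrite hornerZ hornerXn.
Qed.

(** Taylor expansion in [s] by induction on [n]: integrate the expansion of the
    derivative from [p] to [s]. The coefficients are functions of [t]. *)
Lemma expandable_taylor (R : realType) (K : set R) (p : R) (n : nat) (G : R -> R -> R) :
  expandable K p n G -> exists c : nat -> R -> R,
    (forall k, (k <= n)%N -> peano K p (n - k) (c k)) /\
    forall e : R, 0 < e -> exists2 d : R, 0 < d & forall t, K t -> `|t - p| < d ->
    forall s, `|s - p| <= `|t - p| ->
      `|G t s - \sum_(k < n.+1) c k t * (s - p) ^+ k| <= e * `|t - p| ^+ n.
Proof.
elim: n G => [|n IH] G.
  move=> H; exists (fun _ _ => G p p); split; first by move=> k _; exact: peano_cst.
  move=> e e0; have [d d0 Hd] := H e e0; exists d => // t Kt td s st.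
  by rewrite big_ord1 !expr0 !mulr1; exact: Hd.
move=> [pG [G' [dG /IH[c [pc Hc]]]]].
exists (fun k t => if k is j.+1 then c j t / j.+1%:R else G t p); split.
  case=> [|k] kn; first by rewrite subn0.
  rewrite subSS.
  have h := peano_lin (k.+1%:R^-1) (peano_cst K p (n - k) 0) (pc k kn).
  by apply: (peano_eq_near ltr01 _ h) => s _ _; rewrite add0r mulrC.
move=> e e0; have [d d0 Hd] := Hc e e0; exists d => // t Kt td s st.
rewrite big_ord_recl /= expr0 mulr1.
pose g v := G t v + (-1) * \sum_(k < n.+1) c k t / k.+1%:R * (v - p) ^+ k.+1.
pose dg v := G' t v + (-1) * \sum_(k < n.+1) c k t * (v - p) ^+ k.
have dgP v : is_delta_derive setT g v (dg v).
  apply: is_delta_derive_lin; [exact: dG|].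
  exact: (is_delta_derive_power_sum (c ^~ t)).
have -> : G t s - (G t p + \sum_(i < n.+1) c i t / i.+1%:R * (s - p) ^+ bump 0 i) =
    g s - g p - 0 * (s - p).
  rewrite /g subrr.
  have -> : \sum_(k < n.+1) c k t / k.+1%:R * (0 : R) ^+ k.+1 = 0.
    by apply: big1 => k _; rewrite expr0n mulr0.
  ring.
apply: (le_trans (@mean_value_dist _ g dg p s 0 (e * `|t - p| ^+ n) dgP _)).
  move=> z zps; rewrite subr0 /dg mulN1r; apply: Hd => //; apply: le_trans st.
  move: zps; case: (leP p s) => ? /andP[? ?]; first by rewrite !ger0_norm; lra.
  by rewrite !ler0_norm; lra.
by rewrite exprSr mulrA ler_wpM2l// mulr_ge0 ?exprn_ge0// ltW.
Qed.

Lemma peano_approx (R : realType) (K : set R) (p : R) (n : nat) f g :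
  (forall e : R, 0 < e -> exists2 d : R, 0 < d & forall t, K t -> `|t - p| < d ->
     `|g t - f t| <= e * `|t - p| ^+ n) -> peano K p n f -> peano K p n g.
Proof.
move=> H [P HP]; exists P => e e0; have e20 : 0 < e / 2 by lra.
have [d1 d10 H1] := H _ e20; have [d2 d20 H2] := HP _ e20.
exists (Num.min d1 d2); first by rewrite lt_min d10.
move=> s Ks; rewrite lt_min => /andP[/(H1 s Ks) h1 /(H2 s Ks) h2].
have -> : g s - P.[s - p] = (g s - f s) + (f s - P.[s - p]) by ring.
apply: (le_trans (ler_normD _ _)).
have -> : e * `|s - p| ^+ n = e / 2 * `|s - p| ^+ n + e / 2 * `|s - p| ^+ n by field.
exact: lerD.
Qed.

Lemma expandable_diagonal (R : realType) (K : set R) (p : R) (n : nat) (G : R -> R -> R) :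
  expandable K p n G -> peano K p n (fun t => G t t).
Proof.
move=> /expandable_taylor[c [pc Hc]].
apply: (@peano_approx _ _ _ _ (fun t => \sum_(k < n.+1) c k t * (t - p) ^+ k)).
  by move=> e e0; have [d d0 Hd] := Hc e e0; exists d => // t Kt td; exact: Hd.
apply: peano_sum => k.
by have := peano_mul_exp k (pc k (ltn_ord k)); rewrite subnK// -ltnS.
Qed.

Lemma expandable_add (R : realType) (K : set R) (p : R) n (G H : R -> R -> R) :
  expandable K p n G -> expandable K p n H -> expandable K p n (fun t s => G t s + H t s).
Proof.
elim: n G H => [|n IH] G H.
  move=> HG HH e e0; have e20 : 0 < e / 2 by lra.
  have [d1 d10 H1] := HG _ e20; have [d2 d20 H2] := HH _ e20.
  exists (Num.min d1 d2); first by rewrite lt_min d10.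
  move=> t Kt; rewrite lt_min => /andP[td1 td2] s st.
  have -> : G t s + H t s - (G p p + H p p) = (G t s - G p p) + (H t s - H p p) by ring.
  apply: (le_trans (ler_normD _ _)).
  by have := H1 t Kt td1 s st; have := H2 t Kt td2 s st; lra.
move=> [pG [G' [dG gG]]] [pH [H' [dH gH]]]; split.
  have := peano_lin 1 pG pH; by under eq_fun do rewrite mul1r.
exists (fun t s => G' t s + H' t s); split; last exact: IH.
by move=> t s Kt; apply: is_delta_derive_add; [exact: dG|exact: dH].
Qed.

Lemma expandable_sum (R : realType) (I : Type) (r : seq I) (K : set R) (p : R) n
    (G : I -> R -> R -> R) : expandable K p n (fun _ _ => 0) ->
  (forall i, expandable K p n (G i)) -> expandable K p n (fun t s => \sum_(i <- r) G i t s).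
Proof.
move=> g0 HG; elim: r => [|i r IH].
  by congr expandable: g0; apply/funext => t; apply/funext => s; rewrite big_nil.
have := expandable_add (HG i) IH; congr expandable.
by apply/funext => t; apply/funext => s; rewrite big_cons.
Qed.

Lemma expandable0 (R : realType) (K : set R) (p : R) n : expandable K p n (fun _ _ => 0).
Proof.
elim: n => [|n IH].
  by move=> e e0; exists 1 => // t _ _ s _; rewrite subrr normr0 ltW.
split; first exact: peano_cst.
by exists (fun _ _ => 0); split => // t s _; exact: is_delta_derive_cst.
Qed.

(** Differentiation in [s] replaces [f] by its partial derivatives and [q] by
    products with derivatives of [x]. The polynomial factor [q] is what makes this
    family stable. *)
Lemma expandable_curve (R : realType) (r : nat) (K : set R) (p : R) N : K p ->
  (forall n g, (0 < n <= N)%N -> deltan_derivable K n g -> peano K p n g) ->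
  forall n (f : R -> 'rV[R]_r.+1 -> R) (x : 'I_r.+1 -> {poly R}) (q : {poly R}),
  (n <= N)%N -> lagrangian_C n K f ->
  expandable K p n (fun t s => f t (\row_i (x i).[s - p]) * q.[s - p]).
Proof.
move=> Kp Hp; elim=> [|n IH] f x q nN lf.
  move=> e e0; rewrite subrr.
  pose u0 : 'rV[R]_r.+1 := \row_i (x i).[0]; set a0 := f p _; set b0 := q.[0].
  pose c := 2 * (`|b0| + 1); pose c' := 2 * (`|a0| + 1).
  have c0 : 0 < c by rewrite /c; have := normr_ge0 b0; lra.
  have c'0 : 0 < c' by rewrite /c'; have := normr_ge0 a0; lra.
  have [d1 d10 H1] := lagrangian_cont lf u0 Kp (divr_gt0 e0 c0).
  have k0 : 0 < Num.min 1 (e / c') by rewrite lt_min ltr01 divr_gt0.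
  have [d2 d20 H2] := poly_near0 q k0.
  have [||d3 d30 H3] := @common_dist R 'I_r.+1 (fun i d => forall z, `|z| < d ->
    `|(x i).[z] - (x i).[0]| < d1).
  - move=> i; have d12 : 0 < d1 / 2 by lra.
    have [d d0 Hd] := poly_near0 (x i) d12; exists d => // z /Hd; lra.
  - by move=> i d d' d'd Hd z zd; apply: Hd; exact: lt_le_trans d'd.
  exists (Num.min d1 (Num.min d2 d3)); first by rewrite !lt_min d10 d20.
  move=> t Kt; rewrite !lt_min => /and3P[td1 td2 td3] s st.
  set a := f t _; set b := q.[s - p].
  have ha : `|a - a0| <= e / c.
    by apply: H1 => // i; rewrite !mxE; apply: H3; exact: le_lt_trans td3.
  have hb : `|b - b0| <= Num.min 1 (e / c') by apply: H2; exact: le_lt_trans td2.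
  rewrite le_min in hb; move: hb => /andP[hb1 hb2].
  have hb3 : `|b| <= `|b0| + 1.
    by rewrite -[b](subrK b0) addrC; apply: (le_trans (ler_normD _ _)); rewrite lerD2l.
  have -> : a * b - a0 * b0 = (a - a0) * b + a0 * (b - b0) by ring.
  apply: (le_trans (ler_normD _ _)); rewrite !normrM.
  have -> : e = e / c * (`|b0| + 1) + (`|a0| + 1) * (e / c').
    by rewrite /c /c'; field; apply/andP; split; rewrite gt_eqF// ltr_wpDl.
  by apply: lerD; apply: ler_pM => //; lra.
split.
  rewrite subrr.
  have pf : peano K p n.+1 (f ^~ (\row_i (x i).[0])).
    by apply: Hp; [rewrite nN|exact: lagrangian_deltan_derivable].
  have := peano_lin q.[0] (peano_cst K p n.+1 0) pf; congr peano.
  by apply/funext => t; rewrite add0r mulrC.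
exists (fun t s => \sum_i (partial_u i f t (\row_i (x i).[s - p]) * ((x i)^`() * q).[s - p])
   + f t (\row_i (x i).[s - p]) * q^`().[s - p]); split; last first.
  apply: expandable_add => //; last by apply: IH; [exact: ltnW|exact: lagrangian_C_pred].
  apply: expandable_sum => // [|i]; first exact: expandable0.
  by apply: IH; [exact: ltnW|exact: (lf.2.1 i).2].
move=> t s Kt.
have dx i := is_delta_derive_horner (x i) p s.
have df : is_delta_derive setT (fun s => f t (\row_i (x i).[s - p])) s
    (0 + \sum_i partial_u i f t (\row_i (x i).[s - p]) * (x i)^`().[s - p]).
  apply: (@chain_fixed R r setT (fun _ => f t) (fun i s => (x i).[s - p])) => //.
  - exact: sigma_setT.
  - move=> e e0; have [d d0 H] := lagrangian_strict_diff (\row_i (x i).[s - p]) lf Kt e0.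
    exists d => // _ u v _ _ ud vd; apply: H => //; first by rewrite subrr normr0.
      by move=> i; rewrite mxE.
    by move=> i; rewrite mxE.
  - exact: is_delta_derive_cst.
have := is_delta_derive_mul I (sigma_setT s) df (is_delta_derive_horner q p s).
congr is_delta_derive; rewrite add0r mulr_suml; congr (_ + _).
by apply: eq_bigr => i _; rewrite hornerM; ring.
Qed.

(** Replacing the curve by its polynomial costs [o(|t - p|^(n + 1))], because [f] is
    Lipschitz in [u] near [p]. Along a polynomial curve the arguments [t] and [s] of
    [f t (x s)] can be separated, and the diagonal is expandable. *)
Lemma peano_lagrangian (R : realType) (r : nat) (K : set R) (p : R) N n
    (f : R -> 'rV[R]_r.+1 -> R) (x : 'I_r.+1 -> R -> R) : K p ->
  (forall n g, (0 < n <= N)%N -> deltan_derivable K n g -> peano K p n g) ->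
  (n < N)%N -> lagrangian_C n.+1 K f -> (forall i, peano K p n.+1 (x i)) ->
  peano K p n.+1 (fun t => f t (\row_i x i t)).
Proof.
move=> Kp Hp nN lf /choice[P HP].
have gP := expandable_diagonal (expandable_curve Kp Hp P 1 nN lf).
apply: peano_approx gP => e e0.
pose c i := partial_u i f p (\row_i (P i).[0]).
have [d d0 Hd] := lagrangian_strict_diff (\row_i (P i).[0]) lf Kp ltr01.
pose M := \sum_i (`|c i| + 1) + 1.
have M0 : 0 < M by apply: ltr_wpDl => //; apply: sumr_ge0 => i _; rewrite addr_ge0.
have d20 : 0 < d / 2 by lra.
have k0 : 0 < Num.min (e / M) (d / 2) by rewrite lt_min !divr_gt0.
have [||d1 d10 H1] := @common_dist R 'I_r.+1 (fun i d1 => forall s, K s -> `|s - p| < d1 ->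
    `|x i s - (P i).[s - p]| <= Num.min (e / M) (d / 2) * `|s - p| ^+ n.+1).
- by move=> i; exact: HP k0.
- by move=> i d1 d' d'd H s Ks sd; apply: H => //; exact: lt_le_trans d'd.
have [||d2 d20' H2] := @common_dist R 'I_r.+1 (fun i d1 => forall z, `|z| < d1 ->
    `|(P i).[z] - (P i).[0]| < d / 2).
- move=> i; have d40 : 0 < d / 4 by lra.
  have [d1' d10' Hd1] := poly_near0 (P i) d40; exists d1' => // z /Hd1; lra.
- by move=> i d1' d' d'd H z zd; apply: H; exact: lt_le_trans d'd.
exists (Num.min 1 (Num.min d (Num.min d1 d2))); first by rewrite !lt_min ltr01 d0 d10.
move=> t Kt; rewrite !lt_min => /and4P[t1 td td1 td2].
rewrite hornerC mulr1.
set u : 'rV[R]_r.+1 := \row_i x i t; set v : 'rV[R]_r.+1 := \row_i (P i).[t - p].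
set y := `|t - p| ^+ n.+1.
have y0 : 0 <= y by rewrite exprn_ge0.
have y1 : y <= 1 by rewrite exprn_ile1// ltW.
have huv i : `|u 0 i - v 0 i| <= Num.min (e / M) (d / 2) * y by rewrite !mxE; exact: H1.
have hv i : `|v 0 i - (P i).[0]| < d / 2 by rewrite mxE; exact: H2.
have huv2 i : `|u 0 i - v 0 i| <= d / 2.
  apply: (le_trans (huv i)); apply: (@le_trans _ _ (d / 2 * y)).
    by rewrite ler_wpM2r// ge_min lexx orbT.
  by rewrite ler_piMr// ltW.
have := Hd t u v Kt td; rewrite -/c => h.
have {}h : `|f t u - f t v - \sum_i c i * (u 0 i - v 0 i)| <= 1 * \sum_i `|u 0 i - v 0 i|.
  apply: h => i; rewrite [X in _ - X]mxE; last by apply: (lt_le_trans (hv i)); lra.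
  rewrite -[u 0 i](subrK (v 0 i)) -addrA; apply: (le_lt_trans (ler_normD _ _)).
  by have := huv2 i; have := hv i; lra.
rewrite mul1r in h.
have -> : f t u - f t v = (f t u - f t v - \sum_i c i * (u 0 i - v 0 i)) + \sum_i c i * (u 0 i - v 0 i).
  by rewrite subrK.
apply: (le_trans (ler_normD _ _)).
apply: (@le_trans _ _ (\sum_i (`|c i| + 1) * `|u 0 i - v 0 i|)).
  under [X in _ <= X]eq_bigr do rewrite mulrDl mul1r.
  rewrite big_split /= addrC; apply: lerD => //.
  apply: (le_trans (ler_norm_sum _ _ _)); apply: ler_sum => i _.
  by rewrite normrM.
apply: (@le_trans _ _ (\sum_i (`|c i| + 1) * (e / M * y))).
  apply: ler_sum => i _; rewrite ler_wpM2l ?addr_ge0//; apply: (le_trans (huv i)).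
  by rewrite ler_wpM2r// ge_min lexx.
rewrite -mulr_suml; apply: (@le_trans _ _ (M * (e / M * y))).
  apply: ler_wpM2r; last by rewrite /M lerDl.
  by rewrite mulr_ge0 ?divr_ge0 ?(ltW e0) ?(ltW M0).
by rewrite mulrA [M * _]mulrC divfK// gt_eqF.
Qed.

(** * Dense time scales *)

(** Near a fixed point, [A s] is near it as well, so that also the value at the jump
    is known to vanish. *)
Lemma deltan_near0 (R : realType) (K : set R) (a1 a0 : R) n f (p : R) :
  0 < a1 -> affine_scale K (affine a1 a0) n -> affine a1 a0 p = p ->
  (exists2 d : R, 0 < d & forall s, K s -> `|s - p| < d -> f s = 0) ->
  forall m, (m <= n)%N -> exists2 d : R, 0 < d &
    forall s, kappan K m s -> `|s - p| < d -> deltan K m f s = 0.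
Proof.
move=> a10 hA Ap f0; elim=> [//|m IH] mn.
have [d d0 Hd] := IH (ltnW mn).
have k0 : 0 < a1 + 1 by lra.
exists (d / (a1 + 1)); first by rewrite divr_gt0.
move=> s ks; rewrite ltr_pdivlMr// => sd.
have sd1 : `|s - p| < d by apply: le_lt_trans sd; rewrite ler_peMr//; lra.
have [sE KA _ _] := hA m s mn ks.
apply: (affine_scale_deltaE hA mn ks).
have d'0 : 0 < d - `|s - p| by rewrite subr_gt0.
apply: (@is_delta_derive_near _ _ (fun=> 0) _ _ _ (d - `|s - p|)) => //.
- rewrite sE; symmetry; apply: Hd => //; have [-> _] := fixed_affine s Ap.
  rewrite normrM gtr0_norm// mulrC; apply: le_lt_trans sd.
  by rewrite ler_wpM2l//; lra.
- move=> u Ku us; symmetry; apply: Hd => //.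
  rewrite (_ : u - p = (u - s) + (s - p)); last by ring.
  by apply: (le_lt_trans (ler_normD _ _)); lra.
- exact: is_delta_derive_cst.
Qed.

Definition dense_scale (R : realType) (T : set R) : Prop :=
  kappa T = T /\ forall t, T t -> sigma T t = t /\ limit_point T t.

(** If the maximum were left-scattered, its backward jump would be a right-scattered
    point fixed by sigma. *)
Lemma dense_scale_affine (R : realType) (T : set R) (a b a1 a0 : R) (n : nat) : closed T ->
  T a -> T b -> a < b ->
  affine_scale T (affine a1 a0) n.+1 -> a1 = 1 -> a0 = 0 -> dense_scale T.
Proof.
move=> cT Ta Tb ab hA a1E a0E.
have AE t : affine a1 a0 t = t by rewrite /affine a1E a0E mul1r addr0.
have kT : kappa T = T.
  apply/seteqP; split => t; first by case.
  move=> Tt; apply: contrapT => nk; have [ubt _] := not_kappa Tt nk.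
  have at_ : a < t by apply: (lt_le_trans ab); exact: ubt.
  have Tr := rho_in cT Ta at_.
  have [r1 r2 _] := rho_adherent Ta at_.
  have rt : rho T t < t.
    by rewrite lt_neqAle r1 andbT; apply/eqP => rt; apply: nk; split => //; right.
  have kr : kappa T (rho T t) by split => //; left; exists t.
  have [sE _ _ _] := hA 0%N _ (ltn0Sn n) kr; rewrite AE /= in sE.
  have tr : 0 < t - rho T t by rewrite subr_gt0.
  have [_ _ /(_ _ tr)[s [Ts rs _]]] := sigma_adherent Tt rt.
  by rewrite sE addrCA subrr addr0 => /(r2 _ Ts); rewrite leNgt rs.
split => // t Tt; have kt : kappa T t by rewrite kT.
by have [sE _ _ [lp _]] := hA 0%N _ (ltn0Sn n) kt; rewrite AE in sE lp; split; auto.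
Qed.

Lemma dense_kappan (R : realType) (T : set R) m : dense_scale T -> kappan T m = T.
Proof. by case=> kT _; elim: m => [//|m IH]; rewrite /kappan iterS -/(kappan T m) IH. Qed.

Lemma dense_affine_scale (R : realType) (T : set R) n : dense_scale T ->
  affine_scale T (affine 1 0) n.
Proof.
move=> D m t _; rewrite !(dense_kappan _ D) => Tt.
have AE : affine 1 0 t = t by rewrite /affine mul1r addr0.
by have [sE lp] := D.2 t Tt; rewrite AE.
Qed.

Lemma dense_delta_CS (R : realType) (T : set R) n f : dense_scale T ->
  delta_C T n.+1 f <->
  (forall t, T t -> delta_derivable T f t) /\ delta_C T n (delta T f).
Proof. by move=> D; have := delta_CS T n f; rewrite D.1. Qed.

Lemma dense_deltaE (R : realType) (T : set R) f (t l : R) : dense_scale T -> T t ->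
  is_delta_derive T f t l -> delta T f t = l.
Proof. by move=> D Tt; apply: deltaE => //; right; exact: (D.2 t Tt).2. Qed.

Lemma delta_C_mul (R : realType) (T : set R) n f g : dense_scale T ->
  delta_C T n f -> delta_C T n g -> delta_C T n (fun s => f s * g s).
Proof.
move=> D; elim: n f g => [|n IH] f g.
  by move=> [_ cf] [_ cg]; split => // x; apply: cvgM; [exact: cf|exact: cg].
move=> hf hg; have [df cf] := (dense_delta_CS n f D).1 hf.
have [dg cg] := (dense_delta_CS n g D).1 hg.
have dM t : T t -> is_delta_derive T (fun s => f s * g s) t
    (delta T f t * g t + f t * delta T g t).
  move=> Tt; apply: is_delta_derive_mul => //; first exact: (D.2 t Tt).1.
    by apply: deltaP; exact: df.
  by apply: deltaP; exact: dg.
apply/(dense_delta_CS _ _ D); split; first by move=> t Tt; eexists; exact: dM.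
apply: (@delta_C_eq _ T _ _ (fun t => delta T f t * g t + 1 * (f t * delta T g t))
  _ (@dense_affine_scale _ _ n D)).
  by move=> t Tt; rewrite mul1r (dense_deltaE D Tt (dM t Tt)).
apply: (delta_C_lin _ (@dense_affine_scale _ _ n D)).
  by apply: IH => //; exact: delta_C_le hg.
by apply: IH => //; exact: delta_C_le hf.
Qed.

Lemma delta_C_cst (R : realType) (T : set R) n c : dense_scale T ->
  delta_C T n (fun=> c).
Proof.
move=> D; elim: n c => [|n IH] c.
  by split => //; apply/within_continuousP => t _ e e0; exists 1 => // s _ _; rewrite subrr normr0 ltW.
apply/(dense_delta_CS _ _ D); split.
  by move=> t Tt; exists 0; exact: is_delta_derive_cst.
apply: (delta_C_eq (@dense_affine_scale _ _ n D) _ (IH 0)) => t Tt.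
by rewrite (dense_deltaE D Tt (is_delta_derive_cst T t c)).
Qed.

Lemma delta_C_sum (R : realType) (I : Type) (r : seq I) (T : set R) n (f : I -> R -> R) :
  dense_scale T -> (forall i, delta_C T n (f i)) ->
  delta_C T n (fun s => \sum_(i <- r) f i s).
Proof.
move=> D h; elim: r => [|i r IH].
  by under eq_fun do rewrite big_nil; exact: delta_C_cst.
under eq_fun do rewrite big_cons.
have := delta_C_lin 1 (@dense_affine_scale _ _ n D) (h i) IH.
by under eq_fun do rewrite mul1r.
Qed.

Lemma cont_at_along_curve (R : realType) (r : nat) (K : set R) (g : R -> 'rV[R]_r.+1 -> R)
    (x : 'I_r.+1 -> R -> R) t :
  cont_prod_at K g t (\row_i x i t) -> (forall i, cont_at K (x i) t) ->
  cont_at K (fun s => g s (\row_i x i s)) t.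
Proof.
move=> cg cx e e0; have [d d0 Hd] := cg e e0.
have d20 : 0 < d / 2 by lra.
have [||d' d'0 Hd'] := @common_dist R 'I_r.+1 (fun i d' => forall s, K s -> `|s - t| < d' ->
    `|x i s - x i t| < d).
- move=> i; have [d1 d10 H1] := cx i _ d20; exists d1 => // s Ks /(H1 s Ks); lra.
- by move=> i d1 d2 d21 H s Ks sd; apply: H => //; exact: lt_le_trans d21.
exists (Num.min d d'); first by rewrite lt_min d0.
move=> s Ks; rewrite lt_min => /andP[sd sd']; apply: Hd => // i; rewrite !mxE; exact: Hd'.
Qed.

(** The chain rule expresses the derivative by functions of the same kind, for
    partial derivatives of [f], multiplied by derivatives of the curve. *)
Lemma delta_C_lagrangian (R : realType) (r : nat) (T : set R) n
    (f : R -> 'rV[R]_r.+1 -> R) (x : 'I_r.+1 -> R -> R) : dense_scale T ->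
  lagrangian_C n T f -> (forall i, delta_C T n (x i)) ->
  delta_C T n (fun t => f t (\row_i x i t)).
Proof.
move=> D; elim: n f => [|n IH] f lf hx.
  split => //; apply/within_continuousP => t Tt.
  apply: cont_at_along_curve; first exact: lagrangian_cont lf _ _ Tt.
  by move=> i; have [_ /within_continuousP cx] := hx i; exact: cx.
have [_ [uf [dt lt]]] := lf.
rewrite D.1 in dt lt.
have dF t : T t -> is_delta_derive T (fun t => f t (\row_i x i t)) t
    (partial_t T f t (\row_i x i t) +
      \sum_i partial_u i f t (\row_i x i t) * delta T (x i) t).
  move=> Tt; apply: chain_fixed => //; first exact: (D.2 t Tt).1.
  - move=> e e0; have [d d0 H] := lagrangian_strict_diff (\row_i x i t) lf Tt e0.
    exists d => // s u v Ts sd ud vd; apply: H => // i; rewrite mxE; [exact: ud|exact: vd].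
  - by apply: deltaP; exact: dt.
  - by move=> i; apply: deltaP; have [/(_ t Tt)] := (dense_delta_CS n (x i) D).1 (hx i).
apply/(dense_delta_CS _ _ D); split; first by move=> t Tt; eexists; exact: dF.
have hx' i : delta_C T n (x i) by exact: delta_C_le (hx i).
apply: (@delta_C_eq _ T _ _ (fun t => partial_t T f t (\row_i x i t) +
   1 * \sum_i partial_u i f t (\row_i x i t) * delta T (x i) t)
  _ (@dense_affine_scale _ _ n D)).
  by move=> t Tt; rewrite mul1r (dense_deltaE D Tt (dF t Tt)).
apply: (delta_C_lin _ (@dense_affine_scale _ _ n D)); first exact: IH.
apply: delta_C_sum => // i; apply: delta_C_mul => //.
  by apply: IH => //; exact: (uf i).2.
by have [] := (dense_delta_CS n (x i) D).1 (hx i).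
Qed.

(** Repeated integration by parts, stated as an antiderivative of the difference of
    the two integrands that vanishes at both ends. *)
Lemma dense_parts (R : realType) (T : set R) (a b : R) i F g : dense_scale T ->
  deltan_derivable T i F -> deltan_derivable T i g ->
  (forall j, (j < i)%N -> deltan T j g a = 0 /\ deltan T j g b = 0) ->
  exists H : R -> R, [/\ forall t, T t -> is_delta_derive T H t
      (F t * deltan T i g t - (-1) ^+ i * deltan T i F t * g t), H a = 0 & H b = 0].
Proof.
move=> D; elim: i F => [|i IH] F dF dg g0.
  exists (fun=> 0); split => // t Tt /=; rewrite mul1r subrr; exact: is_delta_derive_cst.
have [dF1 dF2] := (deltan_derivableS T i F).1 dF; rewrite D.1 in dF1 dF2.
have [||H [dH Ha Hb]] := IH _ dF2.
- by move=> m mi; apply: dg; exact: ltnW.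
- by move=> j ji; apply: g0; exact: ltnW.
exists (fun t => F t * deltan T i g t + (-1) * H t); split; last first.
- by rewrite Hb (g0 i (ltnSn i)).2 !mulr0 addr0.
- by rewrite Ha (g0 i (ltnSn i)).1 !mulr0 addr0.
move=> t Tt; have kt : kappan T i.+1 t by rewrite (dense_kappan _ D).
have dgi : is_delta_derive T (deltan T i g) t (deltan T i.+1 g t).
  by have := deltan_is_delta_derive dg (ltnSn i) kt; rewrite (dense_kappan _ D).
have := is_delta_derive_lin (-1)
  (is_delta_derive_mul Tt (D.2 t Tt).1 (deltaP (dF1 t Tt)) dgi) (dH t Tt).
congr is_delta_derive; rewrite -(deltanSr T i F) D.1 exprS; ring.
Qed.

(** * Spline bump functions *)

(** The positive part of an affine function, raised to the power [n]; of class
    C^(n - 1), and a factor of the test functions. *)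
Definition pos_part_pow (R : realType) (u v : R) (n : nat) (t : R) : R :=
  Num.max (u * t + v) 0 ^+ n.

(** The square is treated by hand, as a quadratic estimate across the kink; higher
    powers are products with the affine function itself. *)
Lemma is_delta_derive_pos_part_pow (R : realType) (K : set R) (u v : R) n (t : R) : K t ->
  sigma K t = t ->
  is_delta_derive K (pos_part_pow u v n.+2) t (n.+2%:R * u * pos_part_pow u v n.+1 t).
Proof.
move=> Kt st; elim: n => [|n IH].
  apply/is_delta_deriveP => e e0; rewrite st.
  have k0 : 0 < u ^+ 2 + 1 by have := sqr_ge0 u; lra.
  exists (e / (u ^+ 2 + 1)); first by rewrite divr_gt0.
  move=> s Ks; rewrite ltr_pdivlMr// => sd.
  have h : `|pos_part_pow u v 2 t - pos_part_pow u v 2 s - 2%:R * u * pos_part_pow u v 1 t * (t - s)| <=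
      ((u * t + v) - (u * s + v)) ^+ 2.
    rewrite /pos_part_pow expr1 ler_norml.
    have -> : 2%:R * u * Num.max (u * t + v) 0 * (t - s) =
      2%:R * Num.max (u * t + v) 0 * ((u * t + v) - (u * s + v)) by ring.
    move: (u * t + v) (u * s + v) => x y.
    have sx := sqr_ge0 x; have sy := sqr_ge0 y; have := sqr_ge0 (x - y).
    have -> : (x - y) ^+ 2 = x ^+ 2 - 2 * (x * y) + y ^+ 2 by ring.
    have E : 2 * x * (x - y) = 2 * x ^+ 2 - 2 * (x * y) by ring.
    case: (leP x 0) => hx; case: (leP y 0) => hy; rewrite ?E ?mulr0 ?mul0r ?expr0n /=; first lra.
    - have := mulr_le0_ge0 hx (ltW hy); lra.
    - have := mulr_ge0_le0 (ltW hx) hy; lra.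
    - lra.
  apply: (le_trans h).
  have -> : ((u * t + v) - (u * s + v)) ^+ 2 = (`|s - t| * u ^+ 2) * `|t - s|.
    by rewrite -mulrA mulrCA mulrC [`|s - t|]distrC -expr2 real_normK ?num_real//; ring.
  rewrite ler_wpM2r//; apply: ltW; apply: le_lt_trans sd.
  by rewrite ler_wpM2l// lerDl.
have dX : is_delta_derive K (fun s => u * s + 1 * v) t (u * 1 + 1 * 0).
  apply: is_delta_derive_lin; last exact: is_delta_derive_cst.
  exact/is_delta_derive_mulr/is_delta_derive_id.
have E m s : pos_part_pow u v m.+2 s = (u * s + 1 * v) * pos_part_pow u v m.+1 s.
  rewrite /pos_part_pow mul1r exprS; case: (leP (u * s + v) 0) => //.
  by rewrite expr0n /= !mulr0.
have := is_delta_derive_mul Kt st dX IH.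
have -> : (u * 1 + 1 * 0) * pos_part_pow u v n.+2 t + (u * t + 1 * v) * (n.+2%:R * u * pos_part_pow u v n.+1 t)
   = n.+3%:R * u * pos_part_pow u v n.+2 t.
  have -> : (u * t + 1 * v) * (n.+2%:R * u * pos_part_pow u v n.+1 t) =
     n.+2%:R * u * ((u * t + 1 * v) * pos_part_pow u v n.+1 t) by ring.
  by rewrite -E [n.+3%:R]mulrS; ring.
by congr is_delta_derive; apply/funext => s; rewrite [RHS]E.
Qed.

Lemma delta_C_pos_part_pow (R : realType) (T : set R) (u v : R) n : dense_scale T ->
  delta_C T n (pos_part_pow u v n.+1).
Proof.
move=> D; elim: n => [|n IH].
  split => //; apply/within_continuousP => t Tt e e0.
  have k0 : 0 < `|u| + 1 by have := normr_ge0 u; lra.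
  exists (e / (`|u| + 1)); first by rewrite divr_gt0.
  move=> s Ts; rewrite ltr_pdivlMr// => sd.
  have h : `|pos_part_pow u v 1 s - pos_part_pow u v 1 t| <= `|(u * s + v) - (u * t + v)|.
    rewrite /pos_part_pow !expr1; move: (u * t + v) (u * s + v) => x y.
    case: (leP x 0) => hx; case: (leP y 0) => hy.
    - by rewrite subrr normr0.
    - by rewrite subr0 !gtr0_norm; lra.
    - by rewrite sub0r normrN (ltr0_norm (_ : y - x < 0)) ?gtr0_norm; lra.
    - by [].
  apply: (le_trans h); have -> : (u * s + v) - (u * t + v) = u * (s - t) by ring.
  rewrite normrM mulrC; apply: ltW; apply: le_lt_trans sd.
  by rewrite ler_wpM2l// lerDl.
have dE t : T t -> is_delta_derive T (pos_part_pow u v n.+2) t (n.+2%:R * u * pos_part_pow u v n.+1 t).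
  by move=> Tt; apply: is_delta_derive_pos_part_pow => //; exact: (D.2 t Tt).1.
apply/(dense_delta_CS _ _ D); split; first by move=> t Tt; eexists; exact: dE.
apply: (@delta_C_eq _ T _ _ (fun t => (fun=> n.+2%:R * u) t * pos_part_pow u v n.+1 t) _ (@dense_affine_scale _ _ n D)).
  by move=> t Tt; rewrite (dense_deltaE D Tt (dE t Tt)).
by apply: delta_C_mul => //; exact: delta_C_cst.
Qed.

Definition spline_bump (R : realType) (c d : R) (n : nat) (t : R) : R :=
  pos_part_pow 1 (- c) n t * pos_part_pow (-1) d n t.

Lemma spline_bump_out (R : realType) (c d : R) n t : ~~ (c < t < d) -> spline_bump c d n.+1 t = 0.
Proof.
rewrite negb_and -!leNgt /spline_bump /pos_part_pow => /orP[tc|dt].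
  by rewrite (max_r (_ : 1 * t + - c <= 0)) ?expr0n ?mul0r//; lra.
by rewrite (max_r (_ : -1 * t + d <= 0)) ?expr0n ?mulr0//; lra.
Qed.

Lemma spline_bump_ge0 (R : realType) (c d : R) n t : 0 <= spline_bump c d n t.
Proof. by rewrite mulr_ge0// exprn_ge0// le_max lexx orbT. Qed.

Lemma spline_bump_gt0 (R : realType) (c d : R) n t : c < t < d -> 0 < spline_bump c d n t.
Proof.
by move=> /andP[ct td]; rewrite mulr_gt0// exprn_gt0// lt_max; apply/orP; left; lra.
Qed.

(** * First variation *)

(** The arguments of the Lagrangian are derivatives of [z \o sigma^k]; this asks that
    these exist. It holds on dense and on scattered time scales, for different
    reasons. *)
Definition shift_stable (R : realType) (T : set R) (r : nat) : Prop :=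
  forall z k, delta_C T (2 * r) z -> deltan_derivable T (2 * r) (z \o iter k (sigma T)).

Lemma jet_coord_cont (R : realType) (T : set R) (r : nat) z (i : 'I_r.+1) : (0 < r)%N ->
  shift_stable T r -> delta_C T (2 * r) z ->
  {within kappan T r, continuous (sigma_delta T (r - i) i z)}.
Proof.
move=> r0 hc hz; apply: (@continuous_subspaceW _ _ _ (kappan T i)).
  by apply: kappan_sub; rewrite -ltnS.
apply: (deltan_derivable_cont (hc z (r - i)%N hz)); have := ltn_ord i; lia.
Qed.

Lemma jet_coord_lin (R : realType) (T : set R) A (r : nat) z z' (c : R) (i : 'I_r.+1) t :
  affine_scale T A (2 * r) ->
  shift_stable T r -> delta_C T (2 * r) z -> delta_C T (2 * r) z' -> kappan T r t ->
  sigma_delta T (r - i) i (fun s => z s + c * z' s) t =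
  sigma_delta T (r - i) i z t + c * sigma_delta T (r - i) i z' t.
Proof.
move=> hA hc hz hz' kt; rewrite /sigma_delta.
have i2r : (i <= 2 * r)%N by have := ltn_ord i; lia.
apply: (deltan_lin c hA (hc z _ hz) (hc z' _ hz')) => //.
by apply: kappan_sub kt; rewrite -ltnS.
Qed.

Lemma jet_lin (R : realType) (T : set R) A (r : nat) z z' (c : R) t :
  affine_scale T A (2 * r) ->
  shift_stable T r -> delta_C T (2 * r) z -> delta_C T (2 * r) z' -> kappan T r t ->
  jet T r (fun s => z s + c * z' s) t = jet T r z t + c *: jet T r z' t.
Proof.
move=> hA hc hz hz' kt; apply/rowP => i; rewrite !mxE.
exact: (jet_coord_lin c i hA hc).
Qed.

Lemma jet_cont_at (R : realType) (T : set R) (r : nat) z (g : R -> 'rV[R]_r.+1 -> R) n t :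
  (0 < r)%N -> shift_stable T r -> delta_C T (2 * r) z ->
  lagrangian_C n (kappan T r) g -> kappan T r t ->
  cont_at (kappan T r) (fun s => g s (jet T r z s)) t.
Proof.
move=> r0 hc hz lg kt; apply: cont_at_along_curve; first exact: lagrangian_cont lg _ _ kt.
by move=> i; have /within_continuousP := @jet_coord_cont _ _ _ _ i r0 hc hz; exact.
Qed.

Lemma within_bounded (R : realType) (K : set R) (g : R -> R) : compact K ->
  {within K, continuous g} -> exists2 M : R, 0 <= M & forall t, K t -> `|g t| <= M.
Proof.
move=> cK cg; have [M [_ HM]] := compact_bounded (continuous_compact cg cK).
exists (`|M| + 1); first by rewrite addr_ge0.
move=> t Kt; apply: HM; last by exists t.
by have := ler_norm M; lra.
Qed.

(** The jets of [h] are continuous on a compact set, so the norm of [e h] is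
    of order [e] and small variations are admissible. *)
Lemma norm_r_scale (R : realType) (T : set R) A (r : nat) (h : R -> R) : (0 < r)%N ->
  affine_scale T A (2 * r) -> compact (kappan T r) -> kappan T r !=set0 ->
  shift_stable T r -> delta_C T (2 * r) h ->
  exists2 M : R, 0 <= M & forall e : R, norm_r T r (fun s => e * h s) <= `|e| * M.
Proof.
move=> r0 hA cK [t0 kt0] hc hh.
have : forall j : 'I_r.+1, exists M : R, 0 <= M /\
    forall t, kappan T r t -> `|sigma_delta T j (r - j) h t| <= M.
  move=> j; have := @jet_coord_cont _ _ _ _ (rev_ord j) r0 hc hh.
  rewrite /= subSS subKn -1?ltnS// => cj.
  by have [M M0 HM] := within_bounded cK cj; exists M.
move=> /choice[M HM]; exists (\sum_j M j).
  by apply: sumr_ge0 => j _; exact: (HM j).1.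
move=> e; rewrite /norm_r mulr_sumr; apply: ler_sum => j _.
apply: ge_sup; first by exists (`|sigma_delta T j (r - j) (fun s => e * h s) t0|), t0.
move=> _ [t kt <-].
have -> : (fun s => e * h s) = (fun s => h s + (e - 1) * h s) by apply/funext => s; ring.
have := jet_coord_lin (e - 1) (rev_ord j) hA hc hh hh kt.
rewrite /= subSS subKn -1?ltnS// => ->.
have -> : forall x : R, x + (e - 1) * x = e * x by move=> x; ring.
by rewrite normrM ler_wpM2l//; exact: (HM j).2.
Qed.

(** A local estimate near each [t0], from strict differentiability at [t0] and
    continuity of the jets, made uniform by compactness. *)
Lemma variation_uniform (R : realType) (T : set R) (r : nat) n (L : R -> 'rV[R]_r.+1 -> R)
    y h : (0 < r)%N -> compact (kappan T r) -> shift_stable T r ->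
  delta_C T (2 * r) y -> delta_C T (2 * r) h -> lagrangian_C n.+1 (kappan T r) L ->
  forall k : R, 0 < k -> exists2 d : R, 0 < d & forall e t : R, `|e| < d -> kappan T r t ->
    `|L t (jet T r y t + e *: jet T r h t) - L t (jet T r y t)
      - e * \sum_i partial_u i L t (jet T r y t) * jet T r h t 0 i| <= k * `|e|.
Proof.
move=> r0 cK hc hy hh lL k k0.
pose P e t := `|L t (jet T r y t + e *: jet T r h t) - L t (jet T r y t)
      - e * \sum_i partial_u i L t (jet T r y t) * jet T r h t 0 i| <= k * `|e|.
have local t0 : kappan T r t0 ->
    \forall t' \near t0 & e \near (0 : R), kappan T r t' -> P e t'.
  move=> kt0.
  have cy (i : 'I_r.+1) : cont_at (kappan T r) (sigma_delta T (r - i) i y) t0.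
    by have /within_continuousP := @jet_coord_cont _ _ _ _ i r0 hc hy; exact.
  have ch (i : 'I_r.+1) : cont_at (kappan T r) (sigma_delta T (r - i) i h) t0.
    by have /within_continuousP := @jet_coord_cont _ _ _ _ i r0 hc hh; exact.
  have cp (i : 'I_r.+1) : cont_at (kappan T r) (fun s => partial_u i L s (jet T r y s)) t0.
    by apply: (jet_cont_at r0 hc hy _ kt0); exact: (lL.2.1 i).2.
  pose S := \sum_(i < r.+1) (`|jet T r h t0 0 i| + 1).
  have S0 : 0 <= S by apply: sumr_ge0 => i _; rewrite addr_ge0.
  have q0 : 0 < k / (2 * (S + 1)) by rewrite divr_gt0//; lra.
  set q := k / (2 * (S + 1)) in q0.
  have [d1 d10 H1] := lagrangian_strict_diff (jet T r y t0) lL kt0 q0.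
  have [||d2 d20 H2] := @common_dist R 'I_r.+1 (fun i d => forall s, kappan T r s -> `|s - t0| < d ->
      [/\ `|jet T r y s 0 i - jet T r y t0 0 i| < d1 / 2,
         `|jet T r h s 0 i| <= `|jet T r h t0 0 i| + 1 &
         `|partial_u i L s (jet T r y s) - partial_u i L t0 (jet T r y t0)| <= q]).
  - move=> i; have d14 : 0 < d1 / 4 by lra.
    have [e1 e10 E1] := cy i _ d14; have [e2 e20 E2] := ch i _ ltr01.
    have [e3 e30 E3] := cp i _ q0.
    exists (Num.min e1 (Num.min e2 e3)); first by rewrite !lt_min e10 e20.
    move=> s ks; rewrite !lt_min => /and3P[/(E1 s ks) f1 /(E2 s ks) f2 /(E3 s ks) f3].
    rewrite !mxE; split => //; first lra.
    set u := sigma_delta _ _ _ _ s in f2 *; set v := sigma_delta _ _ _ _ t0 in f2 *.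
    by rewrite -[u](subrK v) addrC; apply: (le_trans (ler_normD _ _)); rewrite lerD2l.
  - by move=> i d d' d'd H s ks sd; apply: H => //; exact: lt_le_trans d'd.
  pose d3 := Num.min 1 (d1 / (2 * (S + 1))).
  have d30 : 0 < d3 by rewrite lt_min ltr01 divr_gt0//; lra.
  exists (ball t0 (Num.min d1 d2), ball (0 : R) d3) => /=.
    split; first by apply: nbhsx_ballx; rewrite lt_min d10.
    exact: nbhsx_ballx.
  move=> [t e] /= [tb eb] kt; move: tb eb.
  rewrite /ball /= distrC lt_min sub0r normrN => /andP[td1 td2] ed; rewrite /P.
  have {}H2 i := H2 i t kt td2.
  set x := jet T r y t; set xi := jet T r h t.
  have ed1 : `|e| < d1 / (2 * (S + 1)) by move: ed; rewrite /d3 lt_min => /andP[].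
  have xiS i : `|xi 0 i| <= S.
    have [_ h2 _] := H2 i; apply: (le_trans h2).
    by rewrite /S (bigD1 i)//= lerDl sumr_ge0// => j _; rewrite addr_ge0.
  have exi i : `|e * xi 0 i| < d1 / 2.
    rewrite normrM; apply: (@le_lt_trans _ _ (`|e| * (S + 1))).
      by rewrite ler_wpM2l//; apply: (le_trans (xiS i)); lra.
    have -> : d1 / 2 = d1 / (2 * (S + 1)) * (S + 1) by field; lra.
    by rewrite ltr_pM2r//; lra.
  have h1 : `|L t (x + e *: xi) - L t x - \sum_i partial_u i L t0 (jet T r y t0) *
      ((x + e *: xi) 0 i - x 0 i)| <= q * \sum_i `|(x + e *: xi) 0 i - x 0 i|.
    apply: H1 => // i; have [h3 _ _] := H2 i; last by lra.
    have -> : (x + e *: xi) 0 i = x 0 i + e * xi 0 i by rewrite !mxE.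
    rewrite addrAC; apply: (le_lt_trans (ler_normD _ _)).
    by have := exi i; rewrite -/x in h3; lra.
  have diffE i : (x + e *: xi) 0 i - x 0 i = e * xi 0 i.
    have -> : (x + e *: xi) 0 i = x 0 i + e * xi 0 i by rewrite !mxE.
    by rewrite addrAC subrr add0r.
  have sumxi : \sum_i `|xi 0 i| <= S by apply: ler_sum => i _; have [] := H2 i.
  have h2 : \sum_i `|(x + e *: xi) 0 i - x 0 i| <= `|e| * S.
    under eq_bigr do rewrite diffE normrM.
    by rewrite -mulr_sumr ler_wpM2l.
  have h3 : `|\sum_i (partial_u i L t0 (jet T r y t0) - partial_u i L t x) * (e * xi 0 i)|
      <= q * (`|e| * S).
    apply: (le_trans (ler_norm_sum _ _ _)).
    apply: (@le_trans _ _ (\sum_i q * (`|e| * `|xi 0 i|))).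
      apply: ler_sum => i _; rewrite !normrM distrC; apply: ler_wpM2r.
        by rewrite mulr_ge0.
      by have [] := H2 i.
    by rewrite -!mulr_sumr !ler_wpM2l// ltW.
  have -> : L t (x + e *: xi) - L t x - e * \sum_i partial_u i L t x * xi 0 i =
    (L t (x + e *: xi) - L t x - \sum_i partial_u i L t0 (jet T r y t0) *
      ((x + e *: xi) 0 i - x 0 i)) +
    \sum_i (partial_u i L t0 (jet T r y t0) - partial_u i L t x) * (e * xi 0 i).
    have -> : e * \sum_i partial_u i L t x * xi 0 i =
        \sum_i partial_u i L t0 (jet T r y t0) * ((x + e *: xi) 0 i - x 0 i) -
        \sum_i (partial_u i L t0 (jet T r y t0) - partial_u i L t x) * (e * xi 0 i).
      by rewrite mulr_sumr -sumrB; apply: eq_bigr => i _; rewrite diffE; ring.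
    by rewrite opprB addrA addrAC.
  apply: (le_trans (ler_normD _ _)).
  apply: (@le_trans _ _ (q * (`|e| * S) + q * (`|e| * S))).
    by apply: lerD => //; apply: (le_trans h1); rewrite ler_wpM2l// ltW.
  have -> : k * `|e| = q * (`|e| * (S + 1)) + q * (`|e| * (S + 1)).
    by rewrite /q; field; lra.
  by apply: lerD; rewrite !ler_wpM2l ?(ltW q0)//; lra.
have /compact_near_coveringP/near_covering_withinP NC := cK.
have := NC R (nbhs (0 : R)) P (nbhs_filter _) local.
rewrite /prop_near1 -nbhs_ballE => -[d /= d0 H]; exists d => // e t ed kt.
by apply: H => //; rewrite /ball /= sub0r normrN.
Qed.

(** Comparing the functional at [y + e h] and [y] for [e] of both signs gives
    [|B D - B a| <= k (D - a)] for every [k > 0]. *)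
Lemma first_variation (R : realType) (T : set R) (a b : R) A (r : nat)
    (L : R -> 'rV[R]_r.+1 -> R) (ya yb : 'I_r -> R) y h B :
  (0 < r)%N -> closed T -> T a -> lbound T a -> T b -> ubound T b ->
  affine_scale T A (2 * r) -> shift_stable T r ->
  lagrangian_C r.+1 (kappan T r) L -> weak_local_min T a b L ya yb y ->
  delta_C T (2 * r) h ->
  (forall i : 'I_r, deltan T i h a = 0 /\ deltan T i h (iter r.-1 (rho T) b) = 0) ->
  delta_antiderivative (kappan T r.-1)
    (fun t => \sum_i partial_u i L t (jet T r y t) * jet T r h t 0 i) B ->
  B (iter r.-1 (rho T) b) = B a.
Proof.
move=> r0 cT Ta la Tb ub hA hc lL [hy bcy [d d0 hmin]] hh bch aB.
set D := iter r.-1 (rho T) b in bch *.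
have [cK KD KE] := kappan_rho r.-1 cT Ta la Tb ub.
rewrite -/D in KD KE; set K := kappan T r.-1 in aB cK KD KE.
have [ckK _ kE] := kappan_rho r cT Ta la Tb ub.
have kK : kappa K = kappan T r by rewrite -[in RHS](prednK r0).
have Da : a <= D by apply: la; move: KD; rewrite KE => -[].
have Ka : K a by rewrite KE.
have lK : lbound K a by move=> t; rewrite KE => -[/la].
have uK : ubound K D by move=> t; rewrite KE => -[].
have ka : kappan T r a.
  have [_ + _] := kappan_rho r cT Ta la Tb ub.
  by rewrite kE => -[TB _]; split => //; exact: la.
have cpK : compact (kappan T r).
  apply: (subclosed_compact ckK (@segment_compact _ a b)) => t /=; rewrite kE => -[Tt _].
  by rewrite in_itv /= la// ub.
have anti z : delta_C T (2 * r) z ->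
    exists F, delta_antiderivative K (fun t => L t (jet T r z t)) F.
  move=> hz; apply: (exists_delta_antiderivative cK Ka lK KD uK).
  by rewrite kK; apply/within_continuousP => t kt; exact: (jet_cont_at r0 hc hz lL kt).
have funE z F : delta_antiderivative K (fun t => L t (jet T r z t)) F ->
    functional T a b L z = F D - F a.
  by move=> aF; apply: delta_intE.
have [M M0 HM] := norm_r_scale r0 hA cpK (ex_intro _ a ka) hc hh.
have hye e : delta_C T (2 * r) (fun s => y s + e * h s) by exact: (delta_C_lin e hA).
have bce e : boundary_conditions T a b ya yb (fun s => y s + e * h s).
  move=> i; have i2 : (i <= 2 * r)%N by have := ltn_ord i; lia.
  have kDi : kappan T i D by apply: kappan_sub KD; have := ltn_ord i; lia.
  have kai : kappan T i a by apply: kappan_sub ka; apply: ltnW.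
  have [h1 h2] := bcy i; have [h3 h4] := bch i.
  rewrite !(deltan_lin e hA hy.1 hh.1 i2)//.
  by rewrite -/D in h2 *; rewrite h3 h4 !mulr0 !addr0.
have MD : 0 < d / (M + 1) by rewrite divr_gt0//; lra.
have minE e : `|e| < d / (M + 1) ->
    functional T a b L y <= functional T a b L (fun s => y s + e * h s).
  move=> ed; apply: hmin => //.
  have -> : (fun s => y s + e * h s) \- y = (fun s => e * h s).
    by apply/funext => s /=; ring.
  apply: (le_lt_trans (HM e)); apply: (@le_lt_trans _ _ (`|e| * (M + 1))).
    by rewrite ler_wpM2l//; lra.
  by rewrite -ltr_pdivlMr//; lra.
suff H k : 0 < k -> `|B D - B a| <= k * (D - a).
  apply/eqP; rewrite -subr_eq0 -normr_le0; apply/ler_addgt0Pr => e e0; rewrite add0r.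
  have k0 : 0 < D - a + 1 by lra.
  apply: (le_trans (H _ (divr_gt0 e0 k0))).
  by rewrite -[X in _ <= X](divfK (lt0r_neq0 k0)) ler_pM2l ?divr_gt0//; lra.
move=> k0.
have [d1 d10 H1] := variation_uniform r0 cpK hc hy hh lL k0.
have [F0 aF0] := anti _ hy.
have est e : `|e| < Num.min d1 (d / (M + 1)) ->
    0 <= e * (B D - B a) + k * `|e| * (D - a).
  rewrite lt_min => /andP[ed1 ed].
  have [F aF] := anti _ (hye e).
  have := minE e ed; rewrite (funE _ _ aF0) (funE _ _ aF) => h1.
  pose G s := (F s + (-1) * F0 s) + (- e) * B s.
  have := @delta_mean_value _ K G
    (fun t => (L t (jet T r (fun s => y s + e * h s) t) + (-1) * L t (jet T r y t)) +
     (- e) * \sum_i partial_u i L t (jet T r y t) * jet T r h t 0 i) a D (k * `|e|)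
     cK Ka KD Da.
  move=> /(_ _)/wrap[].
    move=> u ku _; split.
      apply: is_delta_derive_lin; last exact: aB.
      by apply: is_delta_derive_lin; [exact: aF|exact: aF0].
    rewrite kK in ku; rewrite (jet_lin e hA hc hy hh ku) mulN1r mulNr.
    exact: H1.
  by rewrite ler_norml => /andP[_]; rewrite /G; lra.
pose e := Num.min d1 (d / (M + 1)) / 2.
have m0 : 0 < Num.min d1 (d / (M + 1)) by rewrite lt_min d10.
have e0 : 0 < e by rewrite divr_gt0.
have em : e < Num.min d1 (d / (M + 1)) by rewrite /e; lra.
have := est e; have := est (- e); rewrite normrN gtr0_norm// => /(_ em) h1 /(_ em) h2.
rewrite ler_norml -(ler_pM2l e0) -[X in _ && X](ler_pM2l e0).
by apply/andP; split; [have -> : e * - (k * (D - a)) = - (k * e * (D - a)) by ring|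
  have -> : e * (k * (D - a)) = k * e * (D - a) by ring]; lra.
Qed.

(** * Summation by parts along an orbit *)

Lemma affine_inj (R : realType) (a1 a0 : R) : 0 < a1 -> injective (affine a1 a0).
Proof. by move=> a10 x y /addIr/(mulfI (lt0r_neq0 a10)). Qed.

Lemma iter_inj (X : Type) (A : X -> X) n : injective A -> injective (iter n A).
Proof. by move=> iA; elim: n => [//|n IH] x y /= /iA/IH. Qed.

Lemma affine_step (R : realType) (a1 a0 t : R) l :
  iter l.+1 (affine a1 a0) t - iter l (affine a1 a0) t = a1 ^+ l * (affine a1 a0 t - t).
Proof.
elim: l => [|l IH]; first by rewrite expr0 mul1r.
by rewrite exprS -mulrA -IH /= /affine; ring.
Qed.

Lemma affine_orbit_ge (R : realType) (a1 a0 t : R) l : 0 < a1 -> t <= affine a1 a0 t ->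
  t <= iter l (affine a1 a0) t.
Proof.
move=> a10 tA; elim: l => [//|l IH]; apply: (le_trans IH).
rewrite -subr_ge0 affine_step mulr_ge0 ?subr_ge0//.
by rewrite exprn_ge0// ltW.
Qed.

Lemma affine_orbit_gt (R : realType) (a1 a0 t : R) l : 0 < a1 -> t < affine a1 a0 t ->
  t < iter l.+1 (affine a1 a0) t.
Proof.
move=> a10 tA; apply: (le_lt_trans (affine_orbit_ge l a10 (ltW tA))).
by rewrite -subr_gt0 affine_step mulr_gt0 ?exprn_gt0// subr_gt0.
Qed.

Lemma iter_dquot_eq (R : realType) (A f g : R -> R) i s :
  (forall j, (j <= i)%N -> f (iter j A s) = g (iter j A s)) ->
  iter i (dquot A) f s = iter i (dquot A) g s.
Proof.
elim: i s => [|i IH] s fg /=; first exact: (fg 0%N).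
rewrite /dquot !IH//; first by move=> j ji; apply: fg; exact: ltnW.
by move=> j ji; rewrite -iterSr; exact: fg.
Qed.

Lemma iter_dquot0 (R : realType) (A f : R -> R) i s :
  (forall j, (j <= i)%N -> f (iter j A s) = 0) -> iter i (dquot A) f s = 0.
Proof.
move=> f0; rewrite (@iter_dquot_eq _ _ _ (fun=> 0))//.
by elim: i {f0} s => [//|i IH] s /=; rewrite /dquot !IH subrr mul0r.
Qed.

(** The jump scales the graininess by [a1], hence the factor for each quotient that
    is moved past a shift. *)
Lemma iter_dquot_comp (R : realType) (a1 a0 : R) (f : R -> R) i s : a1 != 0 ->
  iter i (dquot (affine a1 a0)) (f \o affine a1 a0) s =
  a1 ^+ i * iter i (dquot (affine a1 a0)) f (affine a1 a0 s).
Proof.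
move=> a10; elim: i s => [|i IH] s; first by rewrite mul1r.
rewrite !iterS /dquot !IH -mulrBr.
have -> : affine a1 a0 (affine a1 a0 s) - affine a1 a0 s = a1 * (affine a1 a0 s - s).
  by rewrite /affine; ring.
rewrite exprS invfM; move: (_ - s)^-1 (_ - _) (a1 ^+ i) => d x y.
by field.
Qed.

(** The exponents of [1 / a1] accumulate as triangular numbers. *)
Lemma half_triangle i : ((i.+1.-1 * i.+1) %/ 2 = i + (i.-1 * i) %/ 2)%N.
Proof.
case: i => [//|i] /=.
have -> : (i.+1 * i.+2 = i.+1 * 2 + i * i.+1)%N by lia.
by rewrite divnMDl.
Qed.

(** Each summation by parts moves one quotient from [eta] to [F] and shifts the other
    factor. The boundary terms vanish because [eta] is supported at the index [r]. *)
Lemma orbit_sum_parts (R : realType) (a1 a0 t : R) (r : nat) (eta : R -> R) :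
  let A := affine a1 a0 in
  0 < a1 -> A t != t -> (forall j, eta (iter j A t) = (j == r)%:R) ->
  forall i F, (i <= r)%N ->
  \sum_(l < r.+1) (iter l.+1 A t - iter l A t) *
     (F (iter l A t) * iter i (dquot A) (eta \o iter (r - i) A) (iter l A t)) =
  (-1) ^+ i * (1 / a1) ^+ ((i.-1 * i) %/ 2) * (A t - t) * iter i (dquot A) F t.
Proof.
move=> A a10 At etaE; have a1n : a1 != 0 by rewrite gt_eqF.
have step l : iter l.+1 A t - iter l A t != 0.
  by rewrite affine_step mulf_neq0 ?expf_neq0// subr_eq0.
elim=> [|i IH] F ir.
  rewrite big_ord_recl big1 => [|l _].
    by rewrite addr0 /= subn0 etaE eqxx mulr1 !mul1r.
  by rewrite /= subn0 -iterS -iterD etaE -[X in _ == X]addn0 eqn_add2l !mulr0.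
pose g := eta \o iter (r - i.+1) A; pose h := iter i (dquot A) g.
pose x l := iter l A t.
have gA : g \o A = eta \o iter (r - i) A.
  by apply/funext => s; rewrite /g /= -iterSr subnSK.
have hA l : h (x l.+1) = (1 / a1) ^+ i * iter i (dquot A) (eta \o iter (r - i) A) (x l).
  rewrite -gA iter_dquot_comp// mulrA -exprMn mul1r mulVf// expr1n mul1r.
  by [].
have h0 : h (x 0%N) = 0.
  apply: iter_dquot0 => j ji; rewrite /g /= -iterD etaE.
  by case: eqP => // E; exfalso; lia.
have hr : h (x r.+1) = 0.
  apply: iter_dquot0 => j ji; rewrite /g /= -iterS -!iterD etaE.
  by case: eqP => // E; exfalso; lia.
have termE l : (x l.+1 - x l) * (F (x l) * dquot A h (x l)) =
    (F (x l.+1) * h (x l.+1) - F (x l) * h (x l)) -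
    (1 / a1) ^+ i * ((x l.+1 - x l) *
      (dquot A F (x l) * iter i (dquot A) (eta \o iter (r - i) A) (x l))).
  have -> : (1 / a1) ^+ i * ((x l.+1 - x l) *
      (dquot A F (x l) * iter i (dquot A) (eta \o iter (r - i) A) (x l))) =
      ((x l.+1 - x l) * dquot A F (x l)) * h (x l.+1).
    rewrite hA; move: (iter i _ _ _) (dquot _ _ _) => u v; ring.
  have dE (f : R -> R) : (x l.+1 - x l) * dquot A f (x l) = f (x l.+1) - f (x l).
    by rewrite mulrC /dquot divfK//; exact: step.
  by rewrite dE mulrCA dE; ring.
transitivity (\sum_(l < r.+1) ((F (x l.+1) * h (x l.+1) - F (x l) * h (x l)) -
    (1 / a1) ^+ i * ((x l.+1 - x l) *
      (dquot A F (x l) * iter i (dquot A) (eta \o iter (r - i) A) (x l))))).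
  by apply: eq_bigr => l _; exact: termE.
rewrite sumrB -mulr_sumr IH ?(ltnW ir)//.
have -> : \sum_(l < r.+1) (F (x l.+1) * h (x l.+1) - F (x l) * h (x l)) = 0.
  rewrite -(big_mkord xpredT (fun l => F (x l.+1) * h (x l.+1) - F (x l) * h (x l))).
  by rewrite (telescope_sumr (fun l => F (x l) * h (x l)))// hr h0 !mulr0 subrr.
rewrite half_triangle exprD exprS iterSr.
move: (iter i _ _ _) (A t - t) ((1 / a1) ^+ i) => u v w; ring.
Qed.

(** * Regularity on scattered time scales *)

Lemma sigma_near_fixed (R : realType) (K : set R) (a1 a0 : R) n (p e : R) :
  0 < a1 -> affine_scale K (affine a1 a0) n -> (0 < n)%N -> kappa K p ->
  affine a1 a0 p = p -> 0 < e ->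
  exists2 d : R, 0 < d & forall s, K s -> `|s - p| < d ->
    [/\ sigma K s = affine a1 a0 s, K (sigma K s) & `|sigma K s - p| < e].
Proof.
move=> a10 hA n0 kp Ap e0; have [d d0 Hd] := kappa_near kp.
exists (Num.min d (e / a1)); first by rewrite lt_min d0 divr_gt0.
move=> s Ks; rewrite lt_min => /andP[/(Hd s Ks) ks]; rewrite ltr_pdivlMr// => sd.
have [-> KA _ _] := hA 0%N s n0 ks; split => //.
by have [-> _] := fixed_affine s Ap; rewrite normrM gtr0_norm// mulrC.
Qed.

Lemma peano_iter_sigma (R : realType) (K : set R) (a1 a0 : R) n N (p : R) f k :
  0 < a1 -> affine_scale K (affine a1 a0) n -> (0 < n)%N -> kappa K p ->
  affine a1 a0 p = p -> peano K p N f -> peano K p N (f \o iter k (sigma K)).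
Proof.
move=> a10 hA n0 kp Ap pf; elim: k => [//|k IH].
have [d d0 Hd] := sigma_near_fixed a10 hA n0 kp Ap ltr01.
have KA s : K s -> `|s - p| < d -> K (affine a1 a0 s).
  by move=> Ks /(Hd s Ks)[<-].
apply: (peano_eq_near d0 _ (peano_comp_affine a10 d0 Ap KA IH)) => s Ks sd /=.
by rewrite -iterS iterSr; have [-> _ _] := Hd s Ks sd.
Qed.

Lemma peano_of_delta_C (R : realType) (K : set R) (a1 a0 : R) n (p : R) f :
  0 < a1 -> a1 != 1 -> affine_scale K (affine a1 a0) n -> (0 < n)%N ->
  (forall m, closed (kappan K m)) -> kappa K p -> affine a1 a0 p = p ->
  deltan_derivable K n f -> peano K p n f.
Proof.
move=> a10 a11 hA n0 cK kp Ap df.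
have kn := fixed_kappan hA n0 kp Ap n.
by have := deltan_derivable_peano a10 a11 hA cK kn Ap df n0; rewrite subn0.
Qed.

(** Near the fixed point sigma is [A], and composition with [A] preserves
    Peano expansions. *)
Lemma shift_stable_scattered (R : realType) (T : set R) (a1 a0 : R) r :
  0 < a1 -> (forall p, affine a1 a0 p = p -> a1 != 1) -> (0 < r)%N ->
  affine_scale T (affine a1 a0) (2 * r) -> (forall m, closed (kappan T m)) ->
  shift_stable T r.
Proof.
move=> a10 fx r0 hA cT z k [dz _].
have r20 : (0 < 2 * r)%N by rewrite muln_gt0.
suff [] : delta_C T (2 * r) (z \o iter k (sigma T)) by [].
apply: (peano_delta_C a10 fx hA r20) => p kp Ap.
 apply: (peano_iter_sigma k a10 hA) => //.
exact: (peano_of_delta_C a10 (fx p Ap) hA).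
Qed.

Lemma peano_jet (R : realType) (T : set R) (a1 a0 : R) r z (i : 'I_r.+1) (p : R) :
  0 < a1 -> a1 != 1 -> (0 < r)%N ->
  affine_scale T (affine a1 a0) (2 * r) -> (forall m, closed (kappan T m)) ->
  delta_C T (2 * r) z -> kappa T p -> affine a1 a0 p = p ->
  peano (kappan T r) p r (sigma_delta T (r - i) i z).
Proof.
move=> a10 a11 r0 hA cT [dz _] kp Ap.
have r20 : (0 < 2 * r)%N by rewrite muln_gt0.
have ir : (i <= r)%N by rewrite -ltnS.
have pz := peano_iter_sigma (r - i) a10 hA r20 kp Ap (peano_of_delta_C a10 a11 hA r20 cT kp Ap dz).
have kpi := fixed_kappan hA r20 kp Ap i.
have := peano_deltan a10 a11 hA Ap pz (_ : i <= 2 * r)%N (_ : i <= 2 * r)%N kpi.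
move=> /(_ _ _)/wrap[]; [lia|lia|] => h.
apply: (peano_sub ltr01 (fun s ks _ => kappan_sub ir ks)).
by apply: peano_le h; lia.
Qed.

Lemma lagrangian_jet_scattered (R : realType) (T : set R) (a1 a0 : R) r z
    (g : R -> 'rV[R]_r.+1 -> R) :
  0 < a1 -> (forall p, affine a1 a0 p = p -> a1 != 1) -> (0 < r)%N ->
  affine_scale T (affine a1 a0) (2 * r) -> (forall m, closed (kappan T m)) ->
  delta_C T (2 * r) z -> lagrangian_C r (kappan T r) g ->
  delta_C (kappan T r) r (fun t => g t (jet T r z t)).
Proof.
move=> a10 fx r0 hA cT hz lg.
have hAr : affine_scale (kappan T r) (affine a1 a0) r.
  by apply: affine_scale_kappan; rewrite addnn -mul2n.
have cTr m : closed (kappan (kappan T r) m) by rewrite kappanD; exact: cT.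
apply: (peano_delta_C a10 fx hAr r0) => p kp Ap.
have kTp : kappa T p by apply: (@kappan_sub _ T 1 r.+1).
case: r r0 hA hz g lg hAr cTr kp => // r r0 hA hz g lg hAr cTr kp.
apply: (@peano_lagrangian _ _ _ _ r.+1 r g (fun i => sigma_delta T (r.+1 - i) i z)) => //.
- by case: kp.
- move=> n f /andP[n0 nr] df.
  by apply: (peano_of_delta_C a10 (fx p Ap) (affine_scale_le nr hAr)).
- by move=> i; apply: (peano_jet i a10 (fx p Ap) r0 hA).
Qed.

(** A jump of the step function at the isolated point [w] is seen only by the
    derivative at [w]. *)
Lemma is_delta_derive_step (R : realType) (K : set R) A n m (w u : R) :
  affine_scale K A n -> (m < n)%N -> kappan K m.+1 w -> A w != w ->
  kappan K m.+1 u ->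
  is_delta_derive (kappan K m) (fun s => (w < s)%R%:R) u ((u == w)%:R / (A w - w)).
Proof.
move=> hA mn kw /eqP Aw ku.
have [sw KAw wA lpw] := hA m w mn kw; have [su KAu uA lpu] := hA m u mn ku.
have Kw : kappan K m w by case: kw.
have Ku : kappan K m u by case: ku.
have [->|uw] := eqVneq u w.
  have := @isolated_is_delta_derive _ (kappan K m) (fun s => (w < s)%R%:R) w.
  rewrite sw ltxx subr0 => h.
  have := h Aw (fun lp => Aw (lpw.2 lp)).
  by rewrite (_ : (w < A w) = true)// lt_neqAle wA andbT eq_sym; exact/eqP.
rewrite mul0r.
have [Au|Au] := pselect (A u = u).
  have d0 : 0 < `|u - w| by rewrite normr_gt0 subr_eq0.
  have near s : `|s - u| < `|u - w| -> (w < s) = (w < u).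
    have [wu|uw'] := ltP w u.
      by rewrite (gtr0_norm (_ : 0 < u - w)) ?subr_gt0// ltr_distl => /andP[? _]; lra.
    rewrite (ler0_norm (_ : u - w <= 0)) ?subr_le0// ltr_distl => /andP[_ ?].
    by apply/negbTE; rewrite -leNgt; lra.
  apply: (@is_delta_derive_near _ _ (fun=> (w < u)%R%:R) _ _ _ _ d0) => //.
  - by rewrite su Au.
  - by move=> s _ /near ->.
  - exact: is_delta_derive_cst.
have := @isolated_is_delta_derive _ (kappan K m) (fun s => (w < s)%R%:R) u.
rewrite su => h; have := h Au (fun lp => Au (lpu.2 lp)).
suff -> : (w < A u) = (w < u) by rewrite subrr mul0r.
have [wu|uw'] := ltP w u; first exact: lt_le_trans uA.
have uw2 : u < w by rewrite lt_neqAle uw.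
by have [_ h2 _] := sigma_adherent Kw uw2; apply/negbTE; rewrite -leNgt -su; exact: h2.
Qed.

(** * Euler-Lagrange equation on scattered time scales *)

Definition euler_lagrange (R : realType) (T : set R) (a1 : R) (r : nat)
    (L : R -> 'rV[R]_r.+1 -> R) (y : R -> R) (t : R) : R :=
  \sum_(i < r.+1) (-1) ^+ i * (1 / a1) ^+ ((i.-1 * i) %/ 2) *
    deltan (kappan T r) i (fun s => partial_u i L s (jet T r y s)) t.

Lemma iter_sigma (R : realType) (T : set R) A n m t : affine_scale T A n ->
  (m <= n)%N -> kappan T m t ->
  iter m (sigma T) t = iter m A t.
Proof.
move=> hA mn; suff H k : (k <= m)%N -> kappan T m t ->
    iter k (sigma T) t = iter k A t /\ kappan T (m - k) (iter k A t).
  by move=> kt; have [] := H m (leqnn m) kt.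
elim: k => [|k IH] km kt; first by rewrite subn0.
have [e1 e2] := IH (ltnW km) kt; rewrite !iterS e1.
have km' : (m - k = (m - k.+1).+1)%N by lia.
rewrite km' in e2.
have mn' : (m - k.+1 < n)%N by lia.
have [_ KA _ _] := hA _ _ mn' e2; split => //.
have n0 : (0 < n)%N by lia.
have k1 : kappa T (iter k A t) by apply: (@kappan_sub _ T 1 (m - k.+1).+1).
by have [] := hA 0%N (iter k A t) n0 k1.
Qed.

Lemma kappan_orbit (R : realType) (T : set R) A n m l t : affine_scale T A n ->
  (m <= n)%N -> (l <= m)%N -> kappan T m t -> kappan T (m - l) (iter l A t).
Proof.
move=> hA mn; elim: l => [|l IH] lm kt; first by rewrite subn0.
have := IH (ltnW lm) kt; have -> : (m - l = (m - l.+1).+1)%N by lia.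
move=> h; have mn' : (m - l.+1 < n)%N by lia.
by have [_ KA _ _] := hA _ _ mn' h.
Qed.

(** The variation is the indicator of [A^r t]. The boundary conditions do not see
    it: they involve points reached from [a] by fewer than [r] jumps, points from
    the upper limit of integration on, and points close to an end that is fixed by
    [A]. The integral of the first variation is a multiple of the equation at [t]. *)
Lemma euler_lagrange_scattered (R : realType) (T : set R) (a b a1 a0 : R) (r : nat)
    (L : R -> 'rV[R]_r.+1 -> R) (ya yb : 'I_r -> R) (y : R -> R) (t : R) :
  let A := affine a1 a0 in
  0 < a1 -> (forall p, A p = p -> a1 != 1) -> (0 < r)%N ->
  closed T -> T a -> lbound T a -> T b -> ubound T b ->
  affine_scale T A (2 * r) ->
  lagrangian_C r.+1 (kappan T r) L -> weak_local_min T a b L ya yb y ->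
  kappan T (2 * r) t -> A t != t -> euler_lagrange T a1 L y t = 0.
Proof.
move=> A a10 fx r0 cT Ta la Tb ub hA lL hmin kt At.
have cTm m : closed (kappan T m) by have [] := kappan_rho m cT Ta la Tb ub.
have iA := affine_inj (a0 := a0) a10.
have r20 : (0 < 2 * r)%N by rewrite muln_gt0.
have rr : (r <= 2 * r)%N by lia.
have hc := shift_stable_scattered a10 fx r0 hA cTm.
have kt1 : kappa T t by apply: (@kappan_sub _ T 1 (2 * r)).
have tA : t < A t.
  by have [_ _ h _] := hA 0%N t r20 kt1; rewrite lt_neqAle eq_sym At h.
pose x l := iter l A t.
have xnf l : A (x l) != x l by rewrite -iterS iterSr (inj_eq (@iter_inj _ _ l iA)).
have kx l : (l <= r)%N -> kappan T r (x l).
  move=> lr; have := kappan_orbit hA (leqnn _) (leq_trans lr rr) kt.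
  by apply: kappan_sub; lia.
have xinj l m : (x l == x m) = (l == m).
  wlog lm : l m / (l <= m)%N => [H|].
    by case/orP: (leq_total l m) => h; [exact: H|rewrite eq_sym H// eq_sym].
  rewrite /x -(subnKC lm) iterD (inj_eq (@iter_inj _ _ l iA)).
  case: (m - l)%N => [|k]; first by rewrite addn0 !eqxx.
  by rewrite lt_eqF ?affine_orbit_gt// -[X in X == _]addn0 eqn_add2l.
pose w := x r.
pose h s : R := (s == w)%:R.
have hx j : h (x j) = (j == r)%:R by rewrite /h xinj.
(* w is isolated, so the indicator of w vanishes near a fixed point: it is smooth there *)
have hfix p : A p = p -> exists2 d : R, 0 < d & forall s, T s -> `|s - p| < d -> h s = 0.
  move=> Ap; have pw : p != w.
    apply: contraNneq At => pw; apply/eqP; apply: (@iter_inj _ _ r iA).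
    by rewrite -iterSr iterS -/(x r) -/w -pw.
  exists `|w - p|; first by rewrite normr_gt0 subr_eq0 eq_sym.
  move=> s _ sd; rewrite /h; case: eqP => // sw.
  by move: sd; rewrite sw ltxx.
have hh : delta_C T (2 * r) h.
  apply: (peano_delta_C a10 fx hA r20) => p kp Ap; have [d d0 Hd] := hfix p Ap.
  by apply: (peano_eq_near d0 _ (peano_cst T p _ 0)) => s Ts sd; rewrite Hd.
set D := iter r.-1 (rho T) b.
have [cK KD KE] := kappan_rho r.-1 cT Ta la Tb ub; rewrite -/D in KD KE.
have rp : (r.-1 < 2 * r)%N by lia.
have kE : kappan T r = kappan T r.-1.+1 by rewrite prednK.
have Dmax s : kappan T r.-1 s -> s <= D by rewrite KE => -[].
(* D is the maximum of kappan T r.-1, so the jump taken in that scale leaves it in place *)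
have DA : kappan T r D -> A D = D.
  rewrite kE => kD; have [<- _ _ _] := hA _ _ rp kD.
  exact: sigma_max.
have dz s i : (i < r)%N -> kappan T i s ->
    (A s <> s -> forall j, (j <= i)%N -> iter j A s != w) -> deltan T i h s = 0.
  move=> ir ki H; have i2 : (i <= 2 * r)%N by lia.
  have [As|As] := pselect (A s = s).
    have [d d0 Hd] := deltan_near0 a10 hA As (hfix s As) i2.
    by apply: Hd => //; rewrite subrr normr0.
  rewrite (deltan_dquot h hA iA i2 ki); last exact/eqP.
  by apply: iter_dquot0 => j ji; rewrite /h (negbTE (H As j ji)).
have bch (i : 'I_r) : deltan T i h a = 0 /\ deltan T i h D = 0.
  have ir := ltn_ord i; split.
    apply: dz => // [|Aa j ji].
      apply: (@kappan_sub _ T i r); first exact: ltnW.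
      have [_ + kEr] := kappan_rho r cT Ta la Tb ub.
      by rewrite kEr => -[TB _]; split => //; exact: la.
    rewrite /w /x -(subnKC (ltnW (leq_ltn_trans ji ir))) iterD (inj_eq (@iter_inj _ _ j iA)).
    have -> : (r - j = (r - j).-1.+1)%N by lia.
    rewrite lt_eqF//; apply: le_lt_trans (affine_orbit_gt _ a10 tA).
    by apply: la; have := @kappan_sub _ T 0 (2 * r) _ t kt; exact.
  have kDi : kappan T i D by apply: kappan_sub KD; lia.
  apply: dz => // AD j ji; apply/eqP => E; apply: AD; apply: DA.
  suff -> : D = w by exact: kx.
  apply/eqP; rewrite eq_le; apply/andP; split; last first.
    by apply: Dmax; apply: kappan_sub (kx r (leqnn r)); lia.
  rewrite -E; case: j ji E => [//|j] ji E; apply: affine_orbit_ge => //.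
  have kD1 : kappan T 1 D by apply: kappan_sub KD; lia.
  by have [] := hA 0%N D r20 kD1.
pose F (i : 'I_r.+1) s := partial_u i L s (jet T r y s).
pose Phi s := \sum_i F i s * jet T r h s 0 i.
have PhiE s : kappan T r s -> A s != s -> Phi s =
    \sum_(i < r.+1) F i s * iter i (dquot A) (h \o iter (r - i) A) s.
  move=> ks As; apply: eq_bigr => i _; congr (_ * _); rewrite mxE /sigma_delta.
  have ir : (i <= r)%N by rewrite -ltnS.
  have i2 : (i <= 2 * r)%N by lia.
  rewrite (deltan_dquot _ hA iA i2 (kappan_sub ir ks) As).
  apply: iter_dquot_eq => j ji /=; congr h.
  apply: (iter_sigma hA); first lia.
  have := kappan_orbit hA rr (leq_trans ji ir) ks; apply: kappan_sub; lia.
have Phi0 s : kappan T r s -> (forall l, (l <= r)%N -> s != x l) -> Phi s = 0.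
  move=> ks sx; have [As|/eqP As] := pselect (A s = s).
    apply: big1 => i _; rewrite mxE /sigma_delta.
    have ks1 : kappa T s by apply: (@kappan_sub _ T 1 r).
    have zk k : exists2 d : R, 0 < d & forall u, T u -> `|u - s| < d ->
        (h \o iter k (sigma T)) u = 0.
      elim: k => [|k [d d0 Hd]]; first exact: hfix.
      have [d1 d10 Hd1] := sigma_near_fixed a10 hA r20 ks1 As d0.
      exists d1 => // u Tu ud /=; rewrite -iterS iterSr.
      by have [_ Ts sd] := Hd1 u Tu ud; exact: Hd.
    have i2 : (i <= 2 * r)%N by have := ltn_ord i; lia.
    have [d d0 Hd] := deltan_near0 a10 hA As (zk (r - i)%N) i2.
    rewrite Hd ?mulr0 ?subrr ?normr0//.
    by apply: kappan_sub ks; rewrite -ltnS.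
  rewrite PhiE//; apply: big1 => i _; rewrite iter_dquot0 ?mulr0// => j ji /=.
  have ir : (i <= r)%N by rewrite -ltnS.
  rewrite /h -iterD; case: eqP => // E; exfalso.
  have jr : (r - i + j <= r)%N by lia.
  have /eqP := sx (r - (r - i + j))%N (leq_subr _ _); apply.
  by apply: (@iter_inj _ _ (r - i + j) iA); rewrite E /w /x -iterD subnKC.
(* Phi is supported on the orbit points x l, each weighted by its graininess *)
pose B s : R := \sum_(l < r.+1) ((x l.+1 - x l) * Phi (x l)) * (x l < s)%R%:R.
have aB : delta_antiderivative (kappan T r.-1) Phi B.
  move=> u ku; rewrite -[kappa _]/(kappan T r.-1.+1) in ku.
  have -> : Phi u = \sum_(l < r.+1) ((x l.+1 - x l) * Phi (x l)) * ((u == x l)%:R / (x l.+1 - x l)).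
    have nz l : x l.+1 - x l != 0 by rewrite subr_eq0 /x iterS xnf.
    have [[l lr ul]|H] := pselect (exists2 l, (l <= r)%N & u = x l).
      rewrite -ltnS in lr; rewrite (bigD1 (Ordinal lr))//= ul eqxx big1 => [|m].
        rewrite addr0 (_ : true%:R = 1 :> R)//.
        by have := nz l; move: (_ - _) => z z0; field.
      rewrite -val_eqE /= => ml.
      by rewrite xinj eq_sym (negbTE ml) mul0r mulr0.
    rewrite Phi0; last 2 first.
    - by rewrite kE.
    - by move=> l lr; apply/eqP => ul; apply: H; exists l.
    rewrite big1// => l _; case: eqP => [ul|]; last by rewrite mul0r mulr0.
    by exfalso; apply: H; exists l => //; rewrite -ltnS.
  apply: is_delta_derive_sum => l; apply: is_delta_derive_mulr.
  apply: (is_delta_derive_step hA rp) => //.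
  by rewrite -kE; apply: kx; rewrite -ltnS.
have := first_variation r0 cT Ta la Tb ub hA hc lL hmin hh bch aB.
have -> : B a = 0.
  rewrite /B big1// => l _; rewrite ltNge (_ : a <= x l) ?mulr0//.
  by apply: la; have := @kappan_sub _ T 0 r _ _ (kx l _); apply => //; rewrite -ltnS.
have -> : B D = (A t - t) * euler_lagrange T a1 L y t.
  have -> : B D = \sum_(l < r.+1) \sum_(i < r.+1) (x l.+1 - x l) *
      (F i (x l) * iter i (dquot A) (h \o iter (r - i) A) (x l)).
    apply: eq_bigr => l _; have lr : (l <= r)%N by rewrite -ltnS.
    have -> : x l < D.
      rewrite lt_neqAle Dmax ?andbT; last by apply: kappan_sub (kx l lr); lia.
      apply/eqP => xD; have := xnf l; rewrite xD DA ?eqxx// -xD; exact: kx.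
    by rewrite mulr1 PhiE ?mulr_sumr//; exact: kx.
  rewrite exchange_big /= /euler_lagrange mulr_sumr; apply: eq_bigr => i _.
  have ir : (i <= r)%N by rewrite -ltnS.
  rewrite (orbit_sum_parts a10 At hx (F i) ir).
  have hAr : affine_scale (kappan T r) A r.
    by apply: affine_scale_kappan; rewrite addnn -mul2n.
  have kti : kappan (kappan T r) i t by rewrite kappanD; apply: kappan_sub kt; lia.
  by rewrite (deltan_dquot _ hAr iA ir kti At) mulrAC mulrC.
move/eqP; rewrite mulf_eq0 subr_eq0 (negbTE At) /=; exact/eqP.
Qed.

Lemma euler_lagrange_cont_at (R : realType) (T : set R) (a1 : R) (r : nat)
    (L : R -> 'rV[R]_r.+1 -> R) (y : R -> R) t :
  (forall i : 'I_r.+1, delta_C (kappan T r) r (fun s => partial_u i L s (jet T r y s))) ->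
  kappan T (2 * r) t -> cont_at (kappan T (2 * r)) (euler_lagrange T a1 L y) t.
Proof.
move=> hF kt.
have main (i : 'I_r.+1) : cont_at (kappan T (2 * r))
    (deltan (kappan T r) i (fun s => partial_u i L s (jet T r y s))) t.
  have ir : (i <= r)%N by rewrite -ltnS.
  have [_ /within_continuousP ci] := delta_C_le ir (hF i).
  have sub : kappan T (2 * r) `<=` kappan (kappan T r) i.
    by rewrite kappanD; apply: kappan_sub; lia.
  move=> e e0; have [d d0 Hd] := ci t (sub _ kt) e e0.
  by exists d => // s /sub; exact: Hd.
rewrite /euler_lagrange; elim: (index_enum _) => [|i s IH].
  by move=> e e0; exists 1 => // u ku ud; rewrite !big_nil subrr normr0 ltW.
move=> e e0; have [d d0 Hd] := cont_at_lin ((-1) ^+ i * (1 / a1) ^+ ((i.-1 * i) %/ 2)) IH (main i) e0.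
by exists d => // u ku ud; rewrite !big_cons ![_ + \sum_(j <- s) _]addrC; exact: Hd.
Qed.

Lemma cont_at_eq0 (R : realType) (K : set R) (f : R -> R) (t d0 : R) : 0 < d0 ->
  cont_at K f t -> limit_point K t ->
  (forall s, K s -> s != t -> `|s - t| < d0 -> f s = 0) -> f t = 0.
Proof.
move=> d00 cf /limit_pointP_dist lp f0; apply/eqP; rewrite -normr_le0.
apply/ler_addgt0Pr => e e0; have [d d_gt0 Hd] := cf e e0.
have [|s [Ks st]] := lp (Num.min d0 d); first by rewrite lt_min d00.
rewrite lt_min => /andP[sd0 sd].
by have := Hd s Ks sd; rewrite f0// sub0r normrN add0r.
Qed.

(** * Euler-Lagrange equation on dense time scales *)

Lemma dense_iter_sigma (R : realType) (T : set R) k t : dense_scale T -> T t ->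
  iter k (sigma T) t = t.
Proof. by move=> D Tt; elim: k => //= k ->; exact: (D.2 t Tt).1. Qed.

Lemma shift_stable_dense (R : realType) (T : set R) r : dense_scale T -> shift_stable T r.
Proof.
move=> D z k [dz _]; apply: (deltan_derivable_eq (@dense_affine_scale _ T _ D) _ dz) => t Tt /=.
by rewrite dense_iter_sigma.
Qed.

Lemma dense_sigma_delta (R : realType) (T : set R) k i z t : dense_scale T -> T t ->
  sigma_delta T k i z t = deltan T i z t.
Proof.
move=> D Tt; apply: (deltan_eq (@dense_affine_scale _ T i D)) => //.
  by move=> s Ts /=; rewrite dense_iter_sigma.
by rewrite dense_kappan.
Qed.

Lemma dense_delta_C_deltan (R : realType) (T : set R) i m g : dense_scale T ->
  delta_C T (i + m) g -> delta_C T m (deltan T i g).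
Proof.
move=> D [dg cg].
have E j : deltan T j (deltan T i g) = deltan T (i + j) g.
  by have := deltanD T i j g; rewrite dense_kappan.
split.
  move=> j jm t; rewrite !(dense_kappan _ D) E => Tt.
  have ij : (i + j < i + m)%N by rewrite ltn_add2l.
  by have := dg _ ij t; rewrite !(dense_kappan _ D); exact.
by move: cg; rewrite E !(dense_kappan _ D).
Qed.

Lemma lagrangian_jet_dense (R : realType) (T : set R) r z
    (g : R -> 'rV[R]_r.+1 -> R) : dense_scale T ->
  delta_C T (2 * r) z -> lagrangian_C r T g ->
  delta_C T r (fun t => g t (jet T r z t)).
Proof.
move=> D hz lg.
apply: (delta_C_lagrangian (x := fun i => sigma_delta T (r - i) i z) D lg) => i.
apply: dense_delta_C_deltan => //; apply: (@delta_C_le _ _ _ (2 * r)).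
  by have := ltn_ord i; lia.
apply: (delta_C_eq (@dense_affine_scale _ T _ D) _ hz) => t Tt /=.
by rewrite dense_iter_sigma.
Qed.

Lemma delta_C_spline_bump (R : realType) (T : set R) (c d : R) n : dense_scale T ->
  delta_C T n (spline_bump c d n.+1).
Proof. by move=> D; apply: delta_C_mul => //; exact: delta_C_pos_part_pow. Qed.

(** If the expression [EL] were nonzero at [t], integrate it against a bump supported
    where it keeps its sign. An antiderivative of [EL t * EL * h] is nondecreasing
    with equal values at both ends, hence constant, but its derivative at [t] is
    positive. *)
Lemma euler_lagrange_dense_interior (R : realType) (T : set R) (a b : R) (r : nat)
    (L : R -> 'rV[R]_r.+1 -> R) (ya yb : 'I_r -> R) (y : R -> R) (t : R) :
  (0 < r)%N -> closed T -> T a -> lbound T a -> T b -> ubound T b -> dense_scale T ->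
  lagrangian_C r.+1 T L -> weak_local_min T a b L ya yb y ->
  T t -> a < t < b -> euler_lagrange T 1 L y t = 0.
Proof.
move=> r0 cT Ta la Tb ub D lL hmin Tt /andP[at_ tb].
have kT m : kappan T m = T by exact: dense_kappan.
have hA n : affine_scale T (affine 1 0) n by exact: dense_affine_scale.
have hy : delta_C T (2 * r) y by case: hmin.
have bE : iter r.-1 (rho T) b = b.
  have [_ KB KE] := kappan_rho r.-1 cT Ta la Tb ub.
  rewrite kT in KB KE; apply/eqP; rewrite eq_le ub//=.
  by move: Tb; rewrite [X in X b -> _]KE => -[].
pose F (i : 'I_r.+1) s := partial_u i L s (jet T r y s).
have dF i : delta_C T r (F i) by apply: lagrangian_jet_dense => //; exact: (lL.2.1 i).2.
pose EL := euler_lagrange T 1 L y.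
have cEL s : T s -> cont_at T EL s.
  move=> Ts; have := @euler_lagrange_cont_at _ T 1 r L y s; rewrite !kT; apply => //.
have ELE s : EL s = \sum_(i < r.+1) (-1) ^+ i * deltan T i (F i) s.
  by apply: eq_bigr => i _; rewrite divr1 expr1n mulr1 kT.
apply: contrapT => /eqP ELt; rewrite -/(EL t) in ELt.
have q0 : 0 < `|EL t| / 2 by rewrite divr_gt0// normr_gt0.
have [d d0 Hd] := cEL t Tt _ q0.
(* half the minimum keeps the support of the bump away from a and b *)
pose q := Num.min d (Num.min (t - a) (b - t)) / 2.
have m0 : 0 < Num.min d (Num.min (t - a) (b - t)) by rewrite !lt_min d0 !subr_gt0 at_.
have q_gt0 : 0 < q by rewrite divr_gt0.
have : q < Num.min d (Num.min (t - a) (b - t)) by rewrite /q; lra.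
rewrite !lt_min => /and3P[qd qa qb].
pose h := spline_bump (t - q) (t + q) (2 * r).+1.
have hh : delta_C T (2 * r) h by exact: delta_C_spline_bump.
have hz s p d' : d' <= `|p - t| - q -> `|s - p| < d' -> h s = 0.
  move=> d'q sp; apply: spline_bump_out; apply/negP => /andP[h1 h2].
  have : `|s - t| < q by rewrite ltr_distl h1 h2.
  have := ler_normB (s - t) (s - p); rewrite (_ : s - t - (s - p) = p - t); last by ring.
  lra.
have bch (i : 'I_r) : deltan T i h a = 0 /\ deltan T i h b = 0.
  have AE p : affine 1 0 p = p :> R by rewrite /affine mul1r addr0.
  have near0 p : 0 < `|p - t| - q -> T p -> deltan T i h p = 0.
    move=> pq Tp.
    have [|e e0 He] := @deltan_near0 _ T 1 0 r h p ltr01 (hA r) (AE p) _ i (ltnW (ltn_ord i)).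
      by exists (`|p - t| - q) => // s _; exact: hz.
    by apply: He; rewrite ?kT// subrr normr0.
  split; apply: near0 => //; last by rewrite gtr0_norm ?subr_gt0.
  by rewrite distrC gtr0_norm ?subr_gt0.
have [E aE] : exists E, delta_antiderivative T (fun s => EL s * h s) E.
  apply: (exists_delta_antiderivative cT Ta la Tb ub).
  have ch : {within T, continuous h} by have [_] := delta_C_le (leq0n _) hh.
  have cE : {within T, continuous EL} by exact/within_continuousP.
  by rewrite D.1 => s; apply: cvgM; [exact: cE|exact: ch].
have /choice[H HP] : forall i : 'I_r.+1, exists H : R -> R, [/\ forall s, T s -> is_delta_derive T H s
      (F i s * deltan T i h s - (-1) ^+ i * deltan T i (F i) s * h s), H a = 0 & H b = 0].
  move=> i; have ir : (i <= r)%N by rewrite -ltnS.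
  apply: dense_parts => //.
  - by have [] := delta_C_le ir (dF i).
  - have i2 : (i <= 2 * r)%N by lia.
    by have [] := delta_C_le i2 hh.
  - by move=> j ji; exact: (bch (Ordinal (leq_trans ji ir))).
pose B s := E s + \sum_i H i s.
have aB : delta_antiderivative (kappan T r.-1)
    (fun s => \sum_i partial_u i L s (jet T r y s) * jet T r h s 0 i) B.
  rewrite kT => s ks; have Ts : T s by case: ks.
  have dH i : is_delta_derive T (H i) s
      (F i s * deltan T i h s - (-1) ^+ i * deltan T i (F i) s * h s).
    by have [dHi _ _] := HP i; exact: dHi.
  have := is_delta_derive_add (aE s ks) (is_delta_derive_sum (index_enum _) dH).
  congr is_delta_derive; rewrite ELE mulr_suml -big_split /=.
  by apply: eq_bigr => i _; rewrite mxE dense_sigma_delta// addrC subrK.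
have := first_variation r0 cT Ta la Tb ub (hA (2 * r)%N) (@shift_stable_dense _ T r D)
  _ hmin hh _ aB.
rewrite kT bE => /(_ lL bch).
rewrite /B !big1 ?addr0 => [Eab| i _|i _]; last 2 first.
- by have [] := HP i.
- by have [] := HP i.
have ELh s : T s -> 0 <= EL t * (EL s * h s).
  move=> Ts; rewrite mulrA; have [sq|sq] := ltP `|s - t| q; last first.
    rewrite /h spline_bump_out ?mulr0//; apply/negP => /andP[h1 h2].
    by move: sq; rewrite leNgt ltr_distl h1 h2.
  rewrite mulr_ge0 ?spline_bump_ge0//.
  have := Hd s Ts (lt_trans sq qd).
  have -> : EL t * EL s = EL t * EL t + EL t * (EL s - EL t) by ring.
  rewrite -subr_ge0 => h1.
  have : `|EL t * (EL s - EL t)| <= `|EL t| * (`|EL t| / 2).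
    by rewrite normrM ler_wpM2l// -subr_ge0.
  rewrite ler_norml => /andP[h2 _]; have h3 : EL t * EL t = `|EL t| * `|EL t|.
    by rewrite -normrM ger0_norm// -expr2 sqr_ge0.
  have h4 : 0 <= `|EL t| * `|EL t| by rewrite mulr_ge0.
  lra.
have mono c e : T c -> T e -> c <= e -> EL t * E c <= EL t * E e.
  move=> Tc Te ce.
  apply: (@delta_nondecreasing _ T (fun s => EL t * E s) (fun s => EL t * (EL s * h s))) => // u ku _.
  by split; [exact/is_delta_derive_mulr/aE|apply: ELh; case: ku].
have cst s : T s -> EL t * E a = EL t * E s.
  move=> Ts; apply/eqP; rewrite eq_le mono//=; last exact: la.
  by rewrite -Eab mono//; exact: ub.
have kt : kappa T t by rewrite D.1.
have d1 : is_delta_derive T (fun s => EL t * E s) t (EL t * (EL t * h t)).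
  exact/is_delta_derive_mulr/aE.
have d2 : is_delta_derive T (fun s => EL t * E s) t 0.
  apply: (is_delta_derive_eq _ cst (is_delta_derive_cst T t (EL t * E a))).
  by rewrite (D.2 t Tt).1.
have rg : regular T t by right; exact: (D.2 t Tt).2.
have := is_delta_derive_unique Tt rg d1 d2.
have : 0 < h t by apply: spline_bump_gt0; lra.
by move=> h0 /eqP; rewrite mulf_eq0 (negbTE ELt) /= mulf_eq0 (negbTE ELt) (gt_eqF h0).
Qed.

Lemma euler_lagrange_dense (R : realType) (T : set R) (a b : R) (r : nat)
    (L : R -> 'rV[R]_r.+1 -> R) (ya yb : 'I_r -> R) (y : R -> R) (t : R) :
  (0 < r)%N -> closed T -> T a -> lbound T a -> T b -> ubound T b -> a < b -> dense_scale T ->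
  lagrangian_C r.+1 T L -> weak_local_min T a b L ya yb y ->
  T t -> euler_lagrange T 1 L y t = 0.
Proof.
move=> r0 cT Ta la Tb ub ab D lL hmin Tt.
have int := euler_lagrange_dense_interior r0 cT Ta la Tb ub D lL hmin.
have cEL : cont_at T (euler_lagrange T 1 L y) t.
  have := @euler_lagrange_cont_at _ T 1 r L y t; rewrite !(dense_kappan _ D); apply => // i.
  by apply: lagrangian_jet_dense => //; [case: hmin|exact: (lL.2.1 i).2].
have ba : 0 < b - a by rewrite subr_gt0.
have lt := la _ Tt; have ut := ub _ Tt.
have [ta|ta] := eqVneq t a.
  apply: (cont_at_eq0 ba cEL (D.2 t Tt).2) => s Ts st sd; apply: int => //.
  rewrite ta in st sd; rewrite lt_neqAle eq_sym st la//=.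
  by move: sd; rewrite ltr_distl; lra.
have [tb|tb] := eqVneq t b.
  apply: (cont_at_eq0 ba cEL (D.2 t Tt).2) => s Ts st sd; apply: int => //.
  rewrite tb in st sd; rewrite [s < b]lt_neqAle st ub// andbT.
  by move: sd; rewrite ltr_distl; lra.
by apply: int => //; rewrite !lt_neqAle eq_sym ta tb lt.
Qed.

(** * Euler-Lagrange equation *)

Theorem theorem57 (R : realType) (r : nat) (hr : (1 <= r)%N)
  (T : set R) (hT : time_scale T) (a b : R)
  (ha : T a /\ lbound T a) (hb : T b /\ ubound T b)
  (hcard : (`I_(2 * r).+1 #<= T)%card)
  (a1 a0 : R) (ha1 : 0 < a1)
  (hsigma : forall t : R, T t -> a <= t <= rho T b -> sigma T t = a1 * t + a0)
  (L : R -> 'rV[R]_r.+1 -> R) (hL : lagrangian_C r.+1 (kappan T r) L)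
  (ya yb : 'I_r -> R) (ystar : R -> R)
  (hmin : weak_local_min T a b L ya yb ystar) :
  let Lu (i : 'I_r.+1) (s : R) : R := partial_u i L s (jet T r ystar s) in
  (forall i : 'I_r.+1, deltan_derivable (kappan T r) i (Lu i)) /\
  (forall t : R, T t -> a <= t <= iter (2 * r) (rho T) b ->
     \sum_(i < r.+1) (-1) ^+ i * (1 / a1) ^+ ((i.-1 * i) %/ 2)
                     * deltan (kappan T r) i (Lu i) t = 0).
Proof.
move=> Lu; have [cT _] := hT; have [Ta la] := ha; have [Tb ub] := hb.
have r20 : (0 < 2 * r)%N by rewrite muln_gt0.
have ab : a < b by apply: (@kappan_max_gt_min _ T a b 0 _ Ta la ub hcard).
have hA := affine_scale_compact cT Ta la Tb ub hcard ha1 hsigma.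
have hy : delta_C T (2 * r) ystar by case: hmin.
have cTm m : closed (kappan T m) by have [] := kappan_rho m cT Ta la Tb ub.
suff [reg EL] : (forall i, delta_C (kappan T r) r (Lu i)) /\
    (forall t, kappan T (2 * r) t -> euler_lagrange T a1 L ystar t = 0).
  split=> [i|t Tt /andP[_ tB]].
    have ir : (i <= r)%N by rewrite -ltnS.
    by have [] := delta_C_le ir (reg i).
  by apply: EL; have [_ _ ->] := kappan_rho (2 * r) cT Ta la Tb ub.
have [[a1E a0E]|nI] := pselect (a1 = 1 /\ a0 = 0).
  have D : dense_scale T.
    exact: (dense_scale_affine cT Ta Tb ab (affine_scale_le r20 hA) a1E a0E).
  have lL := hL; rewrite (dense_kappan _ D) in lL.
  split=> [i|t]; rewrite (dense_kappan _ D).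
    by apply: lagrangian_jet_dense => //; exact: (lL.2.1 i).2.
  by rewrite a1E; exact: (euler_lagrange_dense hr cT Ta la Tb ub ab D lL hmin).
have fx p : affine a1 a0 p = p -> a1 != 1.
  move=> Ap; apply/eqP => a1E; apply: nI; split => //.
  by move: Ap; rewrite /affine a1E mul1r => Ap; apply: (addrI p); rewrite addr0.
have reg i : delta_C (kappan T r) r (Lu i).
  exact: (lagrangian_jet_scattered ha1 fx hr hA cTm hy (hL.2.1 i).2).
split => // t kt; have [At|At] := eqVneq (affine a1 a0 t) t; last first.
  exact: (euler_lagrange_scattered ha1 fx hr cT Ta la Tb ub hA hL hmin kt At).
have kt1 : kappa T t by apply: (@kappan_sub _ T 1 (2 * r)).
have lp : limit_point (kappan T (2 * r)) t.
  have kn := fixed_kappan hA r20 kt1 At.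
  have [_ _ _ [/(_ At) lp0 _]] := hA 0%N t r20 kt1.
  have H m : limit_point (kappan T m) t.
    by elim: m => // m IH; exact: (limit_point_kappa (kn m) IH).2.
  exact: H.
apply: (cont_at_eq0 ltr01 (euler_lagrange_cont_at a1 reg kt) lp) => s ks st _.
apply: (euler_lagrange_scattered ha1 fx hr cT Ta la Tb ub hA hL hmin ks).
have [_ e2] := fixed_affine s At.
by rewrite -subr_eq0 e2 mulf_neq0 ?subr_eq0// (fx t At).
Qed.
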